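(* If $a,b,\mu,\nu>0$, $\nu+\mu<1$ and $|\arg z|<\pi$, then the following representation holds true: $$z^{\frac{\mu+\nu}{2}}K_{\mu}(a\sqrt{z})K_{\nu}(b\sqrt{z})=-\frac{\pi}{4}\int_{0}^{\infty}\frac{t^{\frac{\mu+\nu}{2}}}{z+t} \left[J_{\mu}(a\sqrt{t})Y_{\nu}(b\sqrt{t})+J_{\nu}(b\sqrt{t})Y_{\mu}(a\sqrt{t})\right] dt,$$ which can be rewritten as $$z^{\frac{\mu+\nu}{2}}K_{\mu}(a\sqrt{z})K_{\nu}(b\sqrt{z})= \int_{0}^{\infty}e^{-zs}\left[-\frac{\pi}{4}\int_{0}^{\infty}e^{-st}t^{\frac{\mu+\nu}{2}}\left[J_{\mu}(a\sqrt{t})Y_{\nu}(b\sqrt{t})+J_{\nu}(b\sqrt{t})Y_{\mu}(a\sqrt{t})\right] dt\right] ds.$$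
   Context: $K_\mu$ is the modified Bessel function of the second kind, and $J_\mu$, $Y_\mu$ are the Bessel functions of the first and second kinds. The variable $z$ is complex and nonzero; powers, square roots and Bessel functions are taken with their principal branches ($|\arg z|<\pi$).
   Formalization: The second (iterated Laplace) formula is stated only for Re z ≥ 0, z ≠ 0, because for Re z < 0 its outer integral over s diverges; the first formula is stated for all |arg z| < π. *)

(* Defs.v *)
From Stdlib Require Import Reals Factorial.
From Coquelicot Require Import Coquelicot.
Open Scope R_scope.

(** Improper integrals over (0, +oo), both end points being limits. *)
Definition ex_int0oo {V : NormedModule R_AbsRing} (f : R -> V) : Prop :=
  ex_RInt_gen f (at_right 0) (Rbar_locally p_infty).

Definition int0oo {V : CompleteNormedModule R_AbsRing} (f : R -> V) : V :=
  RInt_gen f (at_right 0) (Rbar_locally p_infty).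

Definition Cexp (z : C) : C :=
  (exp (Re z) * cos (Im z), exp (Re z) * sin (Im z)).

(** Principal argument, in (-PI, PI], for [z <> 0]; negative reals have
    argument [PI]. *)
Definition Carg (z : C) : R :=
  if Rle_dec 0 (Im z) then acos (Re z / Cmod z) else - acos (Re z / Cmod z).

Definition Clog (z : C) : C := (ln (Cmod z), Carg z).

(** Principal branches, for [z <> 0]. *)
Definition Cpower (z : C) (x : R) : C := Cexp (RtoC x * Clog z)%C.

Definition Csqrt (z : C) : C := Cpower z (1 / 2).

(** Coquelicot's [Series] is real-valued only. *)
Definition CSeries (u : nat -> C) : C :=
  (Series (fun k => Re (u k)), Series (fun k => Im (u k))).

(** Euler's integral: this is the Gamma function for [x > 0] only.  The Bessel
    series of order [mu] below evaluate it at [mu + 1, mu + 2, ...], so they are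
    meant for [mu > -1]. *)
Definition Gamma (x : R) : R :=
  int0oo (fun t => Rpower t (x - 1) * exp (- t)).

(** Bessel functions of the first and second kinds, at [x > 0].  The formula for
    [BesselY] is the one for non-integer orders (at integers it is to be replaced
    by its limit); together with the restriction on [Gamma], it is meant
    for [0 < mu < 1]. *)
Definition BesselJ (mu x : R) : R :=
  Rpower (x / 2) mu *
  Series (fun k => (-1) ^ k / (INR (fact k) * Gamma (INR k + mu + 1))
                   * (x / 2) ^ (2 * k)).

Definition BesselY (mu x : R) : R :=
  (BesselJ mu x * cos (mu * PI) - BesselJ (- mu) x) / sin (mu * PI).

(** Modified Bessel functions of the first and second kinds, at complex
    [z <> 0], principal branches; same restrictions on the order. *)
Definition BesselI (mu : R) (z : C) : C :=
  (Cpower (z / 2) mu *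
   CSeries (fun k => RtoC (/ (INR (fact k) * Gamma (INR k + mu + 1)))
                     * Cpow (z / 2) (2 * k)))%C.

Definition BesselK (mu : R) (z : C) : C :=
  (RtoC (PI / 2) * (BesselI (- mu) z - BesselI mu z)
   / RtoC (sin (mu * PI)))%C.

(* Main.v *)
(** In the variable [u = log z], the function [z^(mu/2) K_mu(a sqrt z)] is, up to a constant,
    [kk mu (u + 2 ln (a/2))], an entire function of [u].  The product [F] of two such functions
    is bounded for [Re u <= 0] and is [O(exp(((mu+nu)/2 - 1/2) Re u))] for [Re u >= 0],
    uniformly on the strip [|Im u| <= PI].  Cauchy's formula on the plane cut along the negative
    axis then recovers [F] from its jump across the cut, which is the Bessel kernel.  In these
    coordinates Cauchy's formula reads as follows: with [w = exp u], the integral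
    [J(r) = int_(-PI)^PI w (F - F u0) / (w - z) dt] over [u = r + i t] is continuous, its
    derivative is the difference of the boundary values, and it tends to [0] and to
    [- 2 PI F u0] at the two ends.

    The decay of [F] rests on the integral [int exp(-x s - 1/s) s^(-m-1) ds], which solves the
    same differential equation as [kk m] on the real axis and has the same behaviour at [0].
    Hence [kk m] is positive and decreasing there, which bounds [sqrt x * exp x * K_m x] for
    real [x]; an energy estimate on circular arcs carries the bound to the whole cut plane. *)

Require Import Defs.
From Stdlib Require Import Reals Factorial Lra Lia Psatz.
From Coquelicot Require Import Coquelicot.
Open Scope R_scope.

(** * Improper integrals on (0, +oo) *)

(** In the variable [u] the multivalued powers become entire, the two edges of the cut are the lines
    [Im u = PI] and [Im u = - PI], and boundary values need no limit. Subtracting [F u0] removes the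
    pole, so [J] crosses [Re u = Re u0] continuously and no residue is computed; the price is a
    nonzero limit at [+oo], and this limit is the value sought.

    The obstacle is the size of [F] up to the edges. There [x = 2 exp(u/2)] is imaginary, [K_m]
    loses its exponential decay and only [|x|^(-1/2)] survives; for the product, weighted by the
    power of [w], the decay exponent is [1/2 - (mu+nu)/2], positive because [mu + nu < 1]. The
    series defining [kk] shows none of this: on the positive axis it is a difference of two
    functions of size [exp x] that nearly cancel. Hence the detour through a positive integral.

    The Laplace form is restricted to [0 <= Re z]: near [t = 0] the kernel behaves like a power of
    [t], so [phi] decays only like a power of [1/s] and cannot compensate a growing [exp(- z s)]. *)

Notation is_int f l := (is_RInt_gen (V := R_NormedModule) f (at_right 0) (Rbar_locally p_infty) l).

Lemma exp_le x y : x <= y -> exp x <= exp y.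
Proof. intros [H | ->]; [left; now apply exp_increasing | apply Rle_refl]. Qed.

Lemma exp_le_1 x : x <= 0 -> exp x <= 1.
Proof. intros H. rewrite <- exp_0. now apply exp_le. Qed.

Lemma exp_nonneg x : 0 <= exp x.
Proof. left; apply exp_pos. Qed.

Lemma Rabs_exp x : Rabs (exp x) = exp x.
Proof. apply Rabs_pos_eq, exp_nonneg. Qed.

Lemma exp_mul_opp x : exp x * exp (- x) = 1.
Proof. rewrite <- exp_plus, Rplus_opp_r. apply exp_0. Qed.

Lemma ex_derive_cont (f : R -> R) x : ex_derive f x -> continuous f x.
Proof. exact (ex_derive_continuous (V := R_NormedModule) f x). Qed.

Lemma ex_RInt_cont (f : R -> R) a b :
  (forall t, Rmin a b <= t <= Rmax a b -> continuous f t) -> ex_RInt f a b.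
Proof. exact (ex_RInt_continuous (V := R_CompleteNormedModule) f a b). Qed.

Definition contpos (f : R -> R) : Prop := forall t, 0 < t -> continuous f t.

(** Absolute integrability as a uniform bound on truncated integrals: no limit is involved, so it
    passes to dominated functions at once. *)
Definition absint (f : R -> R) : Prop :=
  exists M, forall a b, 0 < a <= b -> RInt (fun t => Rabs (f t)) a b <= M.

Lemma contpos_ex_RInt f a b : contpos f -> 0 < a <= b -> ex_RInt f a b.
Proof.
  intros Hf Hab. apply ex_RInt_cont.
  intros t Ht. apply Hf. rewrite Rmin_left in Ht; lra.
Qed.

Lemma contpos_abs f : contpos f -> contpos (fun t => Rabs (f t)).
Proof.
  intros Hf t Ht. apply (continuous_comp f Rabs); [now apply Hf|].
  apply continuity_pt_filterlim, Rcontinuity_abs.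
Qed.

Lemma contpos_mult f g : contpos f -> contpos g -> contpos (fun t => f t * g t).
Proof.
  intros Hf Hg t Ht. apply (continuous_mult f g); [now apply Hf | now apply Hg].
Qed.

Lemma contpos_derive f : (forall t, 0 < t -> ex_derive f t) -> contpos f.
Proof. intros H t Ht. apply ex_derive_cont. now apply H. Qed.

Lemma RInt_Chasles3 f A a b B : contpos f -> 0 < A -> A <= a -> a <= b -> b <= B ->
  RInt f A B = RInt f A a + RInt f a b + RInt f b B.
Proof.
  intros Hf HA Ha Hab Hb.
  rewrite <- (RInt_Chasles f A b B), <- (RInt_Chasles f A a b);
    try (apply contpos_ex_RInt; [assumption | lra]).
  reflexivity.
Qed.

Lemma is_int_intro (f : R -> R) l : contpos f ->
  (forall eps, 0 < eps -> exists a0 b0, 0 < a0 <= b0 /\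
     forall a b, 0 < a <= a0 -> b0 <= b -> Rabs (RInt f a b - l) < eps) ->
  is_int f l.
Proof.
  intros Hf H. apply filterlimi_locally. intros eps.
  destruct (H eps (cond_pos eps)) as (a0 & b0 & Hab & Hlim).
  apply (Filter_prod _ _ _ (fun a => 0 < a <= a0) (fun b => b0 <= b)).
  - exists (mkposreal a0 (proj1 Hab)). intros y Hy Hy0. split; [assumption|].
    apply Rabs_def2 in Hy. unfold minus, plus, opp in Hy. simpl in Hy. lra.
  - exists b0. intros x Hx. lra.
  - intros a b Ha Hb. exists (RInt f a b). split.
    + apply (RInt_correct f). apply contpos_ex_RInt; [assumption | simpl; lra].
    + apply Hlim; assumption.
Qed.

Lemma is_int_elim (f : R -> R) l : is_int f l ->
  forall eps, 0 < eps -> exists a0 b0, 0 < a0 <= b0 /\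
     forall a b, 0 < a <= a0 -> b0 <= b -> Rabs (RInt f a b - l) < eps.
Proof.
  intros H eps Heps.
  destruct (proj1 (filterlimi_locally _ _) H (mkposreal eps Heps))
    as [P Q [da HP] [M HQ] HPQ].
  set (b0 := Rmax da (M + 1)).
  exists (da / 2), b0.
  assert (Hda := cond_pos da).
  assert (Hb1 : da <= b0) by apply Rmax_l.
  assert (Hb2 : M + 1 <= b0) by apply Rmax_r.
  split; [lra|]. intros a b Ha Hb.
  destruct (HPQ a b) as (y & Hy & Hball).
  - apply HP; [|lra]. apply Rabs_def1; unfold minus, plus, opp; simpl; lra.
  - apply HQ. lra.
  - simpl in Hy. rewrite (is_RInt_unique _ _ _ _ Hy). exact Hball.
Qed.

Lemma is_int_unique (f : R -> R) l : is_int f l -> int0oo f = l.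
Proof. intros H. exact (is_RInt_gen_unique (V := R_CompleteNormedModule) f l H). Qed.

Lemma is_int_int0oo (f : R -> R) l : is_int f l -> is_int f (int0oo f).
Proof. intros H. rewrite (is_int_unique f l); exact H. Qed.

Lemma is_int_scal (f : R -> R) k l : is_int f l -> is_int (fun t => k * f t) (k * l).
Proof. exact (is_RInt_gen_scal (V := R_NormedModule) f k l). Qed.

Lemma is_int_plus (f g : R -> R) l m : is_int f l -> is_int g m -> is_int (fun t => f t + g t) (l + m).
Proof. exact (is_RInt_gen_plus (V := R_NormedModule) f g l m). Qed.

Lemma is_int_minus (f g : R -> R) l m : is_int f l -> is_int g m -> is_int (fun t => f t - g t) (l - m).
Proof. exact (is_RInt_gen_minus (V := R_NormedModule) f g l m). Qed.

Lemma is_int_ext (f g : R -> R) l : (forall t, 0 < t -> f t = g t) -> is_int f l -> is_int g l.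
Proof.
  intros H. apply is_RInt_gen_ext.
  apply (Filter_prod _ _ _ (fun a => 0 < a) (fun b => 0 < b)).
  - exists (mkposreal 1 Rlt_0_1). intros y _ Hy; exact Hy.
  - exists 0. intros; lra.
  - simpl. intros a b Ha Hb x Hx. apply H.
    apply Rlt_trans with (Rmin a b); [now apply Rmin_glb_lt | lra].
Qed.

Lemma int0oo_ext (f g : R -> R) : (forall t, 0 < t -> f t = g t) ->
  (exists l, is_int f l) -> int0oo f = int0oo g.
Proof.
  intros H [l Hl]. rewrite (is_int_unique f l Hl).
  symmetry. apply is_int_unique. now apply (is_int_ext f).
Qed.

(** Only truncations containing [[a0, b0]] need a bound; this is the form that [weighted_bound]
    delivers. *)
Lemma is_int_bound_ends (f : R -> R) l B a0 b0 : is_int f l -> 0 < a0 <= b0 ->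
  (forall a b, 0 < a <= a0 -> b0 <= b -> Rabs (RInt f a b) <= B) -> Rabs l <= B.
Proof.
  intros Hl H0 HB. apply Rnot_lt_le. intros Hlt.
  destruct (is_int_elim f l Hl ((Rabs l - B) / 2)) as (a & b & Hab & H); [lra|].
  set (a1 := Rmin a a0). set (b1 := Rmax b b0).
  assert (Ha1 : 0 < a1) by (now apply Rmin_glb_lt).
  assert (Ha2 : a1 <= a) by apply Rmin_l. assert (Ha3 : a1 <= a0) by apply Rmin_r.
  assert (Hb2 : b <= b1) by apply Rmax_l. assert (Hb3 : b0 <= b1) by apply Rmax_r.
  specialize (H a1 b1 (conj Ha1 Ha2) Hb2). specialize (HB a1 b1 (conj Ha1 Ha3) Hb3).
  assert (Rabs l <= Rabs (RInt f a1 b1) + Rabs (RInt f a1 b1 - l)); [|lra].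
  replace l with (RInt f a1 b1 - (RInt f a1 b1 - l)) at 1 by ring.
  eapply Rle_trans; [apply Rabs_triang|]. rewrite Rabs_Ropp. lra.
Qed.

Lemma is_int_bound (f : R -> R) l B : is_int f l ->
  (forall a b, 0 < a <= b -> Rabs (RInt f a b) <= B) -> Rabs l <= B.
Proof.
  intros Hl HB. apply (is_int_bound_ends f l B 1 1 Hl); [lra|].
  intros a b Ha Hb. apply HB. lra.
Qed.

(** The value is the supremum of the truncated integrals, which increase with the interval. *)
Lemma is_int_nonneg f M : contpos f -> (forall t, 0 < t -> 0 <= f t) ->
  (forall a b, 0 < a <= b -> RInt f a b <= M) ->
  exists l, is_int f l /\ l <= M /\ (forall a b, 0 < a <= b -> RInt f a b <= l).
Proof.
  intros Hf Hpos HM.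
  destruct (completeness (fun y => exists a b, 0 < a <= b /\ y = RInt f a b))
    as [l [Hub Hlub]].
  - exists M. intros y (a & b & Hab & ->). now apply HM.
  - exists (RInt f 1 1), 1, 1. split; [lra | reflexivity].
  - exists l.
    assert (Hle : forall a b, 0 < a <= b -> RInt f a b <= l)
      by (intros a b Hab; apply Hub; now exists a, b).
    split; [|split; [|exact Hle]].
    + apply is_int_intro; [assumption|]. intros eps Heps.
      destruct (Classical_Prop.classic
        (exists a b, 0 < a <= b /\ l - eps < RInt f a b)) as [(a0 & b0 & Hab & Hlt) | Hn].
      * exists a0, b0. split; [assumption|]. intros a b Ha Hb.
        assert (H1 : RInt f a b <= l) by (apply Hle; lra).
        rewrite (RInt_Chasles3 f a a0 b0 b) in *; try lra; try assumption.
        assert (H2 : forall u v, 0 < u <= v -> 0 <= RInt f u v).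
        { intros u v Huv. apply RInt_ge_0; [lra | now apply contpos_ex_RInt|].
          intros x Hx. apply Hpos; lra. }
        assert (H3 := H2 a a0 ltac:(lra)). assert (H4 := H2 b0 b ltac:(lra)).
        apply Rabs_def1; lra.
      * exfalso. assert (l <= l - eps); [|lra].
        apply Hlub. intros y (a & b & Hab & ->).
        apply Rnot_lt_le. intros Hlt. apply Hn. now exists a, b.
    + apply Hlub. intros y (a & b & Hab & ->). now apply HM.
Qed.

(** [f] is the difference of [|f| + f] and [|f|], both nonnegative with bounded truncated
    integrals. *)
Lemma absint_is_int f : contpos f -> absint f -> exists l, is_int f l.
Proof.
  intros Hf [M HM].
  assert (Ha := contpos_abs f Hf).
  destruct (is_int_nonneg (fun t => Rabs (f t)) M) as (l1 & H1 & _);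
    [assumption | intros; apply Rabs_pos | assumption |].
  assert (Hs : contpos (fun t => Rabs (f t) + f t)).
  { intros t Ht. apply (continuous_plus (fun t => Rabs (f t)) f); [now apply Ha | now apply Hf]. }
  destruct (is_int_nonneg (fun t => Rabs (f t) + f t) (2 * M)) as (l2 & H2 & _).
  - assumption.
  - intros t _. pose proof (Rle_abs (- f t)). rewrite Rabs_Ropp in H. lra.
  - intros a b Hab.
    apply Rle_trans with (RInt (fun t => 2 * Rabs (f t)) a b).
    + apply RInt_le; [lra | now apply contpos_ex_RInt | |].
      * apply contpos_ex_RInt; [|assumption]. apply contpos_mult; [|assumption].
        intros t _; apply continuous_const.
      * intros t _. pose proof (Rle_abs (f t)). lra.
    + replace (RInt (fun t => 2 * Rabs (f t)) a b) with (2 * RInt (fun t => Rabs (f t)) a b)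
        by (symmetry; apply (RInt_scal (V := R_CompleteNormedModule) (fun t => Rabs (f t)) a b 2);
            now apply contpos_ex_RInt).
      specialize (HM a b Hab). lra.
  - exists (l2 - l1).
    apply (is_int_ext (fun t => Rabs (f t) + f t - Rabs (f t))); [intros t _; ring|].
    now apply is_int_minus.
Qed.

Lemma absint_correct f : contpos f -> absint f -> is_int f (int0oo f).
Proof. intros Hf Ha. destruct (absint_is_int f Hf Ha) as [l Hl]. now apply (is_int_int0oo f l). Qed.

Lemma absint_le f g : contpos f -> contpos g ->
  (forall t, 0 < t -> Rabs (f t) <= Rabs (g t)) -> absint g -> absint f.
Proof.
  intros Hf Hg H [M HM]. exists M. intros a b Hab.
  eapply Rle_trans; [|apply (HM a b Hab)].
  apply RInt_le; try (apply contpos_ex_RInt; [now apply contpos_abs | assumption]).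
  - lra.
  - intros t Ht. apply H. lra.
Qed.

Lemma RInt_FTC P p a b : (forall t, 0 < t -> is_derive P t (p t)) -> contpos p ->
  0 < a <= b -> RInt p a b = P b - P a.
Proof.
  intros HP Hp Hab. apply is_RInt_unique.
  apply (is_RInt_derive (V := R_CompleteNormedModule) P p a b);
    intros x; rewrite Rmin_left, Rmax_right by lra; intros Hx;
    [apply HP | apply Hp]; lra.
Qed.

(** The dominating function has an explicit bounded primitive, whose oscillation is at most
    [2 * M]. *)
Lemma absint_dom f P p M : contpos f -> contpos p ->
  (forall t, 0 < t -> is_derive P t (p t)) ->
  (forall t, 0 < t -> Rabs (f t) <= p t) ->
  (forall t, 0 < t -> Rabs (P t) <= M) -> absint f.
Proof.
  intros Hf Hp HP Hle HM. exists (2 * M). intros a b Hab.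
  apply Rle_trans with (RInt p a b).
  - apply RInt_le; [lra | apply contpos_ex_RInt; [now apply contpos_abs | lra]
      | now apply contpos_ex_RInt |]. intros t Ht. apply Hle. lra.
  - rewrite (RInt_FTC P p a b HP Hp Hab).
    assert (H1 := HM a ltac:(lra)). assert (H2 := HM b ltac:(lra)).
    apply Rabs_le_between in H1. apply Rabs_le_between in H2. lra.
Qed.

(** The Newton-Leibniz identity is the hypothesis, rather than differentiability of [P]: in
    [cauchy_Re] the primitive is only known to be continuous at one point. *)
Lemma is_int_primitive (P p : R -> R) la lb : contpos p ->
  (forall a b, 0 < a <= b -> RInt p a b = P b - P a) ->
  filterlim P (at_right 0) (locally la) ->
  filterlim P (Rbar_locally p_infty) (locally lb) -> is_int p (lb - la).
Proof.
  intros Hp HP H0 H1. apply is_int_intro; [assumption|]. intros eps Heps.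
  assert (He : 0 < eps / 2) by lra.
  destruct (proj1 (filterlim_locally _ _) H0 (mkposreal _ He)) as [d Hd].
  destruct (proj1 (filterlim_locally _ _) H1 (mkposreal _ He)) as [M HM].
  assert (Hdp := cond_pos d).
  exists (d / 2), (Rmax d (M + 1)).
  assert (Hb1 : d <= Rmax d (M + 1)) by apply Rmax_l.
  assert (Hb2 : M + 1 <= Rmax d (M + 1)) by apply Rmax_r.
  split; [lra|]. intros a b Ha Hb.
  rewrite HP by lra.
  assert (Ea : Rabs (P a - la) < eps / 2).
  { apply (Hd a); [|lra]. apply Rabs_def1; unfold minus, plus, opp; simpl; lra. }
  assert (Eb : Rabs (P b - lb) < eps / 2) by (apply (HM b); lra).
  apply Rabs_def2 in Ea. apply Rabs_def2 in Eb. apply Rabs_def1; lra.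
Qed.

Lemma is_int_FTC (P p : R -> R) la lb : (forall t, 0 < t -> is_derive P t (p t)) ->
  contpos p -> filterlim P (at_right 0) (locally la) ->
  filterlim P (Rbar_locally p_infty) (locally lb) -> is_int p (lb - la).
Proof.
  intros HP Hp. apply is_int_primitive; [assumption|]. intros a b. now apply RInt_FTC.
Qed.

(** The map [t -> c / t] exchanges the two ends; reversing the bounds absorbs the sign of its
    derivative. It serves the inversion symmetry of [GG] and its link with [Gamma]. *)
Lemma is_int_subst_inv (f : R -> R) c l : 0 < c -> contpos f -> is_int f l ->
  is_int (fun t => f (c / t) * (c / t ^ 2)) l.
Proof.
  intros Hc Hf Hl.
  assert (Hdc : forall t, 0 < t -> is_derive (fun t => c / t) t (- (c / t ^ 2))).
  { intros t Ht. auto_derive; [lra|]. field. lra. }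
  assert (Hcc : contpos (fun t => c / t ^ 2)).
  { apply contpos_derive. intros t Ht. auto_derive. intros H; apply Rmult_integral in H; lra. }
  assert (Hcont : contpos (fun t => f (c / t) * (c / t ^ 2))).
  { apply contpos_mult; [|assumption]. intros t Ht.
    apply (continuous_comp (fun t => c / t) f).
    - apply ex_derive_cont. eexists. now apply Hdc.
    - apply Hf. now apply Rdiv_lt_0_compat. }
  apply is_int_intro; [assumption|]. intros eps Heps.
  destruct (is_int_elim f l Hl eps Heps) as (a0 & b0 & Hab & H).
  assert (Hlt : c / b0 <= c / a0).
  { apply Rmult_le_compat_l; [lra|]. apply Rinv_le_contravar; lra. }
  exists (c / b0), (c / a0). split.
  { split; [apply Rdiv_lt_0_compat; lra | exact Hlt]. }
  intros a b Ha Hb.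
  assert (Hb0 : 0 < b). { assert (0 < c / a0) by (apply Rdiv_lt_0_compat; lra). lra. }
  assert (HE : RInt (fun t => f (c / t) * (c / t ^ 2)) a b = RInt f (c / b) (c / a)).
  { assert (Hm : 0 < Rmin a b) by (now apply Rmin_glb_lt).
    rewrite <- (opp_RInt_swap (V := R_CompleteNormedModule) f (c / a) (c / b)).
    2:{ apply ex_RInt_swap, contpos_ex_RInt; [assumption|].
        split; [now apply Rdiv_lt_0_compat|].
        apply Rmult_le_compat_l; [lra|]. apply Rinv_le_contravar; lra. }
    apply is_RInt_unique.
    apply (is_RInt_ext (fun t => opp (scal (- (c / t ^ 2)) (f (c / t))))).
    { intros t Ht. unfold scal, opp; simpl. unfold mult; simpl. ring. }
    apply (is_RInt_opp (V := R_NormedModule)).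
    apply (is_RInt_comp (V := R_CompleteNormedModule) f (fun t => c / t) (fun t => - (c / t ^ 2))).
    - intros x Hx. apply Hf. apply Rdiv_lt_0_compat; lra.
    - intros x Hx. split; [apply Hdc; lra|].
      apply (continuous_opp (fun t => c / t ^ 2)). apply Hcc. lra. }
  rewrite HE. apply H.
  - split; [now apply Rdiv_lt_0_compat|].
    apply Rmult_le_reg_r with (b / a0); [apply Rdiv_lt_0_compat; lra|].
    replace (c / b * (b / a0)) with (c / a0) by (field; lra).
    replace (a0 * (b / a0)) with b by (field; lra). assumption.
  - apply Rmult_le_reg_r with (a / b0); [apply Rdiv_lt_0_compat; lra|].
    replace (c / a * (a / b0)) with (c / b0) by (field; lra).
    replace (b0 * (a / b0)) with a by (field; lra). lra.
Qed.

(** * Laplace integrals *)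

(** All comes from [1 + y <= exp y] at [y] and at [- y]: the left side lies between 0 and
    [y * (exp y - 1)], and [|exp y - 1| <= |y| * exp |y|]. *)
Lemma exp_taylor2 y : Rabs (exp y - 1 - y) <= y ^ 2 * exp (Rabs y).
Proof.
  assert (H1 := exp_ineq1_le y). assert (H2 := exp_ineq1_le (- y)).
  assert (H3 : exp y * exp (- y) = 1) by apply exp_mul_opp.
  assert (H4 := exp_pos y).
  assert (H5 : (1 - y) * exp y <= 1).
  { rewrite <- H3. rewrite (Rmult_comm (exp y)). apply Rmult_le_compat_r; lra. }
  rewrite Rabs_pos_eq by lra.
  destruct (Rle_lt_dec 0 y) as [Hy | Hy].
  - rewrite (Rabs_pos_eq y Hy). nra.
  - rewrite (Rabs_left y Hy).
    nra.
Qed.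

(** A quadratic remainder can be bounded under an integral sign, which replaces dominated
    convergence in [Lint_derive]. *)
Lemma is_derive_quad (f : R -> R) x l C r : 0 < r ->
  (forall d, Rabs d < r -> Rabs (f (x + d) - f x - d * l) <= C * d ^ 2) ->
  is_derive f x l.
Proof.
  intros Hr H. apply is_derive_Reals. intros eps Heps.
  set (C1 := Rmax C 0 + 1).
  assert (HC0 : 0 < C1). { unfold C1. pose proof (Rmax_r C 0). lra. }
  assert (HC : C <= C1). { unfold C1. pose proof (Rmax_l C 0). lra. }
  assert (Hd : 0 < Rmin r (eps / C1)).
  { apply Rmin_glb_lt; [assumption | now apply Rdiv_lt_0_compat]. }
  exists (mkposreal _ Hd). simpl. intros h Hh0 Hh.
  assert (Hh1 : Rabs h < r) by (eapply Rlt_le_trans; [exact Hh | apply Rmin_l]).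
  assert (Hh2 : Rabs h < eps / C1) by (eapply Rlt_le_trans; [exact Hh | apply Rmin_r]).
  specialize (H h Hh1).
  replace ((f (x + h) - f x) / h - l) with ((f (x + h) - f x - h * l) / h) by (field; assumption).
  unfold Rdiv. rewrite Rabs_mult, Rabs_inv.
  assert (Ha : 0 < Rabs h) by (now apply Rabs_pos_lt).
  apply Rmult_lt_reg_r with (Rabs h); [assumption|].
  rewrite Rmult_assoc, Rinv_l, Rmult_1_r by lra.
  eapply Rle_lt_trans; [exact H|].
  rewrite <- (pow2_abs h).
  assert (Rabs h * C1 < eps).
  { replace eps with (eps / C1 * C1) by (field; lra). now apply Rmult_lt_compat_r. }
  nra.
Qed.

(** Nothing is required at [s = 0]: [h] itself need not be integrable, and the Bessel kernel is only
    treated as bounded. *)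
Definition lap (h : R -> R) : Prop :=
  contpos h /\ forall s, 0 < s -> absint (fun t => exp (- (s * t)) * h t).

Definition Lint (h : R -> R) (s : R) : R := int0oo (fun t => exp (- (s * t)) * h t).

Lemma contpos_expmul h s : contpos h -> contpos (fun t => exp (- (s * t)) * h t).
Proof.
  intros H. apply contpos_mult; [|assumption].
  apply contpos_derive. intros t _. auto_derive. exact I.
Qed.

Lemma lap_correct h s : lap h -> 0 < s -> is_int (fun t => exp (- (s * t)) * h t) (Lint h s).
Proof.
  intros [Hc Ha] Hs. apply absint_correct; [now apply contpos_expmul | now apply Ha].
Qed.

Lemma absint_scal f k : contpos f -> absint f -> absint (fun t => k * f t).
Proof.
  intros Hf [M HM]. exists (Rabs k * M). intros a b Hab.
  rewrite (RInt_ext _ (fun t => scal (Rabs k) (Rabs (f t)))).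
  - rewrite (RInt_scal (V := R_CompleteNormedModule) (fun t => Rabs (f t)))
      by (apply contpos_ex_RInt; [now apply contpos_abs | assumption]).
    apply Rmult_le_compat_l; [apply Rabs_pos | now apply HM].
  - intros t _. apply Rabs_mult.
Qed.

(** Half of the exponential pays for the factor: [t * exp(- s t) <= (2/s) * exp(- s t / 2)]. *)
Lemma lap_tmul h : lap h -> lap (fun t => t * h t).
Proof.
  intros [Hc Ha].
  split; [now apply contpos_mult|]. intros s Hs.
  assert (Hc2 := contpos_expmul h (s / 2) Hc).
  apply (absint_le _ (fun t => 2 / s * (exp (- (s / 2 * t)) * h t))).
  - apply contpos_expmul. now apply contpos_mult.
  - apply contpos_mult; [intros t _; apply continuous_const | assumption].
  - intros t Ht.
    rewrite <- !Rmult_assoc, !(Rabs_mult _ (h t)).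
    apply Rmult_le_compat_r; [apply Rabs_pos|].
    assert (H2s : 0 < 2 / s) by (apply Rdiv_lt_0_compat; lra).
    rewrite (Rabs_pos_eq (2 / s * _)) by (apply Rmult_le_pos; [lra | apply exp_nonneg]).
    rewrite Rabs_pos_eq by (apply Rmult_le_pos; [apply exp_nonneg | lra]).
    replace (- (s * t)) with (- (s / 2 * t) + - (s / 2 * t)) by field.
    rewrite exp_plus.
    assert (H1 := exp_ineq1_le (s / 2 * t)). assert (H2 := exp_pos (- (s / 2 * t))).
    assert (H3 : exp (s / 2 * t) * exp (- (s / 2 * t)) = 1)
      by apply exp_mul_opp.
    set (e := exp (- (s / 2 * t))) in *.
    assert (H4 : s / 2 * t * e <= 1) by nra.
    assert (H5 : t * e <= 2 / s).
    { replace (t * e) with (2 / s * (s / 2 * t * e)) by (field; lra).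
      rewrite <- (Rmult_1_r (2 / s)) at 2. apply Rmult_le_compat_l; lra. }
    replace (e * e * t) with (t * e * e) by ring. apply Rmult_le_compat_r; lra.
  - apply (absint_scal (fun t => exp (- (s / 2 * t)) * h t)); [assumption | apply Ha; lra].
Qed.

(** For [|d| < s/2] the second-order remainder of the integrand is at most
    [d^2 * t^2 * |h t| * exp(- s t / 2)], integrable by two uses of [lap_tmul]. *)
Lemma Lint_derive h s : lap h -> 0 < s ->
  is_derive (Lint h) s (- Lint (fun t => t * h t) s).
Proof.
  intros Hh Hs.
  assert (Hth := lap_tmul h Hh). assert (Htth := lap_tmul _ Hth).
  destruct Htth as [Hc2 Ha2]. destruct (Ha2 (s / 2) ltac:(lra)) as [M HM].
  apply (is_derive_quad _ _ _ M (s / 2)); [lra|]. intros d Hd.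
  assert (Hd' := Rabs_def2 _ _ Hd).
  set (F := fun t => exp (- ((s + d) * t)) * h t).
  set (G := fun t => exp (- (s * t)) * h t).
  set (T := fun t => exp (- (s * t)) * (t * h t)).
  set (r := fun t => F t - G t - d * (- T t)).
  assert (IF : is_int F (Lint h (s + d))) by (apply lap_correct; [assumption | lra]).
  assert (IG : is_int G (Lint h s)) by (now apply lap_correct).
  assert (IT : is_int T (Lint (fun t => t * h t) s)) by (now apply lap_correct).
  assert (Ir : is_int r (Lint h (s + d) - Lint h s - d * - Lint (fun t => t * h t) s)).
  { apply (is_int_minus (fun t => F t - G t) (fun t => d * - T t)); [now apply is_int_minus|].
    apply (is_int_scal (fun t => - T t)). now apply (is_RInt_gen_opp (V := R_NormedModule) T). }
  assert (Hc := proj1 Hh). assert (Hct := proj1 Hth).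
  assert (CF : contpos F) by (now apply contpos_expmul).
  assert (CG : contpos G) by (now apply contpos_expmul).
  assert (CT : contpos T) by (now apply contpos_expmul).
  assert (Cr : contpos r).
  { intros t Ht. apply (continuous_minus (fun t => F t - G t) (fun t => d * - T t)).
    - apply (continuous_minus F G); [now apply CF | now apply CG].
    - apply (continuous_scal_r d (fun t => - T t)).
      apply (continuous_opp T). now apply CT. }
  apply (is_int_bound r _ _ Ir). intros a b Hab.
  eapply Rle_trans; [apply abs_RInt_le; [lra | now apply contpos_ex_RInt]|].
  assert (C2 := contpos_abs _ (contpos_expmul _ (s / 2) Hc2)).
  apply Rle_trans with (RInt (fun t => scal (d ^ 2) (Rabs (exp (- (s / 2 * t)) * (t * (t * h t))))) a b).
  - apply RInt_le.
    + lra.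
    + apply contpos_ex_RInt; [now apply contpos_abs | assumption].
    + apply contpos_ex_RInt; [|assumption]. intros t Ht.
      apply (continuous_scal_r (V := R_NormedModule) (d ^ 2)). now apply C2.
    + intros t Ht. unfold scal; simpl; unfold mult; simpl.
      replace (r t) with (exp (- (s * t)) * (exp (- (d * t)) - 1 - (- (d * t))) * h t).
      2:{ unfold r, F, G, T. replace (- ((s + d) * t)) with (- (s * t) + - (d * t)) by ring.
          rewrite exp_plus. ring. }
      replace (exp (- (s / 2 * t)) * (t * (t * h t))) with (exp (- (s / 2 * t)) * t ^ 2 * h t) by ring.
      rewrite !Rabs_mult. rewrite <- Rmult_assoc.
      apply Rmult_le_compat_r; [apply Rabs_pos|].
      rewrite !Rabs_exp.
      rewrite (Rabs_pos_eq (t ^ 2)) by (apply pow2_ge_0).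
      assert (H1 := exp_taylor2 (- (d * t))).
      eapply Rle_trans; [apply Rmult_le_compat_l; [apply exp_nonneg | exact H1]|].
      rewrite Rabs_Ropp, Rabs_mult, (Rabs_pos_eq t) by lra.
      assert (H2 : exp (- (s * t)) * exp (Rabs d * t) <= exp (- (s / 2 * t))).
      { rewrite <- exp_plus. apply exp_le. nra. }
      assert (H3 : 0 <= (d * t) ^ 2) by apply pow2_ge_0.
      replace ((- (d * t)) ^ 2) with ((d * t) ^ 2) by ring.
      replace (d * (d * 1) * (exp (- (s / 2 * t)) * t ^ 2))
        with ((d * t) ^ 2 * exp (- (s / 2 * t))) by ring.
      replace (exp (- (s * t)) * ((d * t) ^ 2 * exp (Rabs d * t)))
        with ((d * t) ^ 2 * (exp (- (s * t)) * exp (Rabs d * t))) by ring.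
      now apply Rmult_le_compat_l.
  - rewrite (RInt_scal (V := R_CompleteNormedModule)) by now apply contpos_ex_RInt.
    rewrite (Rmult_comm M). apply Rmult_le_compat_l; [nra|].
    now apply HM.
Qed.

(** [M] is the total mass of [|h|]; a compact interval carries all of it but [eps]. *)
Lemma absint_tight h : contpos h -> absint h -> exists M, 0 <= M /\
  (forall a b, 0 < a <= b -> RInt (fun t => Rabs (h t)) a b <= M) /\
  forall eps, 0 < eps -> exists a b, 0 < a <= b /\ M - eps < RInt (fun t => Rabs (h t)) a b.
Proof.
  intros Hc [M HM].
  destruct (is_int_nonneg (fun t => Rabs (h t)) M) as (l & Hl & _ & Hle);
    [now apply contpos_abs | intros; apply Rabs_pos | assumption |].
  exists l. split; [|split; [assumption|]].
  - specialize (Hle 1 1 ltac:(lra)). rewrite RInt_point in Hle. exact Hle.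
  - intros eps Heps. destruct (is_int_elim _ _ Hl eps Heps) as (a & b & Hab & H).
    exists a, b. split; [assumption|].
    specialize (H a b ltac:(lra) ltac:(lra)). apply Rabs_def2 in H. lra.
Qed.

Lemma absint_lap h : contpos h -> absint h -> lap h.
Proof.
  intros Hc Ha. split; [assumption|]. intros s Hs.
  apply (absint_le _ h); [now apply contpos_expmul | assumption | | assumption].
  intros t Ht. rewrite Rabs_mult, Rabs_exp.
  rewrite <- (Rmult_1_l (Rabs (h t))) at 2. apply Rmult_le_compat_r; [apply Rabs_pos|].
  apply exp_le_1. nra.
Qed.

(* [M] bounds the total mass of [|h|], so at most [eps] of it lies outside [a, b]. *)
Lemma weighted_bound h w M eps kap a b A B : contpos h -> contpos w ->
  (forall a b, 0 < a <= b -> RInt (fun t => Rabs (h t)) a b <= M) ->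
  M - eps < RInt (fun t => Rabs (h t)) a b -> 0 < A -> A <= a -> a <= b -> b <= B ->
  (forall t, 0 < t -> 0 <= w t <= 1) -> 0 <= kap -> (forall t, a <= t <= b -> w t <= kap) ->
  Rabs (RInt (fun t => w t * h t) A B) <= eps + kap * M.
Proof.
  intros Hc Hw HM Heps HA HAa Hab HbB Hw1 Hk Hkap.
  assert (Ca := contpos_abs h Hc).
  assert (Cw := contpos_mult w h Hw Hc).
  assert (Caw := contpos_abs _ Cw).
  eapply Rle_trans; [apply abs_RInt_le; [lra | apply contpos_ex_RInt; [assumption | lra]]|].
  rewrite (RInt_Chasles3 _ A a b B) by (assumption || lra).
  assert (H1 : forall u v, 0 < u <= v ->
    RInt (fun t => Rabs (w t * h t)) u v <= RInt (fun t => Rabs (h t)) u v).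
  { intros u v Huv. apply RInt_le; [lra | now apply contpos_ex_RInt.. |].
    intros t Ht. destruct (Hw1 t) as [W0 W1]; [lra|].
    rewrite Rabs_mult, (Rabs_pos_eq (w t)) by assumption.
    pose proof (Rabs_pos (h t)). nra. }
  assert (H2 : RInt (fun t => Rabs (w t * h t)) a b <= kap * RInt (fun t => Rabs (h t)) a b).
  { replace (kap * RInt (fun t => Rabs (h t)) a b) with
      (RInt (fun t => scal kap (Rabs (h t))) a b).
    2:{ apply (RInt_scal (V := R_CompleteNormedModule)), contpos_ex_RInt; [assumption | lra]. }
    apply RInt_le; [lra | apply contpos_ex_RInt; [assumption | lra] | |].
    - apply contpos_ex_RInt; [|lra]. intros t Ht.
      apply (continuous_scal_r (V := R_NormedModule) kap). now apply Ca.
    - intros t Ht. destruct (Hw1 t) as [W0 W1]; [lra|].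
      specialize (Hkap t ltac:(lra)).
      rewrite Rabs_mult, (Rabs_pos_eq (w t)) by assumption.
      apply Rmult_le_compat_r; [apply Rabs_pos | assumption]. }
  assert (H3 := HM A B ltac:(lra)).
  rewrite (RInt_Chasles3 (fun t => Rabs (h t)) A a b B) in H3 by (assumption || lra).
  assert (H4 := H1 A a ltac:(lra)). assert (H5 := H1 b B ltac:(lra)).
  assert (H6 := HM a b ltac:(lra)).
  assert (kap * RInt (fun t => Rabs (h t)) a b <= kap * M) by (now apply Rmult_le_compat_l).
  lra.
Qed.

(** On an interval [[a, b]] carrying all but [eps/3] of the mass, the weight [1 - exp(- s t)] is at
    most [s * b]; elsewhere it is at most 1. *)
Lemma Lint_lim_0 h : contpos h -> absint h ->
  filterlim (Lint h) (at_right 0) (locally (int0oo h)).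
Proof.
  intros Hc Ha. apply filterlim_locally. intros eps. assert (He := cond_pos eps).
  destruct (absint_tight h Hc Ha) as (M & HM0 & HM & Ht).
  destruct (Ht (eps / 3) ltac:(lra)) as (a & b & Hab & Hm).
  set (K := b * (M + 1)).
  assert (HK : 0 < K) by (apply Rmult_lt_0_compat; lra).
  exists (mkposreal (eps / 3 / K) ltac:(apply Rdiv_lt_0_compat; lra)).
  intros s Hs Hs0. simpl in Hs. apply Rabs_def2 in Hs.
  unfold minus, plus, opp in Hs; simpl in Hs.
  assert (Hs1 : s < eps / 3 / K) by lra.
  assert (HsK : s * K < eps / 3).
  { replace (eps / 3) with (eps / 3 / K * K) by (field; lra). now apply Rmult_lt_compat_r. }
  assert (I0 := absint_correct h Hc Ha).
  assert (Is := lap_correct h s (absint_lap h Hc Ha) Hs0).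
  assert (Id := is_int_minus _ _ _ _ I0 Is).
  set (w := fun t => 1 - exp (- (s * t))).
  assert (Hw : contpos w) by (apply contpos_derive; intros; unfold w; auto_derive; exact I).
  assert (Hwt : forall t, 0 < t -> 0 <= w t <= s * t).
  { intros t Htp. unfold w. pose proof (exp_ineq1_le (- (s * t))).
    assert (exp (- (s * t)) <= 1) by (apply exp_le_1; nra). lra. }
  apply (is_int_ext _ (fun t => w t * h t)) in Id.
  2:{ intros t _. unfold w. ring. }
  assert (HB : Rabs (int0oo h - Lint h s) <= eps / 3 + s * b * M).
  { apply (is_int_bound_ends _ _ _ a b Id Hab). intros A B HA HB.
    apply (weighted_bound h w M (eps / 3) (s * b) a b A B); try assumption; try lra.
    - intros t Htp. specialize (Hwt t Htp). split; [apply Hwt|].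
      unfold w. pose proof (exp_pos (- (s * t))). lra.
    - apply Rmult_le_pos; lra.
    - intros t Htp. apply Rle_trans with (s * t); [apply Hwt; lra|].
      apply Rmult_le_compat_l; lra. }
  change (Rabs (Lint h s - int0oo h) < eps). rewrite Rabs_minus_sym.
  eapply Rle_lt_trans; [exact HB|]. unfold K in HsK. nra.
Qed.

(** Same splitting as at 0, with the weight [exp(- s t)], at most [exp(- s a)] on [[a, b]]. *)
Lemma Lint_lim_infty h : contpos h -> absint h ->
  filterlim (Lint h) (Rbar_locally p_infty) (locally 0).
Proof.
  intros Hc Ha. apply filterlim_locally. intros eps. assert (He := cond_pos eps).
  destruct (absint_tight h Hc Ha) as (M & HM0 & HM & Ht).
  destruct (Ht (eps / 3) ltac:(lra)) as (a & b & Hab & Hm).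
  (* Chosen so that [(M + 1) * exp(- s a) <= eps / 3], using [exp(- s a) <= 1 / (s a)]. *)
  exists (3 * (M + 1) / (a * eps)). intros s Hs.
  assert (Hae : 0 < a * eps) by nra.
  assert (Hs' : 3 * (M + 1) < s * (a * eps)).
  { replace (3 * (M + 1)) with (3 * (M + 1) / (a * eps) * (a * eps)) by (field; lra).
    now apply Rmult_lt_compat_r. }
  assert (Hs0 : 0 < s). { apply Rnot_le_lt. intros Hn. nra. }
  assert (Is := lap_correct h s (absint_lap h Hc Ha) Hs0).
  set (w := fun t => exp (- (s * t))).
  assert (Hw : contpos w) by (apply contpos_derive; intros; unfold w; auto_derive; exact I).
  assert (HB : Rabs (Lint h s) <= eps / 3 + exp (- (s * a)) * M).
  { apply (is_int_bound_ends _ _ _ a b Is Hab). intros A B HA HB.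
    apply (weighted_bound h w M (eps / 3) (exp (- (s * a))) a b A B); try assumption; try lra.
    - intros t Htp. split; [apply exp_nonneg|].
      apply exp_le_1. nra.
    - apply exp_nonneg.
    - intros t Htp. apply exp_le. nra. }
  change (Rabs (Lint h s - 0) < eps). rewrite Rminus_0_r.
  eapply Rle_lt_trans; [exact HB|].
  assert (H1 := exp_ineq1_le (s * a)).
  assert (H2 : exp (s * a) * exp (- (s * a)) = 1)
    by apply exp_mul_opp.
  assert (H3 := exp_pos (- (s * a))).
  set (e := exp (- (s * a))) in *.
  assert (H4 : s * a * e <= 1) by nra.
  assert (H5 : (M + 1) * e <= eps / 3).
  { apply Rmult_le_reg_l with 3; [lra|].
    apply Rle_trans with (s * (a * eps) * e); [nra|].
    replace (s * (a * eps) * e) with (eps * (s * a * e)) by ring. nra. }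
  nra.
Qed.

(** * The Gamma function and a Macdonald-type integral *)

Lemma at_right_0_intro (P : R -> R) l :
  (forall eps, 0 < eps -> exists d, 0 < d /\ forall t, 0 < t < d -> Rabs (P t - l) < eps) ->
  filterlim P (at_right 0) (locally l).
Proof.
  intros H. apply filterlim_locally. intros eps.
  destruct (H eps (cond_pos eps)) as (d & Hd & Hlim).
  exists (mkposreal d Hd). intros t Ht Ht0. apply Hlim. split; [assumption|].
  apply Rabs_def2 in Ht. unfold minus, plus, opp in Ht; simpl in Ht. lra.
Qed.

Lemma p_infty_intro (P : R -> R) l :
  (forall eps, 0 < eps -> exists N, forall t, N < t -> Rabs (P t - l) < eps) ->
  filterlim P (Rbar_locally p_infty) (locally l).
Proof.
  intros H. apply filterlim_locally. intros eps.
  destruct (H eps (cond_pos eps)) as (N & Hlim). exists N. exact Hlim.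
Qed.

Lemma Rpower_pos x y : 0 < Rpower x y.
Proof. apply exp_pos. Qed.

(** Tangent to the logarithm at [1/d]; a small [d] gives an arbitrarily small slope. *)
Lemma ln_bound d s : 0 < d -> 0 < s -> ln s <= d * s - 1 - ln d.
Proof.
  intros Hd Hs. assert (H := exp_ineq1_le (ln (d * s))).
  rewrite exp_ln in H by nra. rewrite ln_mult in H by assumption. lra.
Qed.

(** The right side is the maximum of the left one, at [1 + y = q]; it is the tangent bound with
    [d = 1/q]. *)
Lemma Rpower_exp_bound q y : 0 < q -> 0 <= y ->
  Rpower (1 + y) q * exp (- y) <= exp (1 - q + q * ln q).
Proof.
  intros Hq Hy. unfold Rpower. rewrite <- exp_plus. apply exp_le.
  assert (H := ln_bound (/ q) (1 + y) ltac:(now apply Rinv_0_lt_compat) ltac:(lra)).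
  rewrite ln_Rinv in H by assumption.
  apply (Rmult_le_compat_l q) in H; [|lra].
  replace (q * (/ q * (1 + y) - 1 - - ln q)) with (1 + y - q + q * ln q) in H by (field; lra).
  lra.
Qed.

Lemma contpos_Rpower y : contpos (fun t => Rpower t y).
Proof. apply contpos_derive. intros t Ht. unfold Rpower. auto_derive. assumption. Qed.

Lemma Rpower_S x y : 0 < x -> Rpower x (y + 1) = x * Rpower x y.
Proof. intros Hx. rewrite Rpower_plus, Rpower_1 by assumption. ring. Qed.

Lemma Rpower_inv x y : 0 < x -> Rpower (/ x) y = Rpower x (- y).
Proof. intros Hx. unfold Rpower. rewrite ln_Rinv by assumption. f_equal. ring. Qed.

Definition hGamma (x t : R) : R := Rpower t (x - 1) * exp (- t).

Lemma contpos_hGamma x : contpos (hGamma x).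
Proof.
  apply contpos_mult; [apply contpos_Rpower|].
  apply contpos_derive. intros t _. auto_derive. exact I.
Qed.

(** One dominating function serves both ends: [t^(x-1) * (1+t)^(-x-1)] has the bounded primitive
    [(t/(1+t))^x / x]. *)
Lemma absint_hGamma x : 0 < x -> absint (hGamma x).
Proof.
  intros Hx. set (C := exp (1 - (x + 1) + (x + 1) * ln (x + 1))).
  assert (HC : 0 < C) by apply exp_pos.
  apply (absint_dom _ (fun t => C * (Rpower (t / (1 + t)) x / x))
           (fun t => C * (Rpower t (x - 1) * Rpower (1 + t) (- (x + 1)))) (C / x)).
  - apply contpos_hGamma.
  - apply contpos_derive. intros t Ht. unfold Rpower. auto_derive. lra.
  - intros t Ht. unfold Rpower. auto_derive.
    { split; [lra|]. split; [|exact I]. apply Rdiv_lt_0_compat; lra. }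
    fold (t / (1 + t)). rewrite ln_div by lra.
    replace (exp ((x - 1) * ln t) * exp (- (x + 1) * ln (1 + t))) with
      (exp (x * (ln t - ln (1 + t))) * / exp (ln t) * / exp (ln (1 + t))).
    + rewrite !exp_ln by lra. field. lra.
    + rewrite <- !exp_Ropp, <- !exp_plus. f_equal. ring.
  - intros t Ht. rewrite Rabs_pos_eq.
    2:{ apply Rmult_le_pos; apply exp_nonneg. }
    assert (H := Rpower_exp_bound (x + 1) t ltac:(lra) ltac:(lra)). fold C in H.
    assert (H1 := Rpower_pos t (x - 1)). assert (H2 := Rpower_pos (1 + t) (x + 1)).
    rewrite Rpower_Ropp.
    replace (C * (Rpower t (x - 1) * / Rpower (1 + t) (x + 1)))
      with (Rpower t (x - 1) * (C * / Rpower (1 + t) (x + 1))) by ring.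
    apply Rmult_le_compat_l; [lra|].
    apply Rmult_le_reg_r with (Rpower (1 + t) (x + 1)); [assumption|].
    rewrite Rmult_assoc, Rinv_l by lra. lra.
  - intros t Ht. rewrite Rabs_pos_eq.
    2:{ apply Rmult_le_pos; [lra|]. apply Rmult_le_pos; [left; apply Rpower_pos|].
        left; now apply Rinv_0_lt_compat. }
    unfold Rdiv. apply Rmult_le_compat_l; [lra|].
    rewrite <- (Rmult_1_l (/ x)) at 2.
    apply Rmult_le_compat_r; [left; now apply Rinv_0_lt_compat|].
    apply exp_le_1.
    fold (t / (1 + t)). assert (ln (t / (1 + t)) <= 0); [|nra].
    rewrite <- ln_1. apply ln_le; [apply Rdiv_lt_0_compat; lra|].
    apply Rmult_le_reg_r with (1 + t); [lra|].
    replace (t / (1 + t) * (1 + t)) with t by (field; lra). lra.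
Qed.

Lemma Gamma_correct x : 0 < x -> is_int (hGamma x) (Gamma x).
Proof. intros Hx. apply absint_correct; [apply contpos_hGamma | now apply absint_hGamma]. Qed.

Lemma is_int_pos f l : contpos f -> (forall t, 0 < t -> 0 < f t) -> is_int f l -> 0 < l.
Proof.
  intros Hc Hp Hl.
  assert (H1 : 0 < RInt f 1 2).
  { apply RInt_gt_0; [lra | intros; apply Hp; lra | intros; apply Hc; lra]. }
  apply Rnot_le_lt. intros Hn.
  destruct (is_int_elim f l Hl (RInt f 1 2) H1) as (a0 & b0 & Hab & H).
  set (a := Rmin a0 1). set (b := Rmax b0 2).
  assert (Ha : 0 < a) by (apply Rmin_glb_lt; lra).
  assert (Ha0 : a <= a0) by apply Rmin_l. assert (Ha1 : a <= 1) by apply Rmin_r.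
  assert (Hb0 : b0 <= b) by apply Rmax_l. assert (Hb1 : 2 <= b) by apply Rmax_r.
  specialize (H a b (conj Ha Ha0) Hb0). apply Rabs_def2 in H.
  rewrite (RInt_Chasles3 f a 1 2 b) in H by (assumption || lra).
  assert (0 <= RInt f a 1).
  { apply RInt_ge_0; [lra | apply contpos_ex_RInt; [assumption | lra]|].
    intros t Ht; left; apply Hp; lra. }
  assert (0 <= RInt f 2 b).
  { apply RInt_ge_0; [lra | apply contpos_ex_RInt; [assumption | lra]|].
    intros t Ht; left; apply Hp; lra. }
  lra.
Qed.

Lemma Gamma_pos x : 0 < x -> 0 < Gamma x.
Proof.
  intros Hx. apply (is_int_pos (hGamma x)); [apply contpos_hGamma | | now apply Gamma_correct].
  intros t _. apply Rmult_lt_0_compat; apply exp_pos.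
Qed.

(** Integration by parts: [x * hGamma x - hGamma (x + 1)] is the derivative of [t^x * exp(- t)],
    which vanishes at both ends. *)
Lemma Gamma_S x : 0 < x -> Gamma (x + 1) = x * Gamma x.
Proof.
  intros Hx.
  assert (I1 := Gamma_correct x Hx). assert (I2 := Gamma_correct (x + 1) ltac:(lra)).
  assert (I3 : is_int (fun t => x * hGamma x t - hGamma (x + 1) t) (x * Gamma x - Gamma (x + 1))).
  { apply (is_int_minus (fun t => x * hGamma x t) (hGamma (x + 1))); [now apply is_int_scal | assumption]. }
  assert (I4 : is_int (fun t => x * hGamma x t - hGamma (x + 1) t) (0 - 0)).
  { set (C := exp (1 - (x + 1) + (x + 1) * ln (x + 1))).
    assert (HC : 0 < C) by apply exp_pos.
    apply (is_int_FTC (fun t => Rpower t x * exp (- t))).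
    - intros t Ht. unfold hGamma. replace (x + 1 - 1) with x by ring.
      unfold Rpower. auto_derive; [assumption|].
      replace (exp ((x - 1) * ln t)) with (exp (x * ln t) * / exp (ln t)).
      + rewrite exp_ln by lra. field. lra.
      + rewrite <- exp_Ropp, <- exp_plus. f_equal. ring.
    - apply contpos_derive. intros t Ht. unfold hGamma, Rpower. auto_derive. tauto.
    - apply at_right_0_intro. intros eps Heps.
      exists (Rpower eps (/ x)). split; [apply Rpower_pos|]. intros t Ht.
      rewrite Rminus_0_r, Rabs_pos_eq
        by (apply Rmult_le_pos; left; [apply Rpower_pos | apply exp_pos]).
      assert (H1 : Rpower t x < eps).
      { replace eps with (Rpower (Rpower eps (/ x)) x).
        - now apply Rlt_Rpower_l.
        - rewrite Rpower_mult, Rinv_l, Rpower_1; lra. }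
      assert (H2 : exp (- t) <= 1) by (apply exp_le_1; lra).
      assert (H3 := Rpower_pos t x). nra.
    - apply p_infty_intro. intros eps Heps. exists (Rmax 0 (C / eps)). intros t Ht.
      assert (Ht0 : 0 < t) by (eapply Rle_lt_trans; [apply Rmax_l | exact Ht]).
      assert (Ht1 : C / eps < t) by (eapply Rle_lt_trans; [apply Rmax_r | exact Ht]).
      rewrite Rminus_0_r, Rabs_pos_eq
        by (apply Rmult_le_pos; left; [apply Rpower_pos | apply exp_pos]).
      assert (H := Rpower_exp_bound (x + 1) t ltac:(lra) ltac:(lra)). fold C in H.
      rewrite Rpower_S in H by lra.
      assert (H1 : Rpower t x <= Rpower (1 + t) x) by (apply Rle_Rpower_l; lra).
      assert (H3 := Rpower_pos t x).
      assert (HCt : C < t * eps).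
      { replace C with (C / eps * eps) by (field; lra). now apply Rmult_lt_compat_r. }
      apply Rmult_lt_reg_l with (1 + t); [lra|]. nra. }
  assert (HE := is_int_unique _ _ I3). rewrite (is_int_unique _ _ I4) in HE. lra.
Qed.

(* [GG al x = int_0^oo exp(-x t - 1/t) t^(al-1) dt], which is [2 x^(-al/2) K_al(2 sqrt x)]. *)
Definition hG (al t : R) : R := exp (- / t) * Rpower t (al - 1).
Definition GG (al x : R) : R := Lint (hG al) x.

Lemma contpos_hG al : contpos (hG al).
Proof.
  apply contpos_mult; [|apply contpos_Rpower].
  apply contpos_derive. intros t Ht. auto_derive. lra.
Qed.

Lemma hG_pos al t : 0 < hG al t.
Proof. apply Rmult_lt_0_compat; apply exp_pos. Qed.

Lemma hG_S al t : 0 < t -> t * hG al t = hG (al + 1) t.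
Proof.
  intros Ht. unfold hG. replace (al + 1 - 1) with (al - 1 + 1) by ring.
  rewrite Rpower_S by assumption. ring.
Qed.

(** The power [t^(al-1)] may blow up at either end. [|ln t| <= d t + d/t + |ln d|], with [d] so
    small that [|al - 1| * d <= min(1, x/2)], lets [exp(-1/t)] and half of [exp(- x t)] absorb
    it. *)
Lemma hG_bound al x : 0 < x -> exists C, 0 < C /\
  forall t, 0 < t -> exp (- (x * t)) * hG al t <= C * exp (- (x / 2 * t)).
Proof.
  intros Hx. set (A := Rabs (al - 1)).
  assert (HA : 0 <= A) by apply Rabs_pos.
  set (e := Rmin 1 (x / 2)).
  assert (He : 0 < e) by (apply Rmin_glb_lt; lra).
  assert (He1 : e <= 1) by apply Rmin_l. assert (He2 : e <= x / 2) by apply Rmin_r.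
  set (d := e / (A + 1)).
  assert (Hd : 0 < d) by (apply Rdiv_lt_0_compat; lra).
  assert (HAd : A * d <= e).
  { unfold d. replace (A * (e / (A + 1))) with (e - e / (A + 1)) by (field; lra).
    fold d. lra. }
  exists (exp (A * Rabs (ln d))). split; [apply exp_pos|]. intros t Ht.
  unfold hG, Rpower. rewrite <- !exp_plus. apply exp_le.
  assert (Hit : 0 < / t) by (now apply Rinv_0_lt_compat).
  assert (H1 := ln_bound d t Hd Ht). assert (H2 := ln_bound d (/ t) Hd Hit).
  rewrite ln_Rinv in H2 by assumption.
  assert (H3 : Rabs (ln t) <= d * t + d * / t + Rabs (ln d)).
  { assert (H4 := Rle_abs (- ln d)). rewrite Rabs_Ropp in H4.
    assert (0 < d * t) by nra. assert (0 < d * / t) by nra.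
    apply Rabs_le. lra. }
  assert (H4 : (al - 1) * ln t <= A * Rabs (ln t)).
  { unfold A. rewrite <- Rabs_mult. apply Rle_abs. }
  apply (Rmult_le_compat_l A) in H3; [|assumption].
  assert (H5 : A * d * t <= x / 2 * t) by (apply Rmult_le_compat_r; lra).
  assert (H6 : A * d * / t <= / t) by (rewrite <- (Rmult_1_l (/ t)) at 2; apply Rmult_le_compat_r; lra).
  lra.
Qed.

Lemma absint_exp f C c : 0 < c -> 0 <= C -> contpos f ->
  (forall t, 0 < t -> Rabs (f t) <= C * exp (- (c * t))) -> absint f.
Proof.
  intros Hc HC Hf Hb.
  apply (absint_dom f (fun t => - (C / c) * exp (- (c * t))) (fun t => C * exp (- (c * t))) (C / c));
    [assumption | | | assumption |].
  - apply contpos_derive. intros t _. auto_derive. exact I.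
  - intros t _. auto_derive; [exact I|]. field. lra.
  - intros t Ht. assert (H : 0 <= C / c) by (apply Rmult_le_pos; [lra | left; now apply Rinv_0_lt_compat]).
    rewrite Rabs_mult, Rabs_Ropp, Rabs_exp, (Rabs_pos_eq (C / c)) by assumption.
    assert (exp (- (c * t)) <= 1) by (apply exp_le_1; nra). nra.
Qed.

Lemma lap_hG al : lap (hG al).
Proof.
  split; [apply contpos_hG|]. intros x Hx. destruct (hG_bound al x Hx) as (C & HC & Hb).
  apply (absint_exp _ C (x / 2)); [lra | lra | apply contpos_expmul, contpos_hG |].
  intros t Ht. rewrite Rabs_pos_eq; [now apply Hb|].
  apply Rmult_le_pos; [apply exp_nonneg | left; apply hG_pos].
Qed.

Lemma GG_pos al x : 0 < x -> 0 < GG al x.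
Proof.
  intros Hx. apply (is_int_pos (fun t => exp (- (x * t)) * hG al t)).
  - apply contpos_expmul, contpos_hG.
  - intros t Ht. apply Rmult_lt_0_compat; [apply exp_pos | apply hG_pos].
  - apply lap_correct; [apply lap_hG | assumption].
Qed.

Lemma GG_derive al x : 0 < x -> is_derive (GG al) x (- GG (al + 1) x).
Proof.
  intros Hx. assert (H := Lint_derive (hG al) x (lap_hG al) Hx).
  replace (GG (al + 1) x) with (Lint (fun t => t * hG al t) x); [exact H|].
  apply int0oo_ext.
  - intros t Ht. now rewrite hG_S.
  - eexists. apply (lap_correct (fun t => t * hG al t)); [|assumption].
    apply lap_tmul, lap_hG.
Qed.

(** The integral of the derivative of [exp(- x t - 1/t) * t^al] is zero. This recurrence becomes the
    differential equation in [GG_exp_derive1]. *)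
Lemma GG_rec al x : 0 < x -> x * GG (al + 1) x = GG (al - 1) x + al * GG al x.
Proof.
  intros Hx. set (E := fun be t => exp (- (x * t)) * hG be t).
  assert (HI : forall be, is_int (E be) (GG be x)) by (intros be; apply lap_correct; [apply lap_hG | assumption]).
  assert (I1 : is_int (fun t => (E (al - 1) t + al * E al t) - x * E (al + 1) t)
    (GG (al - 1) x + al * GG al x - x * GG (al + 1) x)).
  { apply (is_int_minus (fun t => E (al - 1) t + al * E al t)); [|apply is_int_scal, HI].
    apply (is_int_plus (E (al - 1))); [|apply is_int_scal]; apply HI. }
  assert (I2 : is_int (fun t => (E (al - 1) t + al * E al t) - x * E (al + 1) t) (0 - 0)).
  { apply (is_int_FTC (E (al + 1))).
    - intros t Ht. unfold E. rewrite <- !hG_S by assumption.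
      replace (hG al t) with (t * hG (al - 1) t).
      2:{ rewrite hG_S by assumption. f_equal. ring. }
      unfold hG, Rpower.
      apply (is_derive_ext_loc (fun t => exp (- (x * t)) * (exp (- / t) * exp (al * ln t)))).
      { exists (mkposreal t Ht). intros y Hy. apply Rabs_def2 in Hy.
        f_equal. f_equal. f_equal. ring. }
      auto_derive; [lra|].
      replace (exp (al * ln t)) with (exp ((al - 1 - 1) * ln t) * exp (ln t) * exp (ln t)).
      + rewrite exp_ln by assumption. field. lra.
      + rewrite <- !exp_plus. f_equal. ring.
    - apply contpos_derive. intros t Ht. unfold E, hG, Rpower. auto_derive. lra.
    - destruct (hG_bound al x Hx) as (C & HC & Hb).
      apply at_right_0_intro. intros eps Heps. exists (eps / C).
      split; [now apply Rdiv_lt_0_compat|]. intros t Ht. rewrite Rminus_0_r.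
      unfold E. rewrite <- hG_S by lra. specialize (Hb t ltac:(lra)).
      rewrite Rabs_pos_eq.
      2:{ apply Rmult_le_pos; [apply exp_nonneg|]. apply Rmult_le_pos; [lra | left; apply hG_pos]. }
      assert (H1 : exp (- (x / 2 * t)) <= 1) by (apply exp_le_1; nra).
      assert (H2 : C * t < eps).
      { replace eps with (C * (eps / C)) by (field; lra). apply Rmult_lt_compat_l; lra. }
      replace (exp (- (x * t)) * (t * hG al t)) with (t * (exp (- (x * t)) * hG al t)) by ring.
      apply Rle_lt_trans with (t * (C * 1)); [|lra].
      apply Rmult_le_compat_l; [lra|]. eapply Rle_trans; [exact Hb|]. apply Rmult_le_compat_l; lra.
    - destruct (hG_bound (al + 1) x Hx) as (C & HC & Hb).
      apply p_infty_intro. intros eps Heps. exists (Rmax 0 (2 * C / (eps * x))). intros t Ht.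
      assert (Ht0 : 0 < t) by (eapply Rle_lt_trans; [apply Rmax_l | exact Ht]).
      assert (Ht1 : 2 * C / (eps * x) < t) by (eapply Rle_lt_trans; [apply Rmax_r | exact Ht]).
      rewrite Rminus_0_r. specialize (Hb t Ht0).
      rewrite Rabs_pos_eq by (apply Rmult_le_pos; left; [apply exp_pos | apply hG_pos]).
      eapply Rle_lt_trans; [exact Hb|].
      assert (Hex : 0 < eps * x) by nra.
      assert (H2 : 2 * C < t * (eps * x)).
      { replace (2 * C) with (2 * C / (eps * x) * (eps * x)) by (field; lra).
        now apply Rmult_lt_compat_r. }
      assert (H3 := exp_ineq1_le (x / 2 * t)).
      assert (H4 : exp (x / 2 * t) * exp (- (x / 2 * t)) = 1)
        by apply exp_mul_opp.
      assert (H5 := exp_pos (- (x / 2 * t))).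
      set (e := exp (- (x / 2 * t))) in *.
      assert (H6 : x / 2 * t * e < 1) by nra.
      nra. }
  assert (HE := is_int_unique _ _ I1). rewrite (is_int_unique _ _ I2) in HE. lra.
Qed.

(** Substitution [t -> 1/(x t)], which exchanges the two terms of the exponent; it is the symmetry
    [K_(-al) = K_al]. *)
Lemma GG_scale al x : 0 < x -> GG al x = Rpower x (- al) * GG (- al) x.
Proof.
  intros Hx. set (E := fun be t => exp (- (x * t)) * hG be t).
  assert (HI : forall be, is_int (E be) (GG be x)) by (intros be; apply lap_correct; [apply lap_hG | assumption]).
  assert (I1 := is_int_subst_inv (E al) (/ x) (GG al x) ltac:(now apply Rinv_0_lt_compat)
    (contpos_expmul _ x (contpos_hG al)) (HI al)).
  assert (I2 := is_int_scal (E (- al)) (Rpower x (- al)) _ (HI (- al))).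
  apply is_int_unique in I2. apply (is_int_ext _ (fun t => Rpower x (- al) * E (- al) t)) in I1.
  - apply is_int_unique in I1. exact (eq_trans (eq_sym I1) I2).
  - intros t Ht. unfold E, hG.
    replace (x * (/ x / t)) with (/ t) by (field; lra).
    replace (/ (/ x / t)) with (x * t) by (field; lra).
    replace (/ x / t) with (/ (x * t)) by (field; lra).
    rewrite Rpower_inv by nra. rewrite <- Rpower_mult_distr by assumption.
    replace (- (al - 1)) with (- al + 1) by ring. rewrite !Rpower_S by assumption.
    replace (Rpower t (- al)) with (t * Rpower t (- al - 1)).
    + field. lra.
    + rewrite <- Rpower_S by assumption. f_equal. ring.
Qed.

Lemma absint_power f C be : 0 < be -> 0 <= C -> contpos f ->
  (forall t, 0 < t -> Rabs (f t) <= C * Rpower (1 + t) (- (be + 1))) -> absint f.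
Proof.
  intros Hbe HC Hf Hb.
  apply (absint_dom _ (fun t => - (C / be) * Rpower (1 + t) (- be))
           (fun t => C * Rpower (1 + t) (- (be + 1))) (C / be)); [assumption | | | assumption |].
  - apply contpos_derive. intros t Ht. unfold Rpower. auto_derive. lra.
  - intros t Ht. unfold Rpower. auto_derive; [lra|].
    replace (exp (- (be + 1) * ln (1 + t))) with (exp (- be * ln (1 + t)) * / exp (ln (1 + t))).
    + rewrite exp_ln by lra. field. lra.
    + rewrite <- exp_Ropp, <- exp_plus. f_equal. ring.
  - intros t Ht.
    assert (H2x : 0 <= C / be) by (apply Rmult_le_pos; [lra | left; now apply Rinv_0_lt_compat]).
    rewrite Rabs_mult, Rabs_Ropp, (Rabs_pos_eq (C / be)), (Rabs_pos_eq (Rpower _ _)).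
    + rewrite <- (Rmult_1_r (C / be)) at 2. apply Rmult_le_compat_l; [lra|].
      apply exp_le_1.
      assert (0 < ln (1 + t)) by (rewrite <- ln_1; apply ln_increasing; lra). nra.
    + left; apply Rpower_pos.
    + lra.
Qed.

(** By [Rpower_exp_bound] at [1/t], the factor [exp(- 1/t)] pays for [((1+t)/t)^(be+1)]. *)
Lemma absint_hG be : 0 < be -> absint (hG (- be)).
Proof.
  intros Hbe. set (C := exp (1 - (be + 1) + (be + 1) * ln (be + 1))).
  assert (HC : 0 < C) by apply exp_pos.
  apply (absint_power _ C be); [assumption | lra | apply contpos_hG |].
  intros t Ht. rewrite Rabs_pos_eq by (left; apply hG_pos). unfold hG.
  assert (Hit : 0 < / t) by (now apply Rinv_0_lt_compat).
  assert (H := Rpower_exp_bound (be + 1) (/ t) ltac:(lra) ltac:(lra)). fold C in H.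
  replace (1 + / t) with ((1 + t) * / t) in H by (field; lra).
  rewrite <- Rpower_mult_distr, Rpower_inv in H by lra.
  replace (- be - 1) with (- (be + 1)) by ring. rewrite (Rpower_Ropp (1 + t)).
  assert (H2 := Rpower_pos (1 + t) (be + 1)).
  apply Rmult_le_reg_l with (Rpower (1 + t) (be + 1)); [assumption|].
  replace (Rpower (1 + t) (be + 1) * (C * / Rpower (1 + t) (be + 1))) with C by (field; lra).
  lra.
Qed.

Lemma int_hG be : 0 < be -> int0oo (hG (- be)) = Gamma be.
Proof.
  intros Hbe. apply is_int_unique.
  assert (I1 := is_int_subst_inv (hGamma be) 1 _ Rlt_0_1 (contpos_hGamma be) (Gamma_correct be Hbe)).
  apply (is_int_ext _ (hG (- be))) in I1; [assumption|].
  intros t Ht. unfold hGamma, hG. replace (1 / t) with (/ t) by (field; lra).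
  rewrite Rpower_inv by assumption.
  replace (- (be - 1)) with (- be - 1 + 1 + 1) by ring. rewrite !Rpower_S by assumption.
  field. lra.
Qed.

(** The order is negative because only then does the integral converge at [x = 0]. *)
Lemma GG_lim_0 be : 0 < be -> filterlim (GG (- be)) (at_right 0) (locally (Gamma be)).
Proof.
  intros Hbe. rewrite <- int_hG by assumption.
  apply Lint_lim_0; [apply contpos_hG | now apply absint_hG].
Qed.

(** * Complex derivatives *)

(** The scalar field is [C]: this is holomorphy, not differentiability on the real plane. *)
Definition Cderiv (f : C -> C) (z l : C) : Prop :=
  @is_derive C_AbsRing (AbsRing_NormedModule C_AbsRing) f z l.

Lemma Cplus_minus_r (z y : C) : (z + (y - z))%C = y.
Proof. ring. Qed.

Lemma Cderiv_eps f z l : Cderiv f z l <->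
  forall eps, 0 < eps -> exists d, 0 < d /\ forall h, Cmod h < d ->
    Cmod (f (z + h) - f z - h * l)%C <= eps * Cmod h.
Proof.
  split.
  - intros [_ H] eps Heps.
    destruct (H z (fun P HP => HP) (mkposreal eps Heps)) as [d Hd].
    exists d. split; [apply cond_pos|]. intros h Hh.
    specialize (Hd (z + h)%C).
    change (Cmod (z + h - z)%C < d -> Cmod (f (z + h) - f z - (z + h - z) * l)%C
      <= eps * Cmod (z + h - z)%C) in Hd.
    replace (z + h - z)%C with h in Hd by ring. now apply Hd.
  - intros H. split.
    + apply (is_linear_scal_l (K := C_AbsRing) (V := AbsRing_NormedModule C_AbsRing)).
    + intros y Hy.
      assert (Hyz : z = y) by (apply (is_filter_lim_locally_unique (K := C_AbsRing) (V := AbsRing_NormedModule C_AbsRing)); exact Hy).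
      subst y. intros eps.
      destruct (H eps (cond_pos eps)) as (d & Hd & Hb).
      exists (mkposreal d Hd). intros y Hyd.
      change (Cmod (y - z)%C < d) in Hyd.
      specialize (Hb (y - z)%C Hyd).
      rewrite Cplus_minus_r in Hb. exact Hb.
Qed.

Lemma Cderiv_quad f z l K r : 0 < r ->
  (forall h, Cmod h < r -> Cmod (f (z + h) - f z - h * l)%C <= K * Cmod h ^ 2) -> Cderiv f z l.
Proof.
  intros Hr H. apply Cderiv_eps. intros eps Heps.
  set (K1 := Rmax K 0 + 1).
  assert (HK0 : 0 < K1). { unfold K1. pose proof (Rmax_r K 0). lra. }
  assert (HK : K <= K1). { unfold K1. pose proof (Rmax_l K 0). lra. }
  exists (Rmin r (eps / K1)). split.
  { apply Rmin_glb_lt; [assumption | now apply Rdiv_lt_0_compat]. }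
  intros h Hh.
  assert (Hh1 : Cmod h < r) by (eapply Rlt_le_trans; [exact Hh | apply Rmin_l]).
  assert (Hh2 : Cmod h < eps / K1) by (eapply Rlt_le_trans; [exact Hh | apply Rmin_r]).
  eapply Rle_trans; [now apply H|].
  assert (Cmod h * K1 < eps).
  { replace eps with (eps / K1 * K1) by (field; lra). now apply Rmult_lt_compat_r. }
  pose proof (Cmod_ge_0 h). nra.
Qed.

Lemma Cderiv_eq f z l l' : Cderiv f z l -> l = l' -> Cderiv f z l'.
Proof. now intros H <-. Qed.

Lemma Cderiv_const c z : Cderiv (fun _ => c) z (RtoC 0).
Proof. exact (is_derive_const (K := C_AbsRing) (V := AbsRing_NormedModule C_AbsRing) c z). Qed.

Lemma Cderiv_id z : Cderiv (fun u => u) z (RtoC 1).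
Proof. exact (is_derive_id (K := C_AbsRing) z). Qed.

Lemma Cderiv_plus f g z l m : Cderiv f z l -> Cderiv g z m ->
  Cderiv (fun u => f u + g u)%C z (l + m)%C.
Proof. exact (is_derive_plus (K := C_AbsRing) (V := AbsRing_NormedModule C_AbsRing) f g z l m). Qed.

Lemma Cderiv_minus f g z l m : Cderiv f z l -> Cderiv g z m ->
  Cderiv (fun u => f u - g u)%C z (l - m)%C.
Proof. exact (is_derive_minus (K := C_AbsRing) (V := AbsRing_NormedModule C_AbsRing) f g z l m). Qed.

Lemma Cderiv_mult f g z l m : Cderiv f z l -> Cderiv g z m ->
  Cderiv (fun u => f u * g u)%C z (l * g z + f z * m)%C.
Proof. intros Hf Hg. exact (is_derive_mult (K := C_AbsRing) f g z l m Hf Hg Cmult_comm). Qed.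

Lemma Cderiv_comp f g z l m : Cderiv f (g z) l -> Cderiv g z m ->
  Cderiv (fun u => f (g u)) z (m * l)%C.
Proof. exact (is_derive_comp (K := C_AbsRing) (V := AbsRing_NormedModule C_AbsRing) f g z l m). Qed.

Lemma Cderiv_scal c f z l : Cderiv f z l -> Cderiv (fun u => c * f u)%C z (c * l)%C.
Proof.
  intros H. eapply Cderiv_eq; [apply Cderiv_mult; [apply Cderiv_const | exact H]|].
  simpl. ring.
Qed.

Lemma Cderiv_continuous f z l : Cderiv f z l ->
  forall eps, 0 < eps -> exists d, 0 < d /\ forall h, Cmod h < d -> Cmod (f (z + h) - f z)%C < eps.
Proof.
  intros H eps Heps. destruct (proj1 (Cderiv_eps _ _ _) H 1 Rlt_0_1) as (d & Hd & Hb).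
  assert (Hl := Cmod_ge_0 l).
  exists (Rmin d (eps / (Cmod l + 2))). split.
  { apply Rmin_glb_lt; [assumption | apply Rdiv_lt_0_compat; lra]. }
  intros h Hh.
  assert (Hh1 : Cmod h < d) by (eapply Rlt_le_trans; [exact Hh | apply Rmin_l]).
  assert (Hh2 : Cmod h < eps / (Cmod l + 2)) by (eapply Rlt_le_trans; [exact Hh | apply Rmin_r]).
  specialize (Hb h Hh1).
  replace (f (z + h) - f z)%C with ((f (z + h) - f z - h * l) + h * l)%C by ring.
  eapply Rle_lt_trans; [apply Cmod_triangle|]. rewrite (Cmod_mult h l).
  assert (Cmod h * (Cmod l + 2) < eps).
  { replace eps with (eps / (Cmod l + 2) * (Cmod l + 2)) by (field; lra).
    apply Rmult_lt_compat_r; lra. }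
  nra.
Qed.

Lemma Im_le_Cmod c : Rabs (Im c) <= Cmod c.
Proof. eapply Rle_trans; [|apply Rmax_Cmod]. apply Rmax_r. Qed.

Lemma Cmod_le_Re_Im c : Cmod c <= Rabs (Re c) + Rabs (Im c).
Proof.
  destruct c as [x y]. unfold Cmod; simpl.
  apply Rsqr_incr_0_var; [|pose proof (Rabs_pos x); pose proof (Rabs_pos y); lra].
  rewrite Rsqr_sqrt by nra. unfold Rsqr.
  pose proof (Rabs_pos x); pose proof (Rabs_pos y).
  replace (x * (x * 1)) with (Rabs x * Rabs x) by (rewrite <- Rabs_mult, Rabs_pos_eq; nra).
  replace (y * (y * 1)) with (Rabs y * Rabs y) by (rewrite <- Rabs_mult, Rabs_pos_eq; nra).
  nra.
Qed.

(** The passage to real calculus: the directions [v = 1] and [v = Ci] together give the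
    Cauchy-Riemann equations. *)
Lemma Cderiv_line f l (p v : C) t0 : Cderiv f (p + RtoC t0 * v)%C l ->
  is_derive (fun t => Re (f (p + RtoC t * v)%C)) t0 (Re (v * l)%C) /\
  is_derive (fun t => Im (f (p + RtoC t * v)%C)) t0 (Im (v * l)%C).
Proof.
  intros H.
  assert (Hmain : forall eps, 0 < eps -> exists d : posreal, forall h : R, h <> 0 -> Rabs h < d ->
    Cmod (f (p + RtoC (t0 + h) * v) - f (p + RtoC t0 * v) - RtoC h * (v * l))%C < eps * Rabs h).
  { intros eps Heps. assert (Hv := Cmod_ge_0 v).
    destruct (proj1 (Cderiv_eps _ _ _) H (eps / (Cmod v + 1))) as (d & Hd & Hb).
    { apply Rdiv_lt_0_compat; lra. }
    exists (mkposreal (d / (Cmod v + 1)) ltac:(apply Rdiv_lt_0_compat; lra)). simpl.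
    intros h Hh0 Hh. assert (Ha : 0 < Rabs h) by (now apply Rabs_pos_lt).
    assert (Hh2 : Rabs h * (Cmod v + 1) < d).
    { replace d with (d / (Cmod v + 1) * (Cmod v + 1)) by (field; lra).
      apply Rmult_lt_compat_r; lra. }
    specialize (Hb (RtoC h * v)%C).
    rewrite Cmod_mult, Cmod_R in Hb.
    replace (p + RtoC t0 * v + RtoC h * v)%C with (p + RtoC (t0 + h) * v)%C in Hb
      by (rewrite RtoC_plus; ring).
    replace (RtoC h * v * l)%C with (RtoC h * (v * l))%C in Hb by ring.
    eapply Rle_lt_trans; [apply Hb; nra|].
    assert (He : 0 < eps / (Cmod v + 1)) by (apply Rdiv_lt_0_compat; lra).
    replace (eps * Rabs h) with (eps / (Cmod v + 1) * (Rabs h * (Cmod v + 1))) by (field; lra).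
    apply Rmult_lt_compat_l; [assumption|]. nra. }
  assert (Hq : forall x h eps : R, h <> 0 -> Rabs x < eps * Rabs h -> Rabs (x / h) < eps).
  { intros x h eps Hh Hx. assert (Ha : 0 < Rabs h) by (now apply Rabs_pos_lt).
    unfold Rdiv. rewrite Rabs_mult, Rabs_inv. apply Rmult_lt_reg_r with (Rabs h); [assumption|].
    now rewrite Rmult_assoc, Rinv_l, Rmult_1_r by lra. }
  split; apply is_derive_Reals; intros eps Heps; destruct (Hmain eps Heps) as [d Hd];
    exists d; intros h Hh0 Hh; specialize (Hd h Hh0 Hh);
    set (D := (f (p + RtoC (t0 + h) * v) - f (p + RtoC t0 * v) - RtoC h * (v * l))%C) in *.
  - replace (_ - Re (v * l)%C) with (Re D / h) by (unfold D, Re; simpl; field; assumption).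
    apply Hq; [assumption|]. eapply Rle_lt_trans; [apply re_le_Cmod | exact Hd].
  - replace (_ - Im (v * l)%C) with (Im D / h) by (unfold D, Im; simpl; field; assumption).
    apply Hq; [assumption|]. eapply Rle_lt_trans; [apply Im_le_Cmod | exact Hd].
Qed.

(** * The complex exponential *)

Lemma Ceq_intro (a b : C) : Re a = Re b -> Im a = Im b -> a = b.
Proof. destruct a, b. simpl. now intros -> ->. Qed.

Lemma Cexp_plus a b : Cexp (a + b)%C = (Cexp a * Cexp b)%C.
Proof.
  destruct a as [x y], b as [x' y']. unfold Cexp; simpl.
  rewrite exp_plus, cos_plus, sin_plus. apply Ceq_intro; simpl; ring.
Qed.

Lemma Cexp_0 : Cexp (RtoC 0) = RtoC 1.
Proof. unfold Cexp; simpl. rewrite exp_0, cos_0, sin_0. apply Ceq_intro; simpl; ring. Qed.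

Lemma Cmod_Cexp z : Cmod (Cexp z) = exp (Re z).
Proof.
  destruct z as [x y]. unfold Cmod, Cexp; simpl.
  transitivity (sqrt (Rsqr (exp x))); [|apply sqrt_Rsqr; apply exp_nonneg].
  f_equal. unfold Rsqr. pose proof (sin2_cos2 y) as H. unfold Rsqr in H.
  transitivity (exp x * exp x * (sin y * sin y + cos y * cos y)); [ring|].
  rewrite H. ring.
Qed.

Lemma Cexp_neq_0 z : Cexp z <> RtoC 0.
Proof. apply Cmod_gt_0. rewrite Cmod_Cexp. apply exp_pos. Qed.

Lemma Cexp_R x : Cexp (RtoC x) = RtoC (exp x).
Proof. unfold Cexp; simpl. rewrite cos_0, sin_0. apply Ceq_intro; simpl; ring. Qed.

Lemma Cexp_nat k u : Cexp (RtoC (INR k) * u)%C = Cpow (Cexp u) k.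
Proof.
  induction k as [|k IH].
  - simpl. replace (RtoC 0 * u)%C with (RtoC 0) by ring. apply Cexp_0.
  - rewrite S_INR, RtoC_plus. replace ((INR k + 1) * u)%C with (u + INR k * u)%C by ring.
    rewrite Cexp_plus, IH. reflexivity.
Qed.

Lemma exp_nat k x : exp (INR k * x) = exp x ^ k.
Proof.
  induction k as [|k IH].
  - simpl. rewrite Rmult_0_l. apply exp_0.
  - rewrite S_INR. replace ((INR k + 1) * x) with (x + INR k * x) by ring.
    now rewrite exp_plus, IH.
Qed.

Lemma taylor2_bound (p p' p'' : R -> R) K : p 0 = 0 -> p' 0 = 0 ->
  (forall t, is_derive p t (p' t)) -> (forall t, is_derive p' t (p'' t)) ->
  (forall t, 0 <= t <= 1 -> Rabs (p'' t) <= K) -> Rabs (p 1) <= K.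
Proof.
  intros H0 H0' Hd Hd' HK.
  destruct (MVT_gen p 0 1 p') as (c & Hc & E).
  { intros; apply Hd. }
  { intros x _. apply continuity_pt_filterlim, ex_derive_cont.
    eexists; apply Hd. }
  rewrite Rmin_left, Rmax_right in Hc by lra.
  destruct (MVT_gen p' 0 c p'') as (e & He & E').
  { intros; apply Hd'. }
  { intros x _. apply continuity_pt_filterlim, ex_derive_cont.
    eexists; apply Hd'. }
  rewrite Rmin_left, Rmax_right in He by lra.
  replace (p 1) with (p'' e * c) by lra.
  rewrite Rabs_mult, (Rabs_pos_eq c) by lra.
  specialize (HK e ltac:(lra)). pose proof (Rabs_pos (p'' e)). nra.
Qed.

(** The mean value theorem fails for complex values, so the two components of [exp(t h) - 1 - t h]
    are treated apart on [[0, 1]]. Their second derivatives are the components of [h^2 * exp(t h)];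
    adding the two bounds gives the factor 2. *)
Lemma Cexp_taylor2 h : Cmod (Cexp h - RtoC 1 - h)%C <= 2 * exp (Cmod h) * Cmod h ^ 2.
Proof.
  destruct h as [x y]. set (h := (x, y) : C).
  assert (Hm : Cmod h ^ 2 = x ^ 2 + y ^ 2) by (rewrite Cmod2_alt; reflexivity).
  assert (Hx : Rabs x <= Cmod h) by apply (re_le_Cmod h).
  (* The expression is [Re (h^2 * (u + i v))] with [u + i v] of modulus 1. The imaginary part of
     [h^2 * exp(i t y)] has the same form with [(u, v) = (sin, - cos)]. *)
  assert (Hrot : forall u v : R, u ^ 2 + v ^ 2 = 1 ->
    Rabs ((x ^ 2 - y ^ 2) * u - 2 * x * y * v) <= Cmod h ^ 2).
  { intros u v Huv. rewrite Hm, <- (Rabs_pos_eq (x ^ 2 + y ^ 2)) by nra.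
    apply Rsqr_le_abs_0. unfold Rsqr.
    assert (0 <= ((x ^ 2 - y ^ 2) * v + 2 * x * y * u) ^ 2) by apply pow2_ge_0.
    replace ((x ^ 2 + y ^ 2) * (x ^ 2 + y ^ 2))
      with ((x ^ 2 + y ^ 2) * (x ^ 2 + y ^ 2) * (u ^ 2 + v ^ 2)) by (rewrite Huv; ring).
    lra. }
  assert (Hexp : forall t, 0 <= t <= 1 -> exp (t * x) <= exp (Cmod h)).
  { intros t Ht. apply exp_le. pose proof (Rle_abs x). pose proof (Rabs_pos x). nra. }
  assert (Hsc : forall a, cos a ^ 2 + sin a ^ 2 = 1).
  { intros a. pose proof (sin2_cos2 a) as H. unfold Rsqr in H. lra. }
  assert (Hre : Rabs (exp x * cos y - 1 - x) <= exp (Cmod h) * Cmod h ^ 2).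
  { replace (exp x * cos y - 1 - x) with (exp (1 * x) * cos (1 * y) - 1 - 1 * x)
      by (rewrite !Rmult_1_l; ring).
    apply (taylor2_bound (fun t => exp (t * x) * cos (t * y) - 1 - t * x)
      (fun t => exp (t * x) * (x * cos (t * y) - y * sin (t * y)) - x)
      (fun t => exp (t * x) * ((x ^ 2 - y ^ 2) * cos (t * y) - 2 * x * y * sin (t * y)))).
    - rewrite !Rmult_0_l, exp_0, cos_0. ring.
    - rewrite !Rmult_0_l, exp_0, cos_0, sin_0. ring.
    - intros t. auto_derive; [exact I | ring].
    - intros t. auto_derive; [exact I | ring].
    - intros t Ht. rewrite Rabs_mult, Rabs_exp.
      apply Rmult_le_compat; [apply exp_nonneg | apply Rabs_pos | now apply Hexp |].
      apply Hrot, Hsc. }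
  assert (Him : Rabs (exp x * sin y - y) <= exp (Cmod h) * Cmod h ^ 2).
  { replace (exp x * sin y - y) with (exp (1 * x) * sin (1 * y) - 1 * y)
      by (rewrite !Rmult_1_l; ring).
    apply (taylor2_bound (fun t => exp (t * x) * sin (t * y) - t * y)
      (fun t => exp (t * x) * (x * sin (t * y) + y * cos (t * y)) - y)
      (fun t => exp (t * x) * ((x ^ 2 - y ^ 2) * sin (t * y) - 2 * x * y * (- cos (t * y))))).
    - rewrite !Rmult_0_l, sin_0. ring.
    - rewrite !Rmult_0_l, exp_0, cos_0, sin_0. ring.
    - intros t. auto_derive; [exact I | ring].
    - intros t. auto_derive; [exact I | ring].
    - intros t Ht. rewrite Rabs_mult, Rabs_exp.
      apply Rmult_le_compat; [apply exp_nonneg | apply Rabs_pos | now apply Hexp |].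
      apply Hrot. rewrite <- (Hsc (t * y)). ring. }
  eapply Rle_trans; [apply Cmod_le_Re_Im|].
  replace (Re (Cexp h - RtoC 1 - h)%C) with (exp x * cos y - 1 - x) by (simpl; ring).
  replace (Im (Cexp h - RtoC 1 - h)%C) with (exp x * sin y - y) by (simpl; ring).
  lra.
Qed.

Lemma Cderiv_Cexp z : Cderiv Cexp z (Cexp z).
Proof.
  apply (Cderiv_quad _ _ _ (exp (Re z) * (2 * exp 1)) 1 Rlt_0_1). intros h Hh.
  replace (Cexp (z + h) - Cexp z - h * Cexp z)%C with (Cexp z * (Cexp h - RtoC 1 - h))%C
    by (rewrite Cexp_plus; ring).
  rewrite Cmod_mult, Cmod_Cexp, Rmult_assoc.
  apply Rmult_le_compat_l; [apply exp_nonneg|].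
  eapply Rle_trans; [apply Cexp_taylor2|].
  apply Rmult_le_compat_r; [apply pow2_ge_0|].
  apply Rmult_le_compat_l; [lra|]. apply exp_le. lra.
Qed.

Lemma Cderiv_inv f z l : f z <> RtoC 0 -> Cderiv f z l ->
  Cderiv (fun u => / f u)%C z (- l / (f z * f z))%C.
Proof.
  intros Hn H.
  assert (Hinv : Cderiv Cinv (f z) (- / (f z * f z))%C).
  { set (w := f z) in *. assert (Hw : 0 < Cmod w) by (now apply Cmod_gt_0).
    apply (Cderiv_quad _ _ _ (2 / Cmod w ^ 3) (Cmod w / 2)); [lra|]. intros h Hh.
    assert (Hwh : Cmod w / 2 <= Cmod (w + h)%C).
    { assert (Cmod w <= Cmod (w + h)%C + Cmod h); [|lra].
      replace w with ((w + h) + - h)%C at 1 by ring.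
      eapply Rle_trans; [apply Cmod_triangle|]. rewrite Cmod_opp. lra. }
    assert (Hwh0 : (w + h)%C <> RtoC 0) by (apply Cmod_gt_0; lra).
    replace (/ (w + h) - / w - h * - / (w * w))%C with (h * h / (w * w * (w + h)))%C
      by (field; split; assumption).
    rewrite Cmod_div by (repeat apply Cmult_neq_0; assumption).
    rewrite !Cmod_mult.
    replace (2 / Cmod w ^ 3 * Cmod h ^ 2) with (Cmod h * Cmod h / (Cmod w * Cmod w * (Cmod w / 2)))
      by (field; lra).
    apply Rmult_le_compat_l; [pose proof (Cmod_ge_0 h); nra|].
    apply Rinv_le_contravar; [|apply Rmult_le_compat_l; nra].
    repeat apply Rmult_lt_0_compat; lra. }
  eapply Cderiv_eq; [apply (Cderiv_comp Cinv f z _ _ Hinv H)|]. field. assumption.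
Qed.

(** * Exponential series *)

Definition ex_CSeries (u : nat -> C) : Prop := ex_series (fun k => Cmod (u k)).

Lemma ex_series_dom (a b : nat -> R) : (forall k, Rabs (a k) <= b k) -> ex_series b -> ex_series a.
Proof. intros H. exact (ex_series_le (K := R_AbsRing) (V := R_CompleteNormedModule) a b H). Qed.

Lemma ex_series_eq (a b : nat -> R) : (forall k, a k = b k) -> ex_series a -> ex_series b.
Proof. apply (ex_series_ext (K := R_AbsRing)). Qed.

Lemma ex_series_mul (c : R) (a : nat -> R) : ex_series a -> ex_series (fun k => c * a k).
Proof. exact (ex_series_scal_l (K := R_AbsRing) (V := AbsRing_NormedModule R_AbsRing) c a). Qed.

Lemma ex_CSeries_Re u : ex_CSeries u -> ex_series (fun k => Re (u k)).
Proof. apply ex_series_dom. intros k. apply re_le_Cmod. Qed.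

Lemma ex_CSeries_Im u : ex_CSeries u -> ex_series (fun k => Im (u k)).
Proof. apply ex_series_dom. intros k. apply Im_le_Cmod. Qed.

Lemma CSeries_ext u v : (forall k, u k = v k) -> CSeries u = CSeries v.
Proof. intros H. unfold CSeries. f_equal; apply Series_ext; intros k; now rewrite H. Qed.

Lemma ex_CSeries_plus u v : ex_CSeries u -> ex_CSeries v -> ex_CSeries (fun k => u k + v k)%C.
Proof.
  intros Hu Hv. apply (ex_series_dom _ (fun k => Cmod (u k) + Cmod (v k))).
  - intros k. rewrite Rabs_pos_eq by apply Cmod_ge_0. apply Cmod_triangle.
  - exact (ex_series_plus (K := R_AbsRing) (V := R_NormedModule) _ _ Hu Hv).
Qed.

Lemma CSeries_plus u v : ex_CSeries u -> ex_CSeries v ->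
  CSeries (fun k => u k + v k)%C = (CSeries u + CSeries v)%C.
Proof.
  intros Hu Hv. apply Ceq_intro; simpl;
    [rewrite <- (Series_plus _ _ (ex_CSeries_Re u Hu) (ex_CSeries_Re v Hv))
    |rewrite <- (Series_plus _ _ (ex_CSeries_Im u Hu) (ex_CSeries_Im v Hv))]; reflexivity.
Qed.

Lemma ex_CSeries_scal z u : ex_CSeries u -> ex_CSeries (fun k => z * u k)%C.
Proof.
  intros Hu. apply (ex_series_eq (fun k => Cmod z * Cmod (u k))).
  - intros k. now rewrite Cmod_mult.
  - apply (ex_series_mul (Cmod z) (fun k => Cmod (u k)) Hu).
Qed.

Lemma CSeries_scal z u : ex_CSeries u -> CSeries (fun k => z * u k)%C = (z * CSeries u)%C.
Proof.
  intros Hu. assert (HR := ex_CSeries_Re u Hu). assert (HI := ex_CSeries_Im u Hu).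
  assert (Hs : forall (c : R) a, ex_series a -> ex_series (fun k => c * a k)).
  { intros c a Ha. apply (ex_series_mul c a Ha). }
  apply Ceq_intro.
  - change (Series (fun k => Re z * Re (u k) - Im z * Im (u k))
      = Re z * Series (fun k => Re (u k)) - Im z * Series (fun k => Im (u k))).
    rewrite Series_minus by (now apply Hs). now rewrite !Series_scal_l.
  - change (Series (fun k => Re z * Im (u k) + Im z * Re (u k))
      = Re z * Series (fun k => Im (u k)) + Im z * Series (fun k => Re (u k))).
    rewrite Series_plus by (now apply Hs). now rewrite !Series_scal_l.
Qed.

(** The factor 2 comes from summing the components separately; only the order of magnitude matters
    later. *)
Lemma Cmod_CSeries u b : (forall k, Cmod (u k) <= b k) -> ex_series b ->
  Cmod (CSeries u) <= 2 * Series b.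
Proof.
  intros H Hb.
  assert (Hc : forall a, (forall k, Rabs (a k) <= b k) -> Rabs (Series a) <= Series b).
  { intros a Ha. assert (Hea : ex_series (fun k => Rabs (a k))).
    { apply (ex_series_dom _ b); [|assumption]. intros k. rewrite Rabs_Rabsolu. apply Ha. }
    eapply Rle_trans; [apply Series_Rabs; assumption|].
    apply Series_le; [|assumption]. intros k. split; [apply Rabs_pos | apply Ha]. }
  eapply Rle_trans; [apply Cmod_le_Re_Im|]. simpl.
  assert (H1 := Hc (fun k => Re (u k)) (fun k => Rle_trans _ _ _ (re_le_Cmod _) (H k))).
  assert (H2 := Hc (fun k => Im (u k)) (fun k => Rle_trans _ _ _ (Im_le_Cmod _) (H k))).
  lra.
Qed.

Definition entire (c : nat -> R) : Prop := forall r, 0 <= r -> ex_series (fun k => Rabs (c k) * r ^ k).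

(** Differentiation in [u] of a power series in [exp u]: the Euler operator, which shifts no
    index. *)
Definition dcoef (c : nat -> R) (k : nat) : R := INR k * c k.

Lemma INR_le_pow2 k : INR k <= 2 ^ k.
Proof.
  induction k as [|k IH]; [simpl; lra|]. rewrite S_INR. simpl.
  pose proof (pow_R1_Rle 2 k ltac:(lra)). lra.
Qed.

(** The factor [k <= 2^k] is absorbed by doubling the radius. *)
Lemma entire_dcoef c : entire c -> entire (dcoef c).
Proof.
  intros H r Hr. apply (ex_series_dom _ (fun k => Rabs (c k) * (2 * r) ^ k)).
  - intros k. unfold dcoef.
    assert (Hrk := pow_le r k Hr). assert (Hk := INR_le_pow2 k). assert (Hk0 := pos_INR k).
    rewrite Rabs_pos_eq by (apply Rmult_le_pos; [apply Rabs_pos | assumption]).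
    rewrite Rabs_mult, (Rabs_pos_eq (INR k)), Rpow_mult_distr by assumption.
    pose proof (Rabs_pos (c k)).
    replace (INR k * Rabs (c k) * r ^ k) with (Rabs (c k) * (INR k * r ^ k)) by ring.
    apply Rmult_le_compat_l; [assumption|]. now apply Rmult_le_compat_r.
  - apply H. lra.
Qed.

Lemma Re_scal (a : R) (u : C) : Re (RtoC a * u)%C = a * Re u.
Proof. destruct u as [x y]. simpl. ring. Qed.

Lemma Im_scal (a : R) (u : C) : Im (RtoC a * u)%C = a * Im u.
Proof. destruct u as [x y]. simpl. ring. Qed.

(** The monomial [c_k * w^k] at [w = exp u], kept as an exponential because all differentiation is
    in [u]. *)
Definition eser_term (c : nat -> R) (u : C) (k : nat) : C := (RtoC (c k) * Cexp (RtoC (INR k) * u))%C.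
Definition eser (c : nat -> R) (u : C) : C := CSeries (eser_term c u).

Lemma Cmod_eser_term c u k : Cmod (eser_term c u k) = Rabs (c k) * exp (Re u) ^ k.
Proof.
  unfold eser_term. rewrite Cmod_mult, Cmod_R, Cmod_Cexp, <- exp_nat.
  now rewrite Re_scal.
Qed.

Lemma ex_eser_term c u : entire c -> ex_CSeries (eser_term c u).
Proof.
  intros H. apply (ex_series_eq (fun k => Rabs (c k) * exp (Re u) ^ k)).
  - intros k. now rewrite Cmod_eser_term.
  - apply H. apply exp_nonneg.
Qed.

Lemma eser_plus c d u : entire c -> entire d ->
  eser (fun k => c k + d k) u = (eser c u + eser d u)%C.
Proof.
  intros Hc Hd. unfold eser. rewrite <- CSeries_plus by (now apply ex_eser_term).
  apply CSeries_ext. intros k. unfold eser_term. rewrite RtoC_plus. ring.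
Qed.

Lemma eser_scal (a : R) c u : entire c -> eser (fun k => a * c k) u = (RtoC a * eser c u)%C.
Proof.
  intros Hc. unfold eser. rewrite <- CSeries_scal by (now apply ex_eser_term).
  apply CSeries_ext. intros k. unfold eser_term. rewrite RtoC_mult. ring.
Qed.

Lemma entire_scal (a : R) c : entire c -> entire (fun k => a * c k).
Proof.
  intros H r Hr. apply (ex_series_eq (fun k => Rabs a * (Rabs (c k) * r ^ k))).
  - intros k. rewrite Rabs_mult. ring.
  - apply (ex_series_mul (Rabs a)). now apply H.
Qed.

(** Termwise differentiation: [Cexp_taylor2] at [k h], [|h| < 1], bounds the k-th remainder by
    [2 |h|^2 * k^2 |c_k| * exp(k (Re u + 1))], which is summable. *)
Lemma eser_deriv c u : entire c -> Cderiv (eser c) u (eser (dcoef c) u).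
Proof.
  intros Hc. assert (Hd := entire_dcoef c Hc). assert (Hdd := entire_dcoef _ Hd).
  set (r := exp (Re u + 1)).
  assert (Hr : 0 <= r) by (apply exp_nonneg).
  set (b := fun k => Rabs (dcoef (dcoef c) k) * r ^ k).
  assert (Hb : ex_series b) by (now apply Hdd).
  apply (Cderiv_quad _ _ _ (4 * Series b) 1 Rlt_0_1). intros h Hh.
  replace (eser c (u + h) - eser c u - h * eser (dcoef c) u)%C
    with (CSeries (fun k => eser_term c (u + h) k + (- RtoC 1 * eser_term c u k + - h * eser_term (dcoef c) u k))%C).
  2:{ set (p := fun k => (- RtoC 1 * eser_term c u k)%C). set (q := fun k => (- h * eser_term (dcoef c) u k)%C).
      assert (Hp : ex_CSeries p) by exact (ex_CSeries_scal _ _ (ex_eser_term c u Hc)).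
      assert (Hq : ex_CSeries q) by exact (ex_CSeries_scal _ _ (ex_eser_term _ u Hd)).
      change (CSeries (fun k => eser_term c (u + h) k + (p k + q k))%C
        = (eser c (u + h) - eser c u - h * eser (dcoef c) u)%C).
      rewrite (CSeries_plus (eser_term c (u + h)) (fun k => p k + q k)%C (ex_eser_term c _ Hc) (ex_CSeries_plus p q Hp Hq)).
      rewrite (CSeries_plus p q Hp Hq). unfold p, q.
      rewrite (CSeries_scal _ _ (ex_eser_term c u Hc)), (CSeries_scal _ _ (ex_eser_term _ u Hd)).
      unfold eser. ring. }
  replace (4 * Series b * Cmod h ^ 2) with (2 * Series (fun k => 2 * Cmod h ^ 2 * b k))
    by (rewrite Series_scal_l; ring).
  apply Cmod_CSeries.
  2:{ apply (ex_series_mul (2 * Cmod h ^ 2) b Hb). }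
  intros k. unfold eser_term, dcoef at 1.
  replace (RtoC (c k) * Cexp (RtoC (INR k) * (u + h)) + (- RtoC 1 * (RtoC (c k) * Cexp (RtoC (INR k) * u))
     + - h * (RtoC (INR k * c k) * Cexp (RtoC (INR k) * u))))%C
    with (RtoC (c k) * Cexp (RtoC (INR k) * u) * (Cexp (RtoC (INR k) * h) - RtoC 1 - RtoC (INR k) * h))%C.
  2:{ replace (RtoC (INR k) * (u + h))%C with (RtoC (INR k) * u + RtoC (INR k) * h)%C by ring.
      rewrite Cexp_plus, RtoC_mult. ring. }
  rewrite !Cmod_mult, Cmod_R, Cmod_Cexp.
  assert (Hk0 := pos_INR k).
  assert (Ht := Cexp_taylor2 (RtoC (INR k) * h)%C).
  rewrite Cmod_mult, Cmod_R, (Rabs_pos_eq (INR k)) in Ht by assumption.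
  rewrite Re_scal.
  unfold b, dcoef. rewrite !Rabs_mult, !(Rabs_pos_eq (INR k)) by assumption.
  unfold r. rewrite <- exp_nat.
  assert (He : exp (INR k * Re u) * exp (INR k * Cmod h) <= exp (INR k * (Re u + 1))).
  { rewrite <- exp_plus. apply exp_le. nra. }
  assert (Hc0 := Rabs_pos (c k)). assert (Heu := exp_pos (INR k * Re u)).
  apply Rle_trans with (Rabs (c k) * exp (INR k * Re u) *
    (2 * exp (INR k * Cmod h) * (INR k * Cmod h) ^ 2)).
  - apply Rmult_le_compat_l; [|assumption]. apply Rmult_le_pos; lra.
  - replace (Rabs (c k) * exp (INR k * Re u) * (2 * exp (INR k * Cmod h) * (INR k * Cmod h) ^ 2))
      with (2 * Cmod h ^ 2 * (INR k * (INR k * Rabs (c k))) * (exp (INR k * Re u) * exp (INR k * Cmod h))) by ring.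
    replace (2 * Cmod h ^ 2 * (INR k * (INR k * Rabs (c k)) * exp (INR k * (Re u + 1))))
      with (2 * Cmod h ^ 2 * (INR k * (INR k * Rabs (c k))) * exp (INR k * (Re u + 1))) by ring.
    apply Rmult_le_compat_l; [|assumption].
    pose proof (pow2_ge_0 (Cmod h)).
    apply Rmult_le_pos; [lra|]. apply Rmult_le_pos; [assumption|]. now apply Rmult_le_pos.
Qed.

Lemma CSeries_incr_1 u : ex_CSeries u -> CSeries u = (u O + CSeries (fun k => u (S k)))%C.
Proof.
  intros H. apply Ceq_intro.
  - exact (Series_incr_1 _ (ex_CSeries_Re u H)).
  - exact (Series_incr_1 _ (ex_CSeries_Im u H)).
Qed.

Lemma entire_shift c : entire c -> entire (fun k => c (S k)).
Proof.
  (* The radius [r + 1] is at least 1, so that one more power does not decrease the term. *)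
  intros H r Hr. apply (ex_series_dom _ (fun k => Rabs (c (S k)) * (r + 1) ^ S k)).
  - intros k. rewrite Rabs_pos_eq by (apply Rmult_le_pos; [apply Rabs_pos | now apply pow_le]).
    apply Rmult_le_compat_l; [apply Rabs_pos|].
    apply Rle_trans with ((r + 1) ^ k); [apply pow_incr; lra|].
    apply Rle_pow; [lra | lia].
  - apply (ex_series_incr_1 (K := R_AbsRing) (V := R_NormedModule) (fun k => Rabs (c k) * (r + 1) ^ k)).
    apply H. lra.
Qed.

Lemma eser_first c u : entire c -> eser c u = (RtoC (c O) + Cexp u * eser (fun k => c (S k)) u)%C.
Proof.
  intros Hc. unfold eser. rewrite CSeries_incr_1, <- CSeries_scal
    by (apply ex_eser_term; try apply entire_shift; assumption).
  f_equal.
  - unfold eser_term. replace (RtoC (INR 0) * u)%C with (RtoC 0) by (simpl; ring). rewrite Cexp_0. ring.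
  - apply CSeries_ext. intros k. unfold eser_term. rewrite S_INR, RtoC_plus.
    replace ((INR k + 1) * u)%C with (u + INR k * u)%C by ring. rewrite Cexp_plus. ring.
Qed.

Lemma Cexp_conj u : Cexp (Cconj u) = Cconj (Cexp u).
Proof.
  destruct u as [x y]. apply Ceq_intro; simpl.
  - now rewrite cos_neg.
  - rewrite sin_neg. ring.
Qed.

Lemma Cconj_plus a b : Cconj (a + b)%C = (Cconj a + Cconj b)%C.
Proof. apply Ceq_intro; simpl; ring. Qed.

Lemma Cconj_opp a : Cconj (- a)%C = (- Cconj a)%C.
Proof. apply Ceq_intro; simpl; ring. Qed.

Lemma Cconj_mult a b : Cconj (a * b)%C = (Cconj a * Cconj b)%C.
Proof. apply Ceq_intro; simpl; ring. Qed.

Lemma Cconj_R (a : R) : Cconj (RtoC a) = RtoC a.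
Proof. apply Ceq_intro; simpl; ring. Qed.

Lemma eser_conj c u : eser c (Cconj u) = Cconj (eser c u).
Proof.
  assert (H : forall k, eser_term c (Cconj u) k = Cconj (eser_term c u k)).
  { intros k. unfold eser_term. rewrite Cconj_mult, <- Cexp_conj, Cconj_mult, !Cconj_R. reflexivity. }
  apply Ceq_intro.
  - change (Series (fun k => Re (eser_term c (Cconj u) k)) = Series (fun k => Re (eser_term c u k))).
    apply Series_ext. intros k. now rewrite H.
  - change (Series (fun k => Im (eser_term c (Cconj u) k)) = - Series (fun k => Im (eser_term c u k))).
    rewrite <- Series_opp. apply Series_ext. intros k. now rewrite H.
Qed.

Lemma eser_bound c u : entire c -> Re u <= 0 -> Cmod (eser c u) <= 2 * Series (fun k => Rabs (c k)).
Proof.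
  intros Hc Hu. apply Cmod_CSeries.
  - intros k. rewrite Cmod_eser_term.
    assert (H : exp (Re u) ^ k <= 1).
    { rewrite <- (pow1 k). apply pow_incr. split; [apply exp_nonneg|].
      rewrite <- exp_0. now apply exp_le. }
    pose proof (Rabs_pos (c k)). nra.
  - apply (ex_series_eq (fun k => Rabs (c k) * 1 ^ k)).
    + intros k. rewrite pow1. apply Rmult_1_r.
    + apply Hc. lra.
Qed.

(** * Coefficients of the Bessel series and the differential equation of [kk] *)

Definition bcoef (m : R) (k : nat) : R := / (INR (fact k) * Gamma (INR k + m + 1)).

Lemma bcoef_pos m k : -1 < m -> 0 < bcoef m k.
Proof.
  intros Hm. apply Rinv_0_lt_compat, Rmult_lt_0_compat.
  - apply lt_0_INR, lt_O_fact.
  - apply Gamma_pos. pose proof (pos_INR k). lra.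
Qed.

(** [eser (bcoef m) u] is [w^(-m/2) * I_m(2 sqrt w)], and this recurrence carries its differential
    equation. *)
Lemma bcoef_S m k : -1 < m -> (INR k + 1) * (INR k + 1 + m) * bcoef m (S k) = bcoef m k.
Proof.
  intros Hm. unfold bcoef. rewrite fact_simpl, mult_INR, !S_INR.
  assert (Hk := pos_INR k).
  assert (Hg : 0 < Gamma (INR k + m + 1)) by (apply Gamma_pos; lra).
  replace (INR k + 1 + m + 1) with (INR k + m + 1 + 1) by ring.
  rewrite Gamma_S by lra.
  assert (Hf := INR_fact_neq_0 k). field. repeat split; lra.
Qed.

Lemma bcoef_entire m : -1 < m -> entire (bcoef m).
Proof.
  intros Hm r Hr.
  assert (HCV : CV_radius (bcoef m) = p_infty).
  { apply CV_radius_infinite_DAlembert.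
    - intros n. apply Rgt_not_eq. now apply bcoef_pos.
    - apply (is_lim_seq_ext (fun k => / (INR k + 1) * / (INR k + 1 + m))).
      + intros k. assert (Hk := pos_INR k). assert (Hp := bcoef_pos m (S k) Hm).
        rewrite <- (bcoef_S m k Hm).
        rewrite Rabs_pos_eq.
        * field. repeat split; lra.
        * apply Rmult_le_pos; [lra|]. left. apply Rinv_0_lt_compat.
          apply Rmult_lt_0_compat; [|assumption]. apply Rmult_lt_0_compat; lra.
      + replace (Finite 0) with (Rbar_mult 0 0) by (simpl; f_equal; ring).
        apply is_lim_seq_mult'; apply is_lim_seq_inv with (l := p_infty); try discriminate.
        * apply is_lim_seq_plus with p_infty 1; [apply is_lim_seq_INR | apply is_lim_seq_const | exact eq_refl].
        * apply is_lim_seq_plus with p_infty m; [|apply is_lim_seq_const | exact eq_refl].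
          apply is_lim_seq_plus with p_infty 1; [apply is_lim_seq_INR | apply is_lim_seq_const | exact eq_refl]. }
  apply (ex_series_eq (fun k => Rabs (bcoef m k * r ^ k))).
  - intros k. rewrite Rabs_mult, (Rabs_pos_eq (r ^ k)) by (now apply pow_le). reflexivity.
  - apply CV_disk_inside. rewrite HCV. exact I.
Qed.

(* Up to a constant, [w^(m/2) K_m(2 sqrt w)] at [w = Cexp u]. *)
Definition kk (m : R) (u : C) : C :=
  (eser (bcoef (- m)) u - Cexp (RtoC m * u) * eser (bcoef m) u)%C.

Definition kk' (m : R) (u : C) : C :=
  (eser (dcoef (bcoef (- m))) u
   - Cexp (RtoC m * u) * (RtoC m * eser (bcoef m) u + eser (dcoef (bcoef m)) u))%C.

Lemma Cderiv_Cexp_lin (a : C) u : Cderiv (fun u => Cexp (a * u)%C) u (a * Cexp (a * u))%C.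
Proof.
  apply (Cderiv_comp Cexp (fun u => a * u)%C u (Cexp (a * u)) a); [apply Cderiv_Cexp|].
  eapply Cderiv_eq; [apply Cderiv_scal, Cderiv_id | ring].
Qed.

Lemma kk_deriv m u : -1 < m < 1 -> Cderiv (kk m) u (kk' m u).
Proof.
  intros Hm. eapply Cderiv_eq.
  - apply Cderiv_minus; [apply eser_deriv, bcoef_entire; lra|].
    apply Cderiv_mult; [apply Cderiv_Cexp_lin | apply eser_deriv, bcoef_entire; lra].
  - unfold kk'. ring.
Qed.

(** On coefficients the left side multiplies by [k (k + m)]; by [bcoef_S] this is a shift of the
    index, that is a factor [exp u]. *)
Lemma eser_bcoef_ode m u : -1 < m ->
  (eser (dcoef (dcoef (bcoef m))) u + RtoC m * eser (dcoef (bcoef m)) u)%C = (Cexp u * eser (bcoef m) u)%C.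
Proof.
  intros Hm. assert (H0 := bcoef_entire m Hm). assert (H1 := entire_dcoef _ H0).
  assert (H2 := entire_dcoef _ H1).
  rewrite (eser_first (dcoef (dcoef _)) u H2), (eser_first (dcoef _) u H1).
  replace (dcoef (dcoef (bcoef m)) 0) with 0 by (unfold dcoef; simpl; ring).
  replace (dcoef (bcoef m) 0) with 0 by (unfold dcoef; simpl; ring).
  rewrite Cplus_0_l, Cplus_0_l, Cmult_assoc, (Cmult_comm (RtoC m)), <- Cmult_assoc, <- Cmult_plus_distr_l.
  rewrite <- eser_scal, <- eser_plus by (try apply entire_scal; now apply entire_shift). f_equal.
  apply CSeries_ext. intros k. unfold eser_term. do 2 f_equal.
  unfold dcoef. rewrite <- (bcoef_S m k Hm), S_INR. ring.
Qed.

(** So [kk'' = m kk' + exp(u) kk]: both [eser (bcoef (- m))] and [exp(m u) * eser (bcoef m)] solve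
    this equation. *)
Lemma kk'_deriv m u : -1 < m < 1 ->
  Cderiv (kk' m) u (RtoC m * kk' m u + Cexp u * kk m u)%C.
Proof.
  intros Hm.
  assert (He : entire (bcoef m)) by (apply bcoef_entire; lra).
  assert (He' : entire (bcoef (- m))) by (apply bcoef_entire; lra).
  eapply Cderiv_eq.
  - apply Cderiv_minus; [apply eser_deriv, entire_dcoef; assumption|].
    apply Cderiv_mult; [apply Cderiv_Cexp_lin |].
    apply Cderiv_plus; [apply Cderiv_scal, eser_deriv; assumption | apply eser_deriv, entire_dcoef; assumption].
  - assert (H1 := eser_bcoef_ode m u ltac:(lra)). assert (H2 := eser_bcoef_ode (- m) u ltac:(lra)).
    rewrite RtoC_opp in H2. unfold kk, kk'.
    replace (eser (dcoef (dcoef (bcoef m))) u) with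
      (Cexp u * eser (bcoef m) u - RtoC m * eser (dcoef (bcoef m)) u)%C by (rewrite <- H1; ring).
    replace (eser (dcoef (dcoef (bcoef (- m)))) u) with
      (Cexp u * eser (bcoef (- m)) u + RtoC m * eser (dcoef (bcoef (- m))) u)%C by (rewrite <- H2; ring).
    ring.
Qed.

Lemma kk_conj m u : kk m (Cconj u) = Cconj (kk m u).
Proof.
  unfold kk, Cminus. rewrite Cconj_plus, Cconj_opp, Cconj_mult, !eser_conj, <- Cexp_conj.
  now rewrite Cconj_mult, Cconj_R.
Qed.

Lemma kk_bound_left m : 0 < m < 1 -> exists K, 0 < K /\ forall u, Re u <= 0 -> Cmod (kk m u) <= K.
Proof.
  intros Hm.
  set (A := 2 * Series (fun k => Rabs (bcoef (- m) k))).
  set (B := 2 * Series (fun k => Rabs (bcoef m k))).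
  exists (Rabs A + Rabs B + 1). split.
  { pose proof (Rabs_pos A). pose proof (Rabs_pos B). lra. }
  intros u Hu. eapply Rle_trans; [apply Cmod_triangle|].
  rewrite Cmod_opp, Cmod_mult, Cmod_Cexp.
  assert (H1 : Cmod (eser (bcoef (- m)) u) <= A) by (apply eser_bound; [apply bcoef_entire; lra | assumption]).
  assert (H2 : Cmod (eser (bcoef m) u) <= B) by (apply eser_bound; [apply bcoef_entire; lra | assumption]).
  assert (H3 : exp (Re (RtoC m * u)%C) <= 1).
  { apply exp_le_1. rewrite Re_scal. nra. }
  pose proof (Rle_abs A). pose proof (Rle_abs B). pose proof (Cmod_ge_0 (eser (bcoef m) u)).
  nra.
Qed.

(** * Identification on the real axis *)

Lemma is_derive_eq (f : R -> R) (x l l' : R) : is_derive f x l -> l = l' -> is_derive f x l'.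
Proof. now intros H <-. Qed.

Lemma is_derive_mul_exp (f p : R -> R) r f' p' l : is_derive f r f' -> is_derive p r p' ->
  l = (f' + p' * f r) * exp (p r) -> is_derive (fun t => f t * exp (p t)) r l.
Proof.
  intros Hf Hp ->.
  refine (is_derive_eq _ _ _ _ (is_derive_mult f (fun t => exp (p t)) r _ _ Hf
    (is_derive_comp exp p r _ _ (is_derive_exp _) Hp) Rmult_comm) _).
  unfold plus, mult, scal; simpl; unfold mult; simpl. ring.
Qed.

Lemma Cderiv_R f l x : Cderiv f (RtoC x) l ->
  is_derive (fun t => Re (f (RtoC t))) x (Re l).
Proof.
  intros H. assert (E : forall t, (RtoC 0 + RtoC t * RtoC 1)%C = RtoC t) by (intros; ring).
  rewrite <- (E x) in H. apply Cderiv_line in H. destruct H as [H _].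
  replace (Re l) with (Re (RtoC 1 * l)%C) by (rewrite Re_scal; ring).
  apply (is_derive_ext (fun t => Re (f (RtoC 0 + RtoC t * RtoC 1)%C))); [|assumption].
  intros t. now rewrite E.
Qed.

Lemma is_lim_exp_mul_m a : 0 < a -> is_lim (fun r => exp (a * r)) m_infty 0.
Proof.
  intros Ha. apply (is_lim_comp exp (fun r => a * r) m_infty 0 m_infty).
  - apply is_lim_exp_m.
  - replace m_infty with (Rbar_mult a m_infty) at 2.
    + apply is_lim_scal_l. apply is_lim_id.
    + simpl. destruct (Rle_dec 0 a) as [H | H]; [|lra].
      destruct (Rle_lt_or_eq_dec 0 a H); [reflexivity | lra].
  - exists 0. intros y _. discriminate.
Qed.

Lemma is_lim_eser_m c : entire c -> is_lim (fun r => Re (eser c (RtoC r))) m_infty (c O).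
Proof.
  intros Hc. assert (Hs := entire_shift c Hc).
  set (K := 2 * Series (fun k => Rabs (c (S k)))).
  assert (H : is_lim (fun r => Re (eser c (RtoC r)) - c O) m_infty 0).
  { apply (is_lim_le_le_loc (fun r => - (K * exp r)) (fun r => K * exp r)).
    - exists 0. intros r Hr. apply Rabs_le_between.
      rewrite (eser_first c _ Hc).
      change (Rabs (c O + Re (Cexp (RtoC r) * eser (fun k => c (S k)) (RtoC r))%C - c O) <= K * exp r).
      replace (c O + Re (Cexp (RtoC r) * eser (fun k => c (S k)) (RtoC r))%C - c O)
        with (Re (Cexp (RtoC r) * eser (fun k => c (S k)) (RtoC r))%C) by ring.
      eapply Rle_trans; [apply re_le_Cmod|]. rewrite Cmod_mult, Cmod_Cexp, Rmult_comm.
      apply Rmult_le_compat_r; [apply exp_nonneg|].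
      apply (eser_bound (fun k => c (S k))); [assumption | simpl; lra].
    - replace (Finite 0) with (Rbar_opp (Rbar_mult K 0)) by (simpl; f_equal; ring).
      apply is_lim_opp, is_lim_scal_l, is_lim_exp_m.
    - replace (Finite 0) with (Rbar_mult K 0) by (simpl; f_equal; ring).
      apply is_lim_scal_l, is_lim_exp_m. }
  apply (is_lim_ext (fun r => (Re (eser c (RtoC r)) - c O) + c O)); [intros; ring|].
  replace (Finite (c O)) with (Finite (0 + c O)) by (f_equal; ring).
  apply is_lim_plus'; [assumption | apply is_lim_const].
Qed.

Lemma is_lim_comp_exp (f : R -> R) l : filterlim f (at_right 0) (locally l) ->
  is_lim (fun r => f (exp r)) m_infty l.
Proof.
  intros H. assert (H1 := filterlim_comp _ _ _ exp f (Rbar_locally m_infty) (at_right 0) (locally l)).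
  apply H1; [|assumption].
  intros P [d Hd]. destruct (is_lim_exp_m (fun y => ball 0 d y)) as [M HM].
  - exists d. tauto.
  - exists M. intros x Hx. apply Hd; [now apply HM | apply exp_pos].
Qed.

Lemma nonincreasing_of_deriv (f f' : R -> R) a b : a <= b ->
  (forall t, a <= t <= b -> is_derive f t (f' t)) ->
  (forall t, a <= t <= b -> f' t <= 0) -> f b <= f a.
Proof.
  intros Hab Hd Hn. destruct (MVT_gen f a b f') as (c & Hc & E).
  - intros x Hx. rewrite Rmin_left, Rmax_right in Hx by lra. apply Hd. lra.
  - intros x Hx. rewrite Rmin_left, Rmax_right in Hx by lra.
    apply continuity_pt_filterlim, ex_derive_cont.
    eexists. apply Hd. lra.
  - rewrite Rmin_left, Rmax_right in Hc by lra. specialize (Hn c Hc). nra.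
Qed.

Lemma nonneg_vanish (W : R -> R) : (forall r, 0 <= W r) ->
  (forall r s, r <= s -> W s <= W r) -> is_lim W m_infty 0 -> forall r, W r = 0.
Proof.
  intros H0 Hmono Hlim r. apply Rle_antisym; [|apply H0].
  apply Rnot_lt_le. intros Hlt.
  destruct (proj1 (filterlim_locally (F := Rbar_locally m_infty) _ _) Hlim (mkposreal _ Hlt)) as [M HM].
  set (s := Rmin r (M - 1)).
  assert (Hs1 : s <= r) by apply Rmin_l. assert (Hs2 : s <= M - 1) by apply Rmin_r.
  specialize (HM s ltac:(lra)). change (Rabs (W s - 0) < W r) in HM.
  rewrite Rminus_0_r, Rabs_pos_eq in HM by apply H0.
  specialize (Hmono s r Hs1). lra.
Qed.

Section RealAxis.
Variable m : R.
Hypothesis Hm : 0 < m < 1.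

Let y r := Re (kk m (RtoC r)).
Let y1 r := Re (kk' m (RtoC r)).
Let v r := GG (- m) (exp r).
Let v1 r := - (exp r * GG (1 - m) (exp r)).

Lemma kk_real_derive r : is_derive y r (y1 r).
Proof. apply Cderiv_R, kk_deriv. lra. Qed.

Lemma kk'_real_derive r : is_derive y1 r (m * y1 r + exp r * y r).
Proof.
  assert (H := Cderiv_R _ _ _ (kk'_deriv m (RtoC r) ltac:(lra))).
  replace (m * y1 r + exp r * y r)
    with (Re (RtoC m * kk' m (RtoC r) + Cexp (RtoC r) * kk m (RtoC r))%C); [exact H|].
  rewrite Cexp_R. unfold y, y1. rewrite <- !Re_scal. reflexivity.
Qed.

Lemma GG_exp_derive r : is_derive v r (v1 r).
Proof.
  unfold v, v1. assert (H := GG_derive (- m) (exp r) (exp_pos r)).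
  replace (- m + 1) with (1 - m) in H by ring.
  assert (H1 := is_derive_comp (GG (- m)) exp r _ _ H (is_derive_exp r)).
  replace (- (exp r * GG (1 - m) (exp r))) with (exp r * - GG (1 - m) (exp r)) by ring. exact H1.
Qed.

Lemma GG_exp_derive1 r : is_derive v1 r (m * v1 r + exp r * v r).
Proof.
  unfold v, v1. assert (H := GG_derive (1 - m) (exp r) (exp_pos r)).
  assert (H1 := is_derive_comp (GG (1 - m)) exp r _ _ H (is_derive_exp r)).
  assert (H2 := is_derive_mult exp (fun r => GG (1 - m) (exp r)) r _ _ (is_derive_exp r) H1 Rmult_comm).
  apply (is_derive_opp (V := R_NormedModule)) in H2.
  assert (Hr := GG_rec (1 - m) (exp r) (exp_pos r)).
  replace (1 - m - 1) with (- m) in Hr by ring.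
  refine (is_derive_eq _ _ _ _ H2 _).
  unfold opp, plus, mult, scal; simpl; unfold mult; simpl.
  replace (GG (- m) (exp r)) with (exp r * GG (1 - m + 1) (exp r) - (1 - m) * GG (1 - m) (exp r))
    by (rewrite Hr; ring).
  ring.
Qed.

(* Both sides solve [y'' - m y' = exp(r) y]; their difference [d] and [e = exp(-m r) d'] tend
   to [0] at [-oo], and Gronwall's argument started from there gives [d = 0]. *)
Lemma kk_eq_GG r : GG (- m) (exp r) = Gamma m * Gamma (1 - m) * Re (kk m (RtoC r)) /\
  - (exp r * GG (1 - m) (exp r)) = Gamma m * Gamma (1 - m) * Re (kk' m (RtoC r)).
Proof.
  assert (Hg1 := Gamma_pos m ltac:(lra)). assert (Hg2 := Gamma_pos (1 - m) ltac:(lra)).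
  (* At [-oo] the integral tends to [Gamma m] and [kk m] to [1 / Gamma (1 - m)]. *)
  set (c := Gamma m * Gamma (1 - m)).
  assert (He : entire (bcoef m)) by (apply bcoef_entire; lra).
  assert (He' : entire (bcoef (- m))) by (apply bcoef_entire; lra).
  set (d := fun r => v r - c * y r).
  (* This weight gives the system [d' = exp(m r) e], [e' = exp((1-m) r) d], whose coefficients are
     integrable at [-oo] because [0 < m < 1]. *)
  set (e := fun r => exp (- m * r) * (v1 r - c * y1 r)).
  assert (Dd : forall r, is_derive d r (exp (m * r) * e r)).
  { intros s. unfold d, e.
    replace (exp (m * s) * (exp (- m * s) * (v1 s - c * y1 s))) with (v1 s - c * y1 s).
    2:{ rewrite <- Rmult_assoc, <- exp_plus. replace (m * s + - m * s) with 0 by ring.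
        rewrite exp_0. ring. }
    apply (is_derive_minus (V := R_NormedModule) v (fun r => c * y r)); [apply GG_exp_derive|].
    apply (is_derive_scal y s c), kk_real_derive. }
  assert (De : forall r, is_derive e r (exp ((1 - m) * r) * d r)).
  { intros s.
    assert (H1 : is_derive (fun r => v1 r - c * y1 r) s
      (m * v1 s + exp s * v s - c * (m * y1 s + exp s * y s))).
    { apply (is_derive_minus (V := R_NormedModule) v1 (fun r => c * y1 r)); [apply GG_exp_derive1|].
      apply (is_derive_scal y1 s c), kk'_real_derive. }
    assert (H2 : is_derive (fun r => exp (- m * r)) s (- m * exp (- m * s))).
    { auto_derive; [exact I | ring]. }
    assert (H3 := is_derive_mult _ _ s _ _ H2 H1 Rmult_comm).
    refine (is_derive_eq _ _ _ _ H3 _).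
    unfold plus, mult; simpl. unfold d.
    replace ((1 - m) * s) with (- m * s + s) by ring. rewrite exp_plus. ring. }
  assert (Ld : is_lim d m_infty 0).
  { unfold d. replace (Finite 0) with (Finite (Gamma m - c * bcoef (- m) 0)).
    2:{ f_equal. unfold bcoef, c. simpl. replace (0 + - m + 1) with (1 - m) by ring. field. lra. }
    apply is_lim_minus'.
    - apply (is_lim_comp_exp (GG (- m))). apply GG_lim_0. lra.
    - apply (is_lim_scal_l y c m_infty (bcoef (- m) 0)).
      unfold y, kk.
      apply (is_lim_ext (fun r => Re (eser (bcoef (- m)) (RtoC r)) - exp (m * r) * Re (eser (bcoef m) (RtoC r)))).
      { intros s. rewrite <- RtoC_mult, Cexp_R.
        change (Re (eser (bcoef (- m)) s) - exp (m * s) * Re (eser (bcoef m) s) =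
          Re (eser (bcoef (- m)) s) - Re (RtoC (exp (m * s)) * eser (bcoef m) s)%C). now rewrite Re_scal. }
      replace (Finite (bcoef (- m) 0)) with (Finite (bcoef (- m) 0 - 0 * bcoef m 0)) by (f_equal; ring).
      apply is_lim_minus'; [now apply is_lim_eser_m|].
      apply (is_lim_mult _ _ m_infty 0 (bcoef m 0)); [apply is_lim_exp_mul_m; lra | now apply is_lim_eser_m | exact I]. }
  (* [GG_scale] turns [exp((1-m) r) * GG (1 - m)] into [GG (m - 1)], which tends to [Gamma (1 - m)].
     The other side tends to [c * m / Gamma (m + 1)], the same number: one constant matches both
     initial data. *)
  assert (Le : is_lim e m_infty 0).
  { apply (is_lim_ext (fun r => - GG (- (1 - m)) (exp r) -
      c * (exp ((1 - m) * r) * Re (eser (fun k => dcoef (bcoef (- m)) (S k)) (RtoC r)) -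
       (m * Re (eser (bcoef m) (RtoC r)) + Re (eser (dcoef (bcoef m)) (RtoC r)))))).
    { intros s. unfold e, v1, y1.
      rewrite (GG_scale (1 - m) (exp s)) by apply exp_pos.
      unfold Rpower. rewrite ln_exp. unfold kk'.
      rewrite (eser_first (dcoef (bcoef (- m)))) by (now apply entire_dcoef).
      replace (dcoef (bcoef (- m)) 0) with 0 by (unfold dcoef; simpl; ring).
      rewrite <- RtoC_mult, !Cexp_R.
      replace (Re (RtoC 0 + RtoC (exp s) * eser (fun k => dcoef (bcoef (- m)) (S k)) s -
        RtoC (exp (m * s)) * (RtoC m * eser (bcoef m) s + eser (dcoef (bcoef m)) s))%C)
      with (exp s * Re (eser (fun k => dcoef (bcoef (- m)) (S k)) s) -
        exp (m * s) * (m * Re (eser (bcoef m) s) + Re (eser (dcoef (bcoef m)) s))) by (simpl; ring).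
      replace (exp ((1 - m) * s)) with (exp (- m * s) * exp s) by (rewrite <- exp_plus; f_equal; ring).
      assert (E1 : exp (- m * s) * exp (m * s) = 1).
      { rewrite <- exp_plus. replace (- m * s + m * s) with 0 by ring. apply exp_0. }
      assert (E2 : exp (- m * s) * exp s * exp (- (1 - m) * s) = 1).
      { rewrite <- !exp_plus. replace (- m * s + s + - (1 - m) * s) with 0 by ring. apply exp_0. }
      set (G := GG (- (1 - m)) (exp s)) in *.
      set (A := Re (eser (fun k => dcoef (bcoef (- m)) (S k)) s)) in *.
      set (B := m * Re (eser (bcoef m) s) + Re (eser (dcoef (bcoef m)) s)) in *.
      transitivity (- (exp (- m * s) * exp s * exp (- (1 - m) * s)) * G
        - c * (exp (- m * s) * exp s * A - exp (- m * s) * exp (m * s) * B)); [|ring].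
      rewrite E1, E2. ring. }
    replace (Finite 0) with (Finite (- Gamma (1 - m) - c * (0 * dcoef (bcoef (- m)) 1
      - (m * bcoef m 0 + dcoef (bcoef m) 0)))).
    2:{ f_equal. set (Q := dcoef (bcoef (- m)) 1). unfold dcoef, bcoef, c. simpl.
        replace (0 + m + 1) with (m + 1) by ring. rewrite Gamma_S by lra. field. lra. }
    apply is_lim_minus'.
    - apply (is_lim_opp (fun r => GG (- (1 - m)) (exp r)) m_infty (Gamma (1 - m))).
      apply (is_lim_comp_exp (GG (- (1 - m)))). apply GG_lim_0. lra.
    - apply (is_lim_scal_l _ c m_infty (Finite _)). apply is_lim_minus'.
      + apply (is_lim_mult _ _ m_infty 0 (dcoef (bcoef (- m)) 1)).
        * apply is_lim_exp_mul_m; lra.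
        * apply (is_lim_eser_m (fun k => dcoef (bcoef (- m)) (S k))). now apply entire_shift, entire_dcoef.
        * exact I.
      + apply is_lim_plus'; [|now apply is_lim_eser_m, entire_dcoef].
        apply (is_lim_scal_l _ m m_infty (Finite _)). now apply is_lim_eser_m. }
  (* A primitive of the sum of the two coefficients. Since [(d^2 + e^2)' = 2 g' d e], the derivative
     of [W] is [- g' (d - e)^2 exp(- g)]. *)
  set (g := fun r => exp (m * r) / m + exp ((1 - m) * r) / (1 - m)).
  set (W := fun r => (d r ^ 2 + e r ^ 2) * exp (- g r)).
  assert (HW : forall r, W r = 0).
  { apply nonneg_vanish.
    - intros s. apply Rmult_le_pos; [nra | apply exp_nonneg].
    - intros s t Hst.
      apply (nonincreasing_of_deriv W (fun r => - ((exp (m * r) + exp ((1 - m) * r)) * (d r - e r) ^ 2 * exp (- g r)))).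
      + assumption.
      + intros x _. unfold W, g. specialize (Dd x). specialize (De x).
        assert (Exd : ex_derive d x) by (eexists; exact Dd).
        assert (Exe : ex_derive e x) by (eexists; exact De).
        auto_derive; [tauto|].
        replace (Derive (fun x => d x) x) with (exp (m * x) * e x) by (symmetry; now apply is_derive_unique).
        replace (Derive (fun x => e x) x) with (exp ((1 - m) * x) * d x) by (symmetry; now apply is_derive_unique).
        unfold Rdiv, Rminus. field. lra.
      + intros x _. pose proof (exp_pos (m * x)). pose proof (exp_pos ((1 - m) * x)).
        pose proof (exp_pos (- g x)). pose proof (pow2_ge_0 (d x - e x)).
        assert (0 <= (exp (m * x) + exp ((1 - m) * x)) * (d x - e x) ^ 2 * exp (- g x)); [|lra].
        apply Rmult_le_pos; [apply Rmult_le_pos|]; lra.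
    - apply (is_lim_le_le_loc (fun _ => 0) (fun r => d r * d r + e r * e r)).
      + exists 0. intros s _. unfold W.
        assert (0 < exp (- g s) <= 1).
        { split; [apply exp_pos|]. apply exp_le_1. unfold g.
          assert (0 < exp (m * s) / m) by (apply Rdiv_lt_0_compat; [apply exp_pos | lra]).
          assert (0 < exp ((1 - m) * s) / (1 - m)) by (apply Rdiv_lt_0_compat; [apply exp_pos | lra]).
          lra. }
        split; nra.
      + apply is_lim_const.
      + replace (Finite 0) with (Finite (0 * 0 + 0 * 0)) by (f_equal; ring).
        apply is_lim_plus'; apply (is_lim_mult _ _ m_infty 0 0); try assumption; exact I. }
  specialize (HW r). apply Rmult_integral in HW.
  destruct HW as [HW | HW]; [|pose proof (exp_pos (- g r)); lra].
  assert (d r = 0) by nra. assert (e r = 0) by nra.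
  unfold d, v, y in H. split; [lra|].
  unfold e, v1, y1 in H0. apply Rmult_integral in H0.
  destruct H0 as [H0 | H0]; [pose proof (exp_pos (- m * r)); lra | lra].
Qed.

End RealAxis.

Lemma Lint_nonincreasing h x x' : lap h -> (forall t, 0 < t -> 0 <= h t) -> 0 < x <= x' ->
  Lint h x' <= Lint h x.
Proof.
  intros Hh Hpos Hx.
  apply (nonincreasing_of_deriv (Lint h) (fun x => - Lint (fun t => t * h t) x)); [lra | |].
  - intros t Ht. apply Lint_derive; [assumption | lra].
  - intros t Ht. assert (Ht0 : 0 < t) by lra.
    assert (Hc := contpos_expmul _ t (proj1 (lap_tmul h Hh))).
    assert (I := lap_correct _ t (lap_tmul h Hh) Ht0).
    assert (0 <= Lint (fun t => t * h t) t); [|lra].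
    apply Rnot_lt_le. intros Hn.
    destruct (is_int_elim _ _ I (- Lint (fun t => t * h t) t)) as (a & b & Hab & H); [lra|].
    specialize (H a b ltac:(lra) ltac:(lra)). apply Rabs_def2 in H.
    assert (0 <= RInt (fun u => exp (- (t * u)) * (u * h u)) a b); [|lra].
    apply RInt_ge_0; [lra | now apply contpos_ex_RInt|].
    intros u Hu. apply Rmult_le_pos; [apply exp_nonneg|].
    apply Rmult_le_pos; [lra | apply Hpos; lra].
Qed.

Lemma GG_nonincreasing al x x' : 0 < x <= x' -> GG al x' <= GG al x.
Proof.
  intros Hx. apply Lint_nonincreasing; [apply lap_hG | intros; left; apply hG_pos | assumption].
Qed.

(** * Decay in the cut plane *)

Lemma real_of_conj (z : C) : Cconj z = z -> z = RtoC (Re z).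
Proof.
  destruct z as [x y]. intros H. apply (f_equal Im) in H. simpl in H.
  apply Ceq_intro; simpl; lra.
Qed.

Lemma kk_RtoC m r : kk m (RtoC r) = RtoC (Re (kk m (RtoC r))).
Proof. apply real_of_conj. rewrite <- kk_conj. now rewrite Cconj_R. Qed.

Lemma kk'_RtoC m r : kk' m (RtoC r) = RtoC (Re (kk' m (RtoC r))).
Proof.
  apply real_of_conj. unfold kk', Cminus.
  rewrite Cconj_plus, Cconj_opp, Cconj_mult, Cconj_plus, Cconj_mult, <- !eser_conj, <- Cexp_conj.
  now rewrite Cconj_mult, !Cconj_R.
Qed.

Lemma lim0_nonneg (f f' : R -> R) : (forall r, is_derive f r (f' r)) -> (forall r, f' r <= 0) ->
  (forall eps, 0 < eps -> exists N, forall r, N < r -> Rabs (f r) < eps) -> forall r, 0 <= f r.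
Proof.
  intros Hd Hn Hlim r. apply Rnot_lt_le. intros Hlt.
  destruct (Hlim (- f r)) as [N HN]; [lra|].
  set (s := Rmax r (N + 1)).
  assert (Hs1 : r <= s) by apply Rmax_l. assert (Hs2 : N + 1 <= s) by apply Rmax_r.
  assert (H1 := nonincreasing_of_deriv f f' r s Hs1 (fun t _ => Hd t) (fun t _ => Hn t)).
  specialize (HN s ltac:(lra)). apply Rabs_def2 in HN. lra.
Qed.

Lemma exp_double x : exp x = exp (x / 2) * exp (x / 2).
Proof. rewrite <- exp_plus. f_equal. field. Qed.

(* On the positive axis [M r = exp(s r + 2 exp(r/2)) y r] is, up to a constant,
   [sqrt x * exp x * K_m x] at [x = 2 exp(r/2)]; its logarithmic derivative is integrable. *)
Section RealBound.
Variable m : R.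
Hypothesis Hm : 0 < m < 1.

Let y r := Re (kk m (RtoC r)).
Let y1 r := Re (kk' m (RtoC r)).
(** [s] converts [kk m] into [sqrt x * exp x * K_m x], and [a = 1/2 - s]. [k4] is a quarter of
    [m^2 - 1/4], the coefficient of [1/x^2] in the equation of [sqrt x * K_m x]. *)
Let s := 1 / 4 - m / 2.
Let a := m / 2 + 1 / 4.
Let k4 := m ^ 2 / 4 - 1 / 16.
Let kap := Rabs k4.
Let M r := exp (s * r + 2 * exp (r / 2)) * y r.
Let M1 r := exp (s * r + 2 * exp (r / 2)) * (y1 r + (s + exp (r / 2)) * y r).

Lemma Gamma_prod_pos : 0 < Gamma m * Gamma (1 - m).
Proof. apply Rmult_lt_0_compat; apply Gamma_pos; lra. Qed.

Lemma kk_real_pos r : 0 < y r.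
Proof.
  destruct (kk_eq_GG m Hm r) as [H _]. assert (Hc := Gamma_prod_pos).
  assert (Hg := GG_pos (- m) (exp r) (exp_pos r)). rewrite H in Hg. unfold y.
  apply Rnot_le_lt. intros Hn. nra.
Qed.

Lemma kk'_real_neg r : y1 r < 0.
Proof.
  destruct (kk_eq_GG m Hm r) as [_ H]. assert (Hc := Gamma_prod_pos).
  assert (Hg := GG_pos (1 - m) (exp r) (exp_pos r)). assert (He := exp_pos r).
  unfold y1. apply Rnot_le_lt. intros Hn. nra.
Qed.

Lemma real_derive_y r : is_derive y r (y1 r).
Proof. now apply kk_real_derive. Qed.

Lemma real_derive_y1 r : is_derive y1 r (m * y1 r + exp r * y r).
Proof. now apply kk'_real_derive. Qed.

(** Crude growth, to be beaten by [exp(- 2 exp(r/2))]: [y] decreases, and [- y1] is [exp r] times a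
    nonincreasing integral, up to a constant. *)
Lemma real_growth : exists A, 0 < A /\ forall r, 0 <= r -> y r <= A /\ Rabs (y1 r) <= A * exp r.
Proof.
  assert (Hc := Gamma_prod_pos). set (c := Gamma m * Gamma (1 - m)) in *.
  exists (y 0 + GG (1 - m) 1 / c). assert (Hy := kk_real_pos 0).
  assert (Hg := GG_pos (1 - m) 1 Rlt_0_1).
  assert (Hgc : 0 < GG (1 - m) 1 / c) by (now apply Rdiv_lt_0_compat).
  split; [lra|]. intros r Hr. split.
  - assert (H := nonincreasing_of_deriv y y1 0 r Hr (fun t _ => real_derive_y t)
      (fun t _ => Rlt_le _ _ (kk'_real_neg t))). lra.
  - destruct (kk_eq_GG m Hm r) as [_ H]. fold c in H. fold (y1 r) in H.
    assert (Hn := kk'_real_neg r). rewrite Rabs_left by assumption.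
    assert (Hd : GG (1 - m) (exp r) <= GG (1 - m) 1).
    { apply GG_nonincreasing. split; [lra|]. rewrite <- exp_0. now apply exp_le. }
    assert (He := exp_pos r).
    apply Rmult_le_reg_l with c; [assumption|].
    replace (c * - y1 r) with (exp r * GG (1 - m) (exp r)) by lra.
    replace (c * ((y 0 + GG (1 - m) 1 / c) * exp r)) with (c * y 0 * exp r + exp r * GG (1 - m) 1)
      by (field; lra).
    assert (0 < c * y 0 * exp r) by (apply Rmult_lt_0_compat; [apply Rmult_lt_0_compat|]; assumption).
    assert (exp r * GG (1 - m) (exp r) <= exp r * GG (1 - m) 1) by (apply Rmult_le_compat_l; lra).
    lra.
Qed.

(** [M1] divided by [exp(r/2 + 4 exp(r/2))], the integrating factor of
    [M'' = (1/2 + 2 exp(r/2)) M' + k4 M]; thus [N'] involves [y] alone. *)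
Let N r := (y1 r + (s + exp (r / 2)) * y r) * exp (- a * r - 2 * exp (r / 2)).
(** The barrier for [N]: [exp(- r/2) * M r] divided by the same integrating factor. *)
Let B r := y r * exp (- (a + 1 / 2) * r - 2 * exp (r / 2)).

Lemma N_derive r : is_derive N r (k4 * y r * exp (- a * r - 2 * exp (r / 2))).
Proof.
  unfold N.
  assert (H0 := real_derive_y r). assert (H1 := real_derive_y1 r).
  assert (E0 : ex_derive y r) by (eexists; exact H0).
  assert (E1 : ex_derive y1 r) by (eexists; exact H1).
  assert (D0 : Derive (fun x => y x) r = y1 r) by (now apply is_derive_unique).
  assert (D1 : Derive (fun x => y1 x) r = m * y1 r + exp r * y r) by (now apply is_derive_unique).
  clearbody y y1. auto_derive; [tauto|]. rewrite D0, D1, (exp_double r).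
  replace (r * / 2) with (r / 2) by reflexivity. unfold a, s, k4.
  set (E := exp (r / 2)). set (X := exp _). field.
Qed.

Lemma B_derive r : is_derive B r
  ((y1 r - (a + 1 / 2 + exp (r / 2)) * y r) * exp (- (a + 1 / 2) * r - 2 * exp (r / 2))).
Proof.
  eapply is_derive_mul_exp; [apply real_derive_y | auto_derive; [exact I | reflexivity] |].
  change (r * / 2) with (r / 2). f_equal. field.
Qed.

(** From [(1 + 2E/3)^3 <= exp(2E)] and [27/8 <= 4]. A cube is wanted because [N] and [B] carry
    factors of size [E^2]. *)
Lemma exp_cube_bound E : 1 <= E -> exp (- (2 * E)) <= 4 / E ^ 3.
Proof.
  intros HE. assert (H := exp_ineq1_le (2 * E / 3)).
  assert (HP : exp (2 * E) = exp (2 * E / 3) ^ 3).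
  { rewrite <- exp_nat. f_equal. simpl. field. }
  assert (H3 : E ^ 3 <= 4 * exp (2 * E)).
  { rewrite HP. assert ((2 * E / 3 + 1) ^ 3 <= exp (2 * E / 3) ^ 3) by (apply pow_incr; lra).
    nra. }
  assert (HE3 : 0 < E ^ 3) by (apply pow_lt; lra).
  rewrite exp_Ropp. assert (Hp := exp_pos (2 * E)).
  apply Rmult_le_reg_r with (exp (2 * E) * E ^ 3); [now apply Rmult_lt_0_compat|].
  replace (/ exp (2 * E) * (exp (2 * E) * E ^ 3)) with (E ^ 3) by (field; lra).
  replace (4 / E ^ 3 * (exp (2 * E) * E ^ 3)) with (4 * exp (2 * E)) by (field; lra). assumption.
Qed.

(** With [E = exp(r/2)], the factors in front of the exponentials are [O(E^2)] by [real_growth] and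
    the exponentials are [O(E^-3)]: there remains [K / E]. *)
Lemma NB_lim k : forall eps, 0 < eps -> exists R0, forall r, R0 < r -> Rabs (N r + k * B r) < eps.
Proof.
  destruct real_growth as (A & HA & HAb). intros eps Heps.
  set (K := 4 * (3 * A + Rabs k * A)).
  assert (HK : 0 < K). { unfold K. pose proof (Rabs_pos k). nra. }
  exists (Rmax 0 (2 * ln (K / eps))). intros r Hr.
  assert (Hr0 : 0 < r) by (eapply Rle_lt_trans; [apply Rmax_l | exact Hr]).
  assert (Hr1 : 2 * ln (K / eps) < r) by (eapply Rle_lt_trans; [apply Rmax_r | exact Hr]).
  set (E := exp (r / 2)).
  assert (HKe : 0 < K / eps) by (now apply Rdiv_lt_0_compat).
  assert (HE : K / eps < E).
  { rewrite <- (exp_ln (K / eps)) by assumption. apply exp_increasing. lra. }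
  assert (HE1 : 1 <= E) by (unfold E; pose proof (exp_ineq1_le (r / 2)); lra).
  destruct (HAb r ltac:(lra)) as [Hy Hy1]. assert (Hyp := kk_real_pos r). fold (y r) in Hyp.
  rewrite (exp_double r) in Hy1. fold E in Hy1.
  assert (Hs : Rabs s <= 1) by (unfold s; apply Rabs_le; lra).
  assert (Ha : 0 < a) by (unfold a; lra).
  assert (He2 := exp_cube_bound E HE1).
  assert (Hx : forall b, 0 < b -> exp (- b * r - 2 * E) <= 4 / E ^ 3).
  { intros b Hb. eapply Rle_trans; [|exact He2]. apply exp_le. nra. }
  assert (H1 : Rabs (y1 r + (s + E) * y r) <= 3 * A * (E * E)).
  { eapply Rle_trans; [apply Rabs_triang|]. rewrite Rabs_mult, (Rabs_pos_eq (y r)) by lra.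
    assert (Rabs (s + E) <= 2 * E).
    { eapply Rle_trans; [apply Rabs_triang|]. rewrite (Rabs_pos_eq E) by lra. lra. }
    assert (Rabs (s + E) * y r <= 2 * E * A) by (apply Rmult_le_compat; (apply Rabs_pos || lra)).
    assert (0 <= A * E * (E - 1)) by (apply Rmult_le_pos; [apply Rmult_le_pos|]; lra). lra. }
  assert (H2 : Rabs (N r) <= 3 * A * (E * E) * (4 / E ^ 3)).
  { unfold N. fold E. rewrite Rabs_mult, Rabs_exp.
    apply Rmult_le_compat; [apply Rabs_pos | apply exp_nonneg | assumption | now apply Hx]. }
  assert (H3 : Rabs (k * B r) <= Rabs k * A * (E * E) * (4 / E ^ 3)).
  { unfold B. fold E. rewrite !Rabs_mult, (Rabs_pos_eq (exp _)), (Rabs_pos_eq (y r))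
      by (lra || (apply exp_nonneg)).
    rewrite <- Rmult_assoc.
    apply Rmult_le_compat; [|apply exp_nonneg | | apply Hx; lra].
    - apply Rmult_le_pos; [apply Rabs_pos | lra].
    - assert (Rabs k * y r <= Rabs k * A) by (apply Rmult_le_compat_l; [apply Rabs_pos | assumption]).
      assert (0 <= Rabs k * A) by (apply Rmult_le_pos; [apply Rabs_pos | lra]).
      assert (1 <= E * E) by (clear - HE1; nra). clear - H H0 H3; nra. }
  eapply Rle_lt_trans; [apply Rabs_triang|].
  apply Rle_lt_trans with (K / E).
  - replace (K / E) with (3 * A * (E * E) * (4 / E ^ 3) + Rabs k * A * (E * E) * (4 / E ^ 3))
      by (unfold K; field; lra). lra.
  - apply Rmult_lt_reg_r with E; [lra|]. replace (K / E * E) with K by (field; lra).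
    replace K with (K / eps * eps) by (field; lra). rewrite (Rmult_comm eps).
    now apply Rmult_lt_compat_r.
Qed.

(** The signs [y1 < 0 < y] and [0 < a] allow all terms but [- exp(r/2) * y] to be dropped. *)
Lemma B_derive_le r : (y1 r - (a + 1 / 2 + exp (r / 2)) * y r) * exp (- (a + 1 / 2) * r - 2 * exp (r / 2))
  <= - (y r * exp (- a * r - 2 * exp (r / 2))).
Proof.
  replace (exp (- a * r - 2 * exp (r / 2)))
    with (exp (- (a + 1 / 2) * r - 2 * exp (r / 2)) * exp (r / 2)).
  2:{ rewrite <- exp_plus. f_equal. field. }
  assert (Hx := exp_pos (- (a + 1 / 2) * r - 2 * exp (r / 2))).
  set (X := exp (- (a + 1 / 2) * r - 2 * exp (r / 2))) in *.
  set (E := exp (r / 2)) in *.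
  assert (Hn := kk'_real_neg r). assert (Hp := kk_real_pos r).
  fold (y1 r) in Hn. fold (y r) in Hp.
  assert (Ha : 0 < a) by (unfold a; lra).
  replace (- (y r * (X * E))) with (- (E * y r) * X) by ring.
  apply Rmult_le_compat_r; [lra|]. nra.
Qed.

(** Comparison from [+oo]: [kap * B + N] and [kap * B - N] are nonincreasing, since [kap * B']
    outweighs [|N'|], and tend to 0. *)
Lemma N_le_B r : Rabs (N r) <= kap * B r.
Proof.
  assert (Hkap : 0 <= kap) by apply Rabs_pos.
  assert (Hk1 : k4 <= kap) by apply Rle_abs.
  assert (Hk2 : - k4 <= kap) by (unfold kap; rewrite <- Rabs_Ropp; apply Rle_abs).
  set (B' := fun r => (y1 r - (a + 1 / 2 + exp (r / 2)) * y r) * exp (- (a + 1 / 2) * r - 2 * exp (r / 2))).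
  set (N' := fun r => k4 * y r * exp (- a * r - 2 * exp (r / 2))).
  assert (Hb : forall t, kap * B' t <= - kap * (y t * exp (- a * t - 2 * exp (t / 2)))).
  { intros t. assert (H := B_derive_le t). fold (B' t) in H.
    apply (Rmult_le_compat_l kap) in H; [|assumption]. lra. }
  assert (Hq : forall t, 0 < y t * exp (- a * t - 2 * exp (t / 2))).
  { intros t. apply Rmult_lt_0_compat; [apply kk_real_pos | apply exp_pos]. }
  assert (Hplus : 0 <= N r + kap * B r).
  { apply (lim0_nonneg (fun r => N r + kap * B r) (fun r => N' r + kap * B' r)).
    - intros t. apply (is_derive_plus (V := R_NormedModule) N (fun r => kap * B r)); [apply N_derive|].
      apply (is_derive_scal B t kap), B_derive.
    - intros t. specialize (Hb t). specialize (Hq t). unfold N'. rewrite Rmult_assoc. nra.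
    - apply NB_lim. }
  assert (Hminus : 0 <= - N r + kap * B r).
  { apply (lim0_nonneg (fun r => - N r + kap * B r) (fun r => - N' r + kap * B' r)).
    - intros t. apply (is_derive_plus (V := R_NormedModule) (fun r => - N r) (fun r => kap * B r)).
      + apply (is_derive_opp (V := R_NormedModule) N), N_derive.
      + apply (is_derive_scal B t kap), B_derive.
    - intros t. specialize (Hb t). specialize (Hq t). unfold N'. rewrite Rmult_assoc. nra.
    - intros eps Heps. destruct (NB_lim (- kap) eps Heps) as [R0 H]. exists R0. intros t Ht.
      rewrite <- Rabs_Ropp. replace (- (- N t + kap * B t)) with (N t + - kap * B t) by ring.
      now apply H. }
  apply Rabs_le. lra.
Qed.

Lemma M1_le_M r : Rabs (M1 r) <= kap * exp (- r / 2) * M r.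
Proof.
  assert (H := N_le_B r).
  assert (E1 : M1 r = N r * exp (r / 2 + 4 * exp (r / 2))).
  { unfold M1, N. rewrite (Rmult_comm (exp _)), Rmult_assoc, <- exp_plus.
    f_equal. f_equal. unfold a, s. field. }
  assert (E2 : exp (- r / 2) * M r = B r * exp (r / 2 + 4 * exp (r / 2))).
  { unfold M, B.
    transitivity (y r * (exp (- r / 2) * exp (s * r + 2 * exp (r / 2)))); [ring|].
    transitivity (y r * (exp (- (a + 1 / 2) * r - 2 * exp (r / 2)) * exp (r / 2 + 4 * exp (r / 2)))); [|ring].
    rewrite <- !exp_plus. f_equal. f_equal. unfold a, s. field. }
  rewrite Rmult_assoc, E2, E1, Rabs_mult, Rabs_exp.
  rewrite <- Rmult_assoc. apply Rmult_le_compat_r; [apply exp_nonneg | assumption].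
Qed.

Lemma M_derive r : is_derive M r (M1 r).
Proof.
  apply (is_derive_ext (fun r => y r * exp (s * r + 2 * exp (r / 2)))); [intros; apply Rmult_comm|].
  eapply is_derive_mul_exp; [apply real_derive_y | auto_derive; [exact I | reflexivity] |].
  unfold M1. change (r * / 2) with (r / 2). rewrite Rmult_comm. f_equal. field.
Qed.

(** The sum of squares is the energy at [t = 0] from which the arcs start in [kk_decay_upper]. *)
Lemma M_bounded : exists K, 0 < K /\ forall r, 0 <= r -> M r ^ 2 + M1 r ^ 2 <= K ^ 2.
Proof.
  assert (Hkap : 0 <= kap) by apply Rabs_pos.
  assert (HMp : forall r, 0 < M r).
  { intros r. apply Rmult_lt_0_compat; [apply exp_pos | apply kk_real_pos]. }
  set (K0 := M 0 * exp (2 * kap)).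
  assert (HK0 : 0 < K0) by (apply Rmult_lt_0_compat; [apply HMp | apply exp_pos]).
  assert (HM : forall r, 0 <= r -> M r <= K0).
  { intros r Hr.
    (* The exponent has derivative [- kap * exp(- r/2)], which compensates the bound of [M1_le_M];
       it stays between 0 and [2 * kap]. *)
    set (W := fun r => M r * exp (2 * kap * exp (- r / 2))).
    assert (HW : W r <= W 0).
    { apply (nonincreasing_of_deriv W
        (fun r => (M1 r - kap * exp (- r / 2) * M r) * exp (2 * kap * exp (- r / 2)))); [assumption | |].
      - intros t _. eapply is_derive_mul_exp; [apply M_derive | auto_derive; [exact I | reflexivity] |].
        unfold Rdiv. field.
      - intros t _. assert (H := M1_le_M t). apply Rabs_le_between in H.
        assert (He := exp_pos (2 * kap * exp (- t / 2))). nra. }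
    unfold W in HW. replace (- 0 / 2) with 0 in HW by field. rewrite exp_0, Rmult_1_r in HW.
    fold K0 in HW. eapply Rle_trans; [|exact HW].
    rewrite <- (Rmult_1_r (M r)) at 1. apply Rmult_le_compat_l; [left; apply HMp|].
    apply Rle_trans with (exp 0); [right; now rewrite exp_0|]. apply exp_le.
    pose proof (exp_pos (- r / 2)). nra. }
  exists (K0 * (1 + kap)). split; [nra|]. intros r Hr.
  assert (H1 := HM r Hr). assert (H2 := HMp r). assert (H3 := M1_le_M r).
  assert (H4 : exp (- r / 2) <= 1).
  { apply exp_le_1. lra. }
  assert (H5 : Rabs (M1 r) <= kap * K0).
  { eapply Rle_trans; [exact H3|].
    rewrite Rmult_assoc. apply Rmult_le_compat_l; [assumption|]. nra. }
  rewrite <- (pow2_abs (M1 r)). pose proof (Rabs_pos (M1 r)).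
  assert (Rabs (M1 r) ^ 2 <= (kap * K0) ^ 2) by (apply pow_incr; lra).
  assert (M r ^ 2 <= K0 ^ 2) by (apply pow_incr; lra).
  assert (0 <= 2 * kap * K0 ^ 2). { pose proof (pow2_ge_0 K0). nra. }
  replace ((K0 * (1 + kap)) ^ 2) with (K0 ^ 2 + (kap * K0) ^ 2 + 2 * kap * K0 ^ 2) by ring. lra.
Qed.

(** [half u] is [sqrt w = x / 2], entire in [u]. [mm] and [mm1] continue [M] and [M1] to complex
    arguments, [q] being the exponential factor. *)
Let half u := Cexp (RtoC (1 / 2) * u)%C.
Let q u := Cexp (RtoC s * u + RtoC 2 * half u)%C.
Let mm u := (q u * kk m u)%C.
Let mm1 u := (q u * (kk' m u + (RtoC s + half u) * kk m u))%C.

Lemma half_deriv u : Cderiv half u (RtoC (1 / 2) * half u)%C.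
Proof. apply Cderiv_Cexp_lin. Qed.

Lemma q_deriv u : Cderiv q u ((RtoC s + half u) * q u)%C.
Proof.
  eapply Cderiv_eq.
  - apply (Cderiv_comp Cexp (fun u => RtoC s * u + RtoC 2 * half u)%C); [apply Cderiv_Cexp|].
    apply Cderiv_plus; [apply Cderiv_scal, Cderiv_id | apply Cderiv_scal, half_deriv].
  - fold (q u). replace (RtoC 2 * (RtoC (1 / 2) * half u))%C with (half u); [ring|].
    rewrite Cmult_assoc, <- RtoC_mult. replace (2 * (1 / 2)) with 1 by field. ring.
Qed.

Lemma half_sqr u : (half u * half u)%C = Cexp u.
Proof.
  unfold half. rewrite <- Cexp_plus. f_equal.
  rewrite <- Cmult_plus_distr_r, <- RtoC_plus. replace (1 / 2 + 1 / 2) with 1 by field. ring.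
Qed.

Lemma mm_deriv u : Cderiv mm u (mm1 u).
Proof.
  eapply Cderiv_eq; [apply Cderiv_mult; [apply q_deriv | apply kk_deriv; lra]|].
  unfold mm1. ring.
Qed.

(** Thanks to [2 s + m = 1/2], all terms in [half u] and its square cancel in the coefficient of
    [mm]; only [s^2 - s/2 = k4] is left. *)
Lemma mm1_deriv u : Cderiv mm1 u
  ((RtoC (1 / 2) + RtoC 2 * half u) * mm1 u + RtoC k4 * mm u)%C.
Proof.
  eapply Cderiv_eq.
  - apply Cderiv_mult; [apply q_deriv|].
    apply Cderiv_plus; [apply kk'_deriv; lra|].
    apply Cderiv_mult; [|apply kk_deriv; lra].
    apply Cderiv_plus; [apply Cderiv_const | apply half_deriv].
  - unfold mm1, mm. rewrite <- half_sqr.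
    assert (Hs : RtoC (1 / 2) = (RtoC 2 * RtoC s + RtoC m)%C).
    { rewrite <- RtoC_mult, <- RtoC_plus. f_equal. unfold s. field. }
    assert (Hk : RtoC k4 = (RtoC s * RtoC s - RtoC s * RtoC (1 / 2))%C).
    { rewrite <- !RtoC_mult, <- RtoC_minus. f_equal. unfold k4, s. field. }
    rewrite Hk.
    transitivity (q u * ((RtoC s + half u) * (kk' m u + (RtoC s + half u) * kk m u) +
      (RtoC m * kk' m u + half u * half u * kk m u + (RtoC (1 / 2) * half u * kk m u + (RtoC s + half u) * kk' m u))))%C.
    { ring. }
    replace (RtoC m) with (RtoC (1 / 2) - RtoC 2 * RtoC s)%C by (rewrite Hs; ring).
    replace (RtoC 2) with (RtoC 1 + RtoC 1)%C by (rewrite <- RtoC_plus; f_equal; ring).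
    ring.
Qed.

(* With [x = 2 exp(u/2)], [mm u] is a multiple of [sqrt x * exp x * K_m x].  It satisfies
   [mm'' = (1/2 + x) mm' + k4 mm], so along an arc [u = r + i t] the derivative of
   [|mm|^2 + |mm'|^2] in [t] contains the damping term [- 2 Im x |mm'|^2] and nothing else of
   size [x]: the bound at [t = 0] propagates uniformly in [r]. *)
Lemma kk_decay_upper : exists K, 0 < K /\ forall u, 0 <= Re u -> 0 <= Im u <= PI ->
  Cmod (kk m u) <= K * exp ((m / 2 - 1 / 4) * Re u).
Proof.
  destruct M_bounded as (K & HK & HKb).
  (* The energy grows at most like [exp(2 t)] with [t <= PI], and [|mm|] is at most its square
     root. *)
  exists (K * exp PI). split; [apply Rmult_lt_0_compat; [assumption | apply exp_pos]|].
  intros u Hu Hi. set (r := Re u) in *. set (th := Im u) in *.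
  set (path := fun t : R => (RtoC r + RtoC t * Ci)%C).
  assert (Hpath : u = path th).
  { unfold path. apply Ceq_intro; simpl; unfold r, th, Re, Im; ring. }
  set (fr := fun t => Re (mm (path t))). set (fi := fun t => Im (mm (path t))).
  set (gr := fun t => Re (mm1 (path t))). set (gi := fun t => Im (mm1 (path t))).
  set (e1 := fun t => Re (half (path t))). set (e2 := fun t => Im (half (path t))).
  assert (Dfr : forall t, is_derive fr t (- gi t)).
  { intros t. destruct (Cderiv_line mm (mm1 (path t)) (RtoC r) Ci t (mm_deriv _)) as [H _].
    refine (is_derive_eq _ _ _ _ H _). unfold gi. simpl. ring. }
  assert (Dfi : forall t, is_derive fi t (gr t)).
  { intros t. destruct (Cderiv_line mm (mm1 (path t)) (RtoC r) Ci t (mm_deriv _)) as [_ H].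
    refine (is_derive_eq _ _ _ _ H _). unfold gr. simpl. ring. }
  assert (Dgr : forall t, is_derive gr t
    (- ((1 / 2 + 2 * e1 t) * gi t + 2 * e2 t * gr t + k4 * fi t))).
  { intros t. destruct (Cderiv_line mm1 _ (RtoC r) Ci t (mm1_deriv _)) as [H _].
    fold (path t) in H. refine (is_derive_eq _ _ _ _ H _).
    unfold fr, fi, gr, gi, e1, e2. destruct (mm1 (path t)), (mm (path t)), (half (path t)). simpl. ring. }
  assert (Dgi : forall t, is_derive gi t
    ((1 / 2 + 2 * e1 t) * gr t - 2 * e2 t * gi t + k4 * fr t)).
  { intros t. destruct (Cderiv_line mm1 _ (RtoC r) Ci t (mm1_deriv _)) as [_ H].
    fold (path t) in H. refine (is_derive_eq _ _ _ _ H _).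
    unfold fr, fi, gr, gi, e1, e2. destruct (mm1 (path t)), (mm (path t)), (half (path t)). simpl. ring. }
  (* The half angle is in [[0, PI/2]]: its sine gives the damping its sign. *)
  assert (He2 : forall t, 0 <= t <= PI -> 0 <= e2 t).
  { intros t Ht. simpl.
    apply Rmult_le_pos; [apply exp_nonneg|]. apply sin_ge_0; simpl; lra. }
  (* The cosine of the half angle is nonnegative too, so [exp(2 half u)] has modulus at least 1 and
     may be dropped from [q u] at the end. *)
  assert (He1 : 0 <= e1 th).
  { unfold e1, half, path, Cexp. simpl.
    apply Rmult_le_pos; [apply exp_nonneg|]. apply cos_ge_0; simpl; lra. }
  set (En := fun t => fr t ^ 2 + fi t ^ 2 + gr t ^ 2 + gi t ^ 2).
  set (W := fun t => En t * exp (- (2 * t))).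
  assert (Hk4 : -1 <= k4 <= 1) by (unfold k4; nra).
  assert (HW : W th <= W 0).
  { apply (nonincreasing_of_deriv W (fun t =>
      (2 * (k4 - 1) * (fr t * gi t - fi t * gr t) - 4 * e2 t * (gr t ^ 2 + gi t ^ 2) - 2 * En t) * exp (- (2 * t)))).
    - lra.
    - intros t _. unfold W, En. specialize (Dfr t). specialize (Dfi t). specialize (Dgr t). specialize (Dgi t).
      assert (X1 : ex_derive fr t) by (eexists; exact Dfr). assert (X2 : ex_derive fi t) by (eexists; exact Dfi).
      assert (X3 : ex_derive gr t) by (eexists; exact Dgr). assert (X4 : ex_derive gi t) by (eexists; exact Dgi).
      apply is_derive_unique in Dfr, Dfi, Dgr, Dgi.
      clearbody fr fi gr gi e1 e2.
      auto_derive; [tauto|].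
      change (Derive (fun x => fr x) t) with (Derive fr t). change (Derive (fun x => fi x) t) with (Derive fi t).
      change (Derive (fun x => gr x) t) with (Derive gr t). change (Derive (fun x => gi x) t) with (Derive gi t).
      rewrite Dfr, Dfi, Dgr, Dgi. set (X := exp _). ring.
    - intros t Ht. specialize (He2 t ltac:(lra)).
      assert (Hex := exp_pos (- (2 * t))).
      assert (HH : 2 * (k4 - 1) * (fr t * gi t - fi t * gr t) - 4 * e2 t * (gr t ^ 2 + gi t ^ 2) - 2 * En t <= 0).
      { assert (0 <= e2 t * (gr t ^ 2 + gi t ^ 2)) by (apply Rmult_le_pos; nra).
        assert (H1 : 2 * (k4 - 1) * (fr t * gi t - fi t * gr t) <= 2 * En t); [|lra].
        assert (Hv : 0 <= 1 - k4 <= 2) by lra. set (v := 1 - k4) in *.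
        replace (2 * (k4 - 1) * (fr t * gi t - fi t * gr t)) with (v * (2 * (fi t * gr t - fr t * gi t)))
          by (unfold v; ring).
        assert (2 * (fi t * gr t - fr t * gi t) <= En t).
        { unfold En. pose proof (pow2_ge_0 (fi t - gr t)). pose proof (pow2_ge_0 (fr t + gi t)). nra. }
        assert (0 <= En t) by (unfold En; nra). nra. }
      nra. }
  assert (H0 : En 0 <= K ^ 2).
  { eapply Rle_trans; [|apply (HKb r Hu)]. unfold En, fr, fi, gr, gi.
    assert (Hp0 : path 0 = RtoC r) by (unfold path; ring). rewrite Hp0.
    assert (Hh : half (RtoC r) = RtoC (exp (r / 2))).
    { unfold half. rewrite <- RtoC_mult, Cexp_R. f_equal. f_equal. field. }
    assert (Hq : q (RtoC r) = RtoC (exp (s * r + 2 * exp (r / 2)))).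
    { unfold q. rewrite Hh, <- !RtoC_mult, <- RtoC_plus, Cexp_R. reflexivity. }
    assert (Hmm : mm (RtoC r) = RtoC (M r)).
    { unfold mm, M. rewrite Hq, kk_RtoC, <- RtoC_mult. reflexivity. }
    assert (Hmm1 : mm1 (RtoC r) = RtoC (M1 r)).
    { unfold mm1, M1. rewrite Hq, Hh, kk_RtoC, kk'_RtoC, <- RtoC_plus, <- RtoC_mult, <- RtoC_plus, <- RtoC_mult.
      reflexivity. }
    rewrite Hmm, Hmm1. simpl. lra. }
  assert (HE : En th <= (K * exp PI) ^ 2).
  { unfold W in HW. rewrite Rmult_0_r, Ropp_0, exp_0, Rmult_1_r in HW.
    assert (Hx : exp (- (2 * th)) * exp (2 * th) = 1) by (rewrite <- exp_plus, Rplus_opp_l; apply exp_0).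
    assert (Hx2 : exp (2 * th) <= exp PI ^ 2).
    { rewrite <- exp_nat. apply exp_le. simpl. lra. }
    assert (Hp := exp_pos (2 * th)).
    replace (En th) with (En th * exp (- (2 * th)) * exp (2 * th)) by (rewrite Rmult_assoc, Hx; ring).
    rewrite Rpow_mult_distr. apply Rmult_le_compat; try lra.
    apply Rmult_le_pos; [unfold En; nra | apply exp_nonneg]. }
  assert (Hmod : Cmod (mm u) <= K * exp PI).
  { apply Rsqr_incr_0_var; [|left; apply Rmult_lt_0_compat; [assumption | apply exp_pos]].
    unfold Rsqr. replace (Cmod (mm u) * Cmod (mm u)) with (Cmod (mm u) ^ 2) by ring.
    rewrite Cmod2_alt, Hpath. fold (fr th) (fi th).
    unfold En in HE. nra. }
  unfold mm in Hmod. rewrite Cmod_mult in Hmod.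
  assert (Hq : exp (s * r) <= Cmod (q u)).
  { unfold q. rewrite Cmod_Cexp. apply exp_le.
    rewrite Hpath. unfold e1 in He1.
    replace (Re (RtoC s * path th + RtoC 2 * half (path th))%C)
      with (s * Re (path th) + 2 * Re (half (path th))) by (simpl; ring).
    replace (Re (path th)) with r by (simpl; ring). lra. }
  assert (Hkk := Cmod_ge_0 (kk m u)).
  assert (Hs : exp ((m / 2 - 1 / 4) * r) * exp (s * r) = 1).
  { rewrite <- exp_plus. replace ((m / 2 - 1 / 4) * r + s * r) with 0 by (unfold s; field). apply exp_0. }
  assert (Hp2 := exp_pos (s * r)).
  apply Rmult_le_reg_r with (exp (s * r)); [assumption|].
  rewrite Rmult_assoc, Hs, Rmult_1_r. nra.
Qed.

End RealBound.

Lemma kk_decay m : 0 < m < 1 -> exists K, 0 < K /\ forall u, 0 <= Re u -> Rabs (Im u) <= PI ->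
  Cmod (kk m u) <= K * exp ((m / 2 - 1 / 4) * Re u).
Proof.
  intros Hm. destruct (kk_decay_upper m Hm) as (K & HK & H). exists K. split; [assumption|].
  intros u Hr Hi. destruct (Rle_lt_dec 0 (Im u)) as [Hp | Hn].
  - apply H; [assumption|]. rewrite Rabs_pos_eq in Hi; lra.
  - rewrite <- Cmod_conj, <- kk_conj. change (Re u) with (Re (Cconj u)). apply H; [assumption|].
    rewrite Rabs_left in Hi by assumption. change (Im (Cconj u)) with (- Im u). lra.
Qed.

(** * Continuity and difference quotients *)

Definition Ccont (f : C -> C) (p : C) : Prop :=
  @continuous (AbsRing_UniformSpace C_AbsRing) (AbsRing_UniformSpace C_AbsRing) f p.

Lemma Ccont_eps f p : Ccont f p <->
  forall eps, 0 < eps -> exists d, 0 < d /\ forall u, Cmod (u - p)%C < d -> Cmod (f u - f p)%C < eps.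
Proof.
  split.
  - intros H eps Heps.
    destruct (proj1 (filterlim_locally (U := AbsRing_UniformSpace C_AbsRing) _ _) H (mkposreal eps Heps)) as [d Hd].
    exists d. split; [apply cond_pos|]. intros u Hu. exact (Hd u Hu).
  - intros H. apply (filterlim_locally (U := AbsRing_UniformSpace C_AbsRing)). intros eps.
    destruct (H eps (cond_pos eps)) as (d & Hd & Hb).
    exists (mkposreal d Hd). intros u Hu. exact (Hb u Hu).
Qed.

Lemma Ccont_Cderiv f p l : Cderiv f p l -> Ccont f p.
Proof.
  intros H. apply Ccont_eps. intros eps Heps.
  destruct (Cderiv_continuous f p l H eps Heps) as (d & Hd & Hb).
  exists d. split; [assumption|]. intros u Hu. specialize (Hb (u - p)%C Hu).
  now rewrite Cplus_minus_r in Hb.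
Qed.

Lemma Ccont_mult f g p : Ccont f p -> Ccont g p -> Ccont (fun u => f u * g u)%C p.
Proof. exact (continuous_mult (U := AbsRing_UniformSpace C_AbsRing) (K := C_AbsRing) f g p). Qed.

Lemma Ccont_plus f g p : Ccont f p -> Ccont g p -> Ccont (fun u => f u + g u)%C p.
Proof.
  exact (continuous_plus (U := AbsRing_UniformSpace C_AbsRing) (K := C_AbsRing)
    (V := AbsRing_NormedModule C_AbsRing) f g p).
Qed.

Lemma Ccont_opp f p : Ccont f p -> Ccont (fun u => - f u)%C p.
Proof.
  exact (continuous_opp (U := AbsRing_UniformSpace C_AbsRing) (K := C_AbsRing)
    (V := AbsRing_NormedModule C_AbsRing) f p).
Qed.

Lemma Ccont_const c p : Ccont (fun _ => c) p.
Proof. apply (Ccont_Cderiv _ _ (RtoC 0)), Cderiv_const. Qed.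

Lemma Ccont_id p : Ccont (fun u => u) p.
Proof. apply (Ccont_Cderiv _ _ (RtoC 1)), Cderiv_id. Qed.

Lemma Ccont_inv f p : f p <> RtoC 0 -> Ccont f p -> Ccont (fun u => / f u)%C p.
Proof.
  intros Hn H.
  apply (continuous_comp (U := AbsRing_UniformSpace C_AbsRing) (V := AbsRing_UniformSpace C_AbsRing)
    (W := AbsRing_UniformSpace C_AbsRing) f Cinv p H).
  apply (Ccont_Cderiv Cinv (f p) (- RtoC 1 / (f p * f p))%C).
  apply (Cderiv_inv (fun u => u) (f p)); [assumption | apply Cderiv_id].
Qed.

Lemma Ccont_ext_loc f g p : (exists d, 0 < d /\ forall u, Cmod (u - p)%C < d -> f u = g u) ->
  Ccont f p -> Ccont g p.
Proof.
  intros (d & Hd & Heq) H. apply Ccont_eps. intros eps Heps.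
  destruct (proj1 (Ccont_eps _ _) H eps Heps) as (d' & Hd' & Hb).
  exists (Rmin d d'). split; [now apply Rmin_glb_lt|]. intros u Hu.
  rewrite <- !Heq.
  - apply Hb. eapply Rlt_le_trans; [exact Hu | apply Rmin_r].
  - replace (p - p)%C with (RtoC 0) by ring. now rewrite Cmod_0.
  - eapply Rlt_le_trans; [exact Hu | apply Rmin_l].
Qed.

Lemma Cmod_lt_of_comp (h : C) d : Rabs (Re h) < d / 2 -> Rabs (Im h) < d / 2 -> Cmod h < d.
Proof. intros H1 H2. eapply Rle_lt_trans; [apply Cmod_le_Re_Im|]. lra. Qed.

Lemma Ccont_2d f x y : Ccont f (x, y) ->
  continuity_2d_pt (fun x y => Re (f (x, y))) x y /\ continuity_2d_pt (fun x y => Im (f (x, y))) x y.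
Proof.
  intros H. split; intros eps; destruct (proj1 (Ccont_eps _ _) H eps (cond_pos eps)) as (d & Hd & Hb);
    exists (mkposreal (d / 2) ltac:(lra)); intros u v Hu Hv; simpl in Hu, Hv;
    (assert (Hlt : Cmod (f (u, v) - f (x, y))%C < eps) by
      (apply Hb, Cmod_lt_of_comp; simpl; [exact Hu | exact Hv])).
  - eapply Rle_lt_trans; [|exact Hlt]. apply (re_le_Cmod (f (u, v) - f (x, y))%C).
  - eapply Rle_lt_trans; [|exact Hlt]. apply (Im_le_Cmod (f (u, v) - f (x, y))%C).
Qed.

Definition Slope (f : C -> C) (l u0 u : C) : C :=
  if Ceq_dec u u0 then l else ((f u - f u0) / (u - u0))%C.

Lemma Cminus_neq_0 (u v : C) : u <> v -> (u - v)%C <> RtoC 0.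
Proof. intros H E. apply H. replace u with (u - v + v)%C by ring. rewrite E. ring. Qed.

Lemma Slope_at f l u0 : Slope f l u0 u0 = l.
Proof. unfold Slope. destruct (Ceq_dec u0 u0); [reflexivity | congruence]. Qed.

Lemma Slope_cont_at f l u0 : Cderiv f u0 l -> Ccont (Slope f l u0) u0.
Proof.
  intros H. apply Ccont_eps. intros eps Heps.
  destruct (proj1 (Cderiv_eps _ _ _) H (eps / 2) ltac:(lra)) as (d & Hd & Hb).
  exists d. split; [assumption|]. intros u Hu. rewrite Slope_at. unfold Slope.
  destruct (Ceq_dec u u0) as [E | Hn].
  - replace (l - l)%C with (RtoC 0) by ring. rewrite Cmod_0. assumption.
  - assert (Hn' := Cminus_neq_0 u u0 Hn).
    specialize (Hb (u - u0)%C Hu). rewrite Cplus_minus_r in Hb.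
    replace ((f u - f u0) / (u - u0) - l)%C with ((f u - f u0 - (u - u0) * l) / (u - u0))%C
      by (field; assumption).
    rewrite Cmod_div by assumption.
    assert (Hp : 0 < Cmod (u - u0)%C) by (now apply Cmod_gt_0).
    apply Rle_lt_trans with (eps / 2); [|lra].
    apply Rmult_le_reg_r with (Cmod (u - u0)%C); [assumption|].
    unfold Rdiv at 1. rewrite Rmult_assoc, Rinv_l, Rmult_1_r by lra. assumption.
Qed.

Lemma Slope_cont_off f l u0 p : p <> u0 -> Ccont f p -> Ccont (Slope f l u0) p.
Proof.
  intros Hp Hf. assert (Hn := Cminus_neq_0 p u0 Hp).
  apply (Ccont_ext_loc (fun u => (f u + - f u0) * / (u + - u0))%C).
  - exists (Cmod (p - u0)%C). split; [now apply Cmod_gt_0|]. intros u Hu.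
    unfold Slope. destruct (Ceq_dec u u0) as [E | Hne]; [|reflexivity].
    subst u. exfalso. rewrite <- Cmod_opp in Hu.
    replace (- (u0 - p))%C with (p - u0)%C in Hu by ring. lra.
  - apply Ccont_mult.
    + apply Ccont_plus; [assumption | apply Ccont_const].
    + apply (Ccont_inv (fun u => u + - u0)%C); [assumption|].
      apply Ccont_plus; [apply Ccont_id | apply Ccont_const].
Qed.

Lemma Slope_cont f f1 u0 p : (forall u, Cderiv f u (f1 u)) -> Ccont (Slope f (f1 u0) u0) p.
Proof.
  intros H. destruct (Ceq_dec p u0) as [-> | Hn]; [now apply Slope_cont_at|].
  apply Slope_cont_off; [assumption | now apply (Ccont_Cderiv f p (f1 p))].
Qed.

Lemma cos_1_small x : cos x = 1 -> Rabs x < 2 * PI -> x = 0.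
Proof.
  intros Hc Hx. replace x with (2 * (x / 2)) in Hc by field.
  rewrite cos_2a_sin in Hc.
  assert (Hs : sin (x / 2) = 0) by nra.
  apply Rabs_def2 in Hx.
  destruct (Rtotal_order x 0) as [Hlt | [H | Hgt]]; [|assumption|].
  - assert (0 < sin (- (x / 2))) by (apply sin_gt_0; lra). rewrite sin_neg in H. lra.
  - assert (0 < sin (x / 2)) by (apply sin_gt_0; lra). lra.
Qed.

(** One closed and one open bound keep the difference of the imaginary parts below [2 PI], while [u]
    may lie on an edge of the cut. *)
Lemma Cexp_inj u v : Cexp u = Cexp v -> Rabs (Im u) <= PI -> Rabs (Im v) < PI -> u = v.
Proof.
  intros H Hu Hv.
  assert (Hr : Re u = Re v).
  { apply exp_inv. now rewrite <- !Cmod_Cexp, H. }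
  assert (Hc : cos (Im u - Im v) = 1).
  { assert (H1 := f_equal Re H). assert (H2 := f_equal Im H). simpl in H1, H2.
    rewrite Hr in H1, H2. assert (He := exp_pos (Re v)).
    apply Rmult_eq_reg_l in H1; [|lra]. apply Rmult_eq_reg_l in H2; [|lra].
    rewrite cos_minus, H1, H2. pose proof (sin2_cos2 (Im v)) as Hsc. unfold Rsqr in Hsc. lra. }
  assert (Hi : Im u - Im v = 0).
  { apply cos_1_small; [assumption|]. eapply Rle_lt_trans; [apply Rabs_triang|].
    rewrite Rabs_Ropp. lra. }
  apply Ceq_intro; [assumption | lra].
Qed.

(** [P] minus an integral of [p] is constant on each side of [t0], and its continuity at [t0] joins
    the two constants. *)
Lemma RInt_FTC_except (P p : R -> R) t0 a b : contpos p ->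
  (forall t, 0 < t -> t <> t0 -> is_derive P t (p t)) -> (0 < t0 -> continuous P t0) ->
  0 < a <= b -> RInt p a b = P b - P a.
Proof.
  intros Hp HP Hc Hab.
  set (D := fun t => P t - RInt p 1 t).
  assert (HI : forall t, 0 < t -> is_derive (fun t => RInt p 1 t) t (p t)).
  { intros t Ht. apply (is_derive_RInt p (fun t => RInt p 1 t) 1 t); [|now apply Hp].
    exists (mkposreal t Ht). intros x Hx. apply Rabs_def2 in Hx.
    unfold minus, plus, opp in Hx; simpl in Hx.
    apply (RInt_correct p). apply ex_RInt_cont.
    intros s Hs. apply Hp. assert (0 < Rmin 1 x) by (apply Rmin_glb_lt; lra). lra. }
  assert (HcP : forall t, 0 < t -> continuous P t).
  { intros t Ht. destruct (Req_EM_T t t0) as [-> | Hn]; [now apply Hc|].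
    apply ex_derive_cont. eexists. now apply HP. }
  assert (HcD : forall t, 0 < t -> continuity_pt D t).
  { intros t Ht. apply continuity_pt_filterlim.
    apply (continuous_minus P (fun t => RInt p 1 t)); [now apply HcP|].
    apply ex_derive_cont. eexists. now apply HI. }
  assert (Hcst : forall u v, 0 < u <= v -> ~ (u < t0 < v) -> D u = D v).
  { intros u v Huv Hn.
    destruct (MVT_gen D u v (fun _ => 0)) as (c & _ & E).
    - intros x Hx. rewrite Rmin_left, Rmax_right in Hx by lra.
      replace 0 with (p x - p x) by ring.
      apply (is_derive_minus (V := R_NormedModule) P (fun t => RInt p 1 t)).
      + apply HP; [lra|]. intros ->. apply Hn. lra.
      + apply HI. lra.
    - intros x Hx. rewrite Rmin_left, Rmax_right in Hx by lra. apply HcD. lra.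
    - lra. }
  assert (E : D a = D b).
  { destruct (Rlt_dec a t0) as [H1 | H1]; [destruct (Rlt_dec t0 b) as [H2 | H2]|].
    - transitivity (D t0); apply Hcst; lra.
    - apply Hcst; lra.
    - apply Hcst; lra. }
  unfold D in E.
  assert (HCh := RInt_Chasles (V := R_CompleteNormedModule) p 1 a b).
  assert (RInt p 1 a + RInt p a b = RInt p 1 b); [|lra].
  apply HCh; apply ex_RInt_cont; intros t Ht; apply Hp.
  - assert (0 < Rmin 1 a) by (apply Rmin_glb_lt; lra). lra.
  - rewrite Rmin_left in Ht by lra. lra.
Qed.

(** * Cauchy's formula in the cut plane *)

Lemma Cderiv_dx f r t l : Cderiv f (r, t) l -> is_derive (fun x => Re (f (x, t))) r (Re l).
Proof.
  intros H. assert (E : forall x, ((0, t) + RtoC x * RtoC 1)%C = (x, t)).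
  { intros x. apply Ceq_intro; simpl; ring. }
  rewrite <- (E r) in H. apply Cderiv_line in H. destruct H as [H _].
  apply (is_derive_ext (fun x => Re (f ((0, t) + RtoC x * RtoC 1)%C))); [intros x; now rewrite E|].
  refine (is_derive_eq _ _ _ _ H _). rewrite Re_scal. ring.
Qed.

(** With [Cderiv_dx], the Cauchy-Riemann equation that turns the [r]-derivative of an integral in
    [t] into a difference of boundary values. *)
Lemma Cderiv_dy f r t l : Cderiv f (r, t) l -> is_derive (fun y => Im (f (r, y))) t (Re l).
Proof.
  intros H. assert (E : forall y, ((r, 0) + RtoC y * Ci)%C = (r, y)).
  { intros y. apply Ceq_intro; simpl; ring. }
  rewrite <- (E t) in H. apply Cderiv_line in H. destruct H as [_ H].
  apply (is_derive_ext (fun y => Im (f ((r, 0) + RtoC y * Ci)%C))); [intros y; now rewrite E|].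
  refine (is_derive_eq _ _ _ _ H _). simpl. unfold Re. ring.
Qed.

Lemma Ccont_y f r t : Ccont f (r, t) -> continuous (fun y => Re (f (r, y))) t.
Proof.
  intros H. apply filterlim_locally. intros eps.
  destruct (proj1 (Ccont_eps _ _) H eps (cond_pos eps)) as (d & Hd & Hb).
  exists (mkposreal (d / 2) ltac:(lra)). intros y Hy.
  change (Rabs (y - t) < d / 2) in Hy.
  change (Rabs (Re (f (r, y) - f (r, t))%C) < eps).
  eapply Rle_lt_trans; [apply re_le_Cmod|]. apply Hb, Cmod_lt_of_comp; simpl.
  - replace (r + - r) with 0 by ring. rewrite Rabs_R0. lra.
  - exact Hy.
Qed.

Lemma RInt_dist (f g h : R -> R) a b : a <= b -> ex_RInt f a b -> ex_RInt g a b -> ex_RInt h a b ->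
  (forall t, a < t < b -> Rabs (f t - g t) <= h t) -> Rabs (RInt f a b - RInt g a b) <= RInt h a b.
Proof.
  intros Hab Hf Hg Hh H.
  assert (E : RInt f a b - RInt g a b = RInt (fun t => f t - g t) a b).
  { symmetry. exact (RInt_minus (V := R_CompleteNormedModule) f g a b Hf Hg). }
  assert (Exm : ex_RInt (fun t => f t - g t) a b) by exact (ex_RInt_minus (V := R_NormedModule) f g a b Hf Hg).
  rewrite E. eapply Rle_trans; [apply abs_RInt_le; assumption|].
  apply RInt_le; [assumption | exact (ex_RInt_norm _ a b Exm) | assumption | assumption].
Qed.

Section Cauchy.
Variables (F F1 : C -> C) (u0 : C) (K del : R).
Hypothesis HF : forall u, Cderiv F u (F1 u).
Hypothesis HF1 : forall u, Ccont F1 u.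
Hypothesis Hu0 : Rabs (Im u0) < PI.
Hypothesis HK : 0 < K.
Hypothesis Hdel : 0 < del.
Hypothesis Hleft : forall u, Re u <= 0 -> Rabs (Im u) <= PI -> Cmod (F u) <= K.
Hypothesis Hright : forall u, 0 <= Re u -> Rabs (Im u) <= PI -> Cmod (F u) <= K * exp (- del * Re u).

(* [Psi] is [w (F - F u0) / (w - z)], [w = Cexp u], with its singularity at [u0] removed by
   writing it with difference quotients. *)
Let z := Cexp u0.
Let Psi u := (Slope F (F1 u0) u0 u * Cexp u * / Slope Cexp z u0 u)%C.
Let W u := (Cexp u * / (Cexp u + - z))%C.
Let W1 u := (Cexp u * / (Cexp u + - z)
   + Cexp u * (- Cexp u * / ((Cexp u + - z) * (Cexp u + - z))))%C.
(** [Q] equals [Psi] wherever [Cexp u <> z]; there it has the explicit derivative [Q1], whereas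
    [Psi] is only shown continuous. *)
Let Q u := ((F u + - F u0) * W u)%C.
Let Q1 u := (F1 u * W u + (F u + - F u0) * W1 u)%C.
Let J (r : R) : R := RInt (fun t => Re (Psi (r, t))) (- PI) PI.

Lemma exp_sub_neq_0 u : Cexp u <> z -> (Cexp u + - z)%C <> RtoC 0.
Proof. apply Cminus_neq_0. Qed.

Lemma Cexp_neq_z_Re u : Re u <> Re u0 -> Cexp u <> z.
Proof.
  intros H E. apply H. apply exp_inv. rewrite <- !Cmod_Cexp. now rewrite E.
Qed.

Lemma Cexp_neq_z_slab u : u <> u0 -> Rabs (Im u) <= PI -> Cexp u <> z.
Proof. intros H Hi E. apply H. now apply Cexp_inj. Qed.

Lemma Psi_Q u : Cexp u <> z -> Psi u = Q u.
Proof.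
  intros H. assert (Hn : u <> u0) by (intros ->; now apply H).
  assert (H1 := Cminus_neq_0 u u0 Hn). assert (H2 := exp_sub_neq_0 u H).
  unfold Psi, Q, W, Slope. destruct (Ceq_dec u u0) as [E | _]; [contradiction|].
  fold z. field. repeat split; assumption.
Qed.

(** The inverted quotient does not vanish: at [u0] it is [Cexp u0], and elsewhere [Cexp] separates
    [u] from [u0] on the closed strip. *)
Lemma Psi_cont u : Rabs (Im u) <= PI -> Ccont Psi u.
Proof.
  intros Hi. apply (Ccont_mult (fun u => Slope F (F1 u0) u0 u * Cexp u)%C).
  - apply Ccont_mult; [now apply Slope_cont|]. apply (Ccont_Cderiv _ _ _ (Cderiv_Cexp u)).
  - apply (Ccont_inv (Slope Cexp z u0)).
    + unfold Slope. destruct (Ceq_dec u u0) as [E | Hn]; [apply Cexp_neq_0|].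
      assert (H1 := Cminus_neq_0 u u0 Hn).
      assert (H2 := Cminus_neq_0 _ _ (Cexp_neq_z_slab u Hn Hi)).
      apply Cmod_gt_0. rewrite Cmod_div by assumption.
      apply Rdiv_lt_0_compat; now apply Cmod_gt_0.
    + apply (Slope_cont Cexp Cexp u0 u Cderiv_Cexp).
Qed.

Lemma W_deriv u : Cexp u <> z -> Cderiv W u (W1 u).
Proof.
  intros H. assert (H2 := exp_sub_neq_0 u H).
  assert (Hd : Cderiv (fun u => Cexp u + - z)%C u (Cexp u)).
  { eapply Cderiv_eq; [apply Cderiv_plus; [apply Cderiv_Cexp | apply Cderiv_const] | ring]. }
  exact (Cderiv_mult Cexp (fun u => / (Cexp u + - z))%C u _ _ (Cderiv_Cexp u)
    (Cderiv_inv (fun u => Cexp u + - z)%C u (Cexp u) H2 Hd)).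
Qed.

Lemma Q_deriv u : Cexp u <> z -> Cderiv Q u (Q1 u).
Proof.
  intros H. apply (Cderiv_mult (fun u => F u + - F u0)%C W u); [|now apply W_deriv].
  eapply Cderiv_eq; [apply (Cderiv_plus F (fun _ => - F u0)%C); [apply HF | apply Cderiv_const] | ring].
Qed.

Lemma Q1_cont u : Cexp u <> z -> Ccont Q1 u.
Proof.
  intros H. assert (H2 := exp_sub_neq_0 u H).
  assert (CE : Ccont Cexp u) by (apply (Ccont_Cderiv _ _ _ (Cderiv_Cexp u))).
  assert (CEz : Ccont (fun u => Cexp u + - z)%C u) by (apply Ccont_plus; [assumption | apply Ccont_const]).
  assert (CI : Ccont (fun u => / (Cexp u + - z))%C u) by (now apply (Ccont_inv (fun u => Cexp u + - z)%C)).
  assert (CF : Ccont F u) by (apply (Ccont_Cderiv _ _ _ (HF u))).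
  apply (Ccont_plus (fun u => F1 u * (Cexp u * / (Cexp u + - z)))%C).
  - apply Ccont_mult; [apply HF1|]. now apply (Ccont_mult Cexp).
  - apply (Ccont_mult (fun u => F u + - F u0)%C).
    + apply Ccont_plus; [assumption | apply Ccont_const].
    + apply (Ccont_plus (fun u => Cexp u * / (Cexp u + - z))%C).
      * now apply (Ccont_mult Cexp).
      * apply (Ccont_mult Cexp); [assumption|]. apply (Ccont_mult (fun u => - Cexp u)%C).
        -- now apply Ccont_opp.
        -- apply (Ccont_inv (fun u => (Cexp u + - z) * (Cexp u + - z))%C).
           ++ now apply Cmult_neq_0.
           ++ now apply (Ccont_mult (fun u => Cexp u + - z)%C).
Qed.

Lemma locally_neq (r c : R) : r <> c -> locally r (fun x => x <> c).
Proof.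
  intros H. exists (mkposreal (Rabs (r - c)) (Rabs_pos_lt _ (Rminus_eq_contra _ _ H))).
  intros x Hx E. subst x. change (Rabs (c - r) < Rabs (r - c)) in Hx.
  rewrite Rabs_minus_sym in Hx. lra.
Qed.

(** Differentiate under the integral; by Cauchy-Riemann the new integrand is a [t]-derivative. On
    the excluded line [Q] is singular at [u0]. *)
Lemma J_derive r : r <> Re u0 ->
  is_derive J r (Im (Psi (r, PI)) - Im (Psi (r, - PI))).
Proof.
  intros Hr.
  assert (Hne : forall x t, x <> Re u0 -> Cexp (x, t) <> z) by (intros x t Hx; now apply Cexp_neq_z_Re).
  apply (is_derive_ext_loc (fun r => RInt (fun t => Re (Q (r, t))) (- PI) PI)).
  { apply (filter_imp (fun x => x <> Re u0)); [|now apply locally_neq].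
    intros x Hx. apply RInt_ext. intros t _. f_equal. symmetry. apply Psi_Q. now apply Hne. }
  rewrite !Psi_Q by (now apply Hne).
  assert (HD : forall x t, x <> Re u0 -> Derive (fun x => Re (Q (x, t))) x = Re (Q1 (x, t))).
  { intros x t Hx. apply is_derive_unique, Cderiv_dx, Q_deriv. now apply Hne. }
  replace (Im (Q (r, PI)) - Im (Q (r, - PI)))
    with (RInt (fun t => Derive (fun x => Re (Q (x, t))) r) (- PI) PI).
  - apply is_derive_RInt_param.
    + apply (filter_imp (fun x => x <> Re u0)); [|now apply locally_neq].
      intros x Hx t _. eexists. apply (Cderiv_dx Q), Q_deriv. now apply Hne.
    + intros t _. apply (continuity_2d_pt_ext_loc (fun x t => Re (Q1 (x, t)))).
      * destruct (locally_neq r (Re u0) Hr) as [d Hd]. exists d.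
        intros u v Hu _. symmetry. apply HD. now apply Hd.
      * apply Ccont_2d, Q1_cont. now apply Hne.
    + apply (filter_imp (fun x => x <> Re u0)); [|now apply locally_neq].
      intros x Hx. apply ex_RInt_cont. intros t _.
      apply Ccont_y. apply (Ccont_Cderiv _ _ (Q1 (x, t))), Q_deriv. now apply Hne.
  - apply is_RInt_unique.
    apply (is_RInt_ext (fun t => Re (Q1 (r, t)))); [intros t _; symmetry; now apply HD|].
    apply (is_RInt_derive (V := R_CompleteNormedModule) (fun t => Im (Q (r, t)))).
    + intros t _. apply (Cderiv_dy Q), Q_deriv. now apply Hne.
    + intros t _. apply Ccont_y, Q1_cont. now apply Hne.
Qed.

Lemma Psi_ex_RInt r : ex_RInt (fun t => Re (Psi (r, t))) (- PI) PI.
Proof.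
  assert (HPI := PI_RGT_0). apply ex_RInt_cont.
  intros t Ht. rewrite Rmin_left, Rmax_right in Ht by lra.
  apply Ccont_y, Psi_cont. simpl. apply Rabs_le. lra.
Qed.

Lemma J_near r c eps : (forall t, - PI <= t <= PI -> Rabs (Re (Psi (r, t)) - c) <= eps) ->
  Rabs (J r - 2 * PI * c) <= 2 * PI * eps.
Proof.
  intros H. assert (HPI := PI_RGT_0).
  assert (Hc : RInt (fun _ => c) (- PI) PI = 2 * PI * c).
  { rewrite RInt_const. unfold scal; simpl; unfold mult; simpl. ring. }
  assert (He : RInt (fun _ => eps) (- PI) PI = 2 * PI * eps).
  { rewrite RInt_const. unfold scal; simpl; unfold mult; simpl. ring. }
  assert (Exc : forall k : R, ex_RInt (fun _ => k) (- PI) PI) by (intros; apply ex_RInt_const).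
  rewrite <- Hc, <- He.
  apply RInt_dist; [lra | apply Psi_ex_RInt | apply Exc | apply Exc |].
  intros t Ht. apply H. lra.
Qed.

(** Uniform continuity of [Psi] on a compact rectangle, including the line through [u0] that
    [J_derive] leaves out. *)
Lemma J_cont r : continuous J r.
Proof.
  assert (HPI := PI_RGT_0). apply filterlim_locally. intros eps.
  destruct (uniform_continuity_2d (fun x t => Re (Psi (x, t))) (r - 1) (r + 1) (- PI) PI) with
    (eps := mkposreal (eps / (4 * PI)) ltac:(apply Rdiv_lt_0_compat; [apply cond_pos | lra])) as [d Hd].
  { intros x t _ Ht. apply Ccont_2d, Psi_cont. simpl. apply Rabs_le. lra. }
  assert (Hdp := cond_pos d). assert (Hep := cond_pos eps).
  assert (Hm : 0 < Rmin 1 d) by (apply Rmin_glb_lt; lra).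
  exists (mkposreal _ Hm). intros x Hx. change (Rabs (x - r) < Rmin 1 d) in Hx.
  assert (Hx1 : Rabs (x - r) < 1) by (eapply Rlt_le_trans; [exact Hx | apply Rmin_l]).
  assert (Hx2 : Rabs (x - r) < d) by (eapply Rlt_le_trans; [exact Hx | apply Rmin_r]).
  apply Rabs_def2 in Hx1. change (Rabs (J x - J r) < eps).
  apply Rle_lt_trans with (RInt (fun _ => eps / (4 * PI)) (- PI) PI).
  - apply RInt_dist; [lra | apply Psi_ex_RInt | apply Psi_ex_RInt | apply ex_RInt_const |].
    intros t Ht. left. apply (Hd r t x t); try lra.
    replace (t - t) with 0 by ring. rewrite Rabs_R0. assumption.
  - rewrite RInt_const. unfold scal; simpl; unfold mult; simpl.
    replace ((PI - - PI) * (eps / (4 * PI))) with (eps / 2) by (field; lra). lra.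
Qed.

Lemma Re_plus (a b : C) : Re (a + b)%C = Re a + Re b.
Proof. reflexivity. Qed.

Lemma Cmod_minus_ge (a b : C) : Cmod a - Cmod b <= Cmod (a + - b)%C.
Proof.
  assert (Cmod a <= Cmod (a + - b)%C + Cmod b); [|lra].
  replace a with ((a + - b) + b)%C at 1 by ring. apply Cmod_triangle.
Qed.

Lemma J_lim_m eps : 0 < eps -> exists N, forall r, r < N -> Rabs (J r) < eps.
Proof.
  intros Heps. assert (HPI := PI_RGT_0). assert (Hz : 0 < Cmod z) by (apply Cmod_gt_0, Cexp_neq_0).
  set (A := K + Cmod (F u0)). assert (HA : 0 < A) by (unfold A; pose proof (Cmod_ge_0 (F u0)); lra).
  (* The first term gives [|w - z| >= |z|/2]; the second makes [2 PI * A * |w| * 2/|z|] less than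
     [eps/2]. *)
  set (e1 := Rmin (Cmod z / 2) (eps * Cmod z / (8 * PI * A))).
  assert (Hpa : 0 < 8 * PI * A) by (apply Rmult_lt_0_compat; [lra | assumption]).
  assert (He1 : 0 < e1).
  { apply Rmin_glb_lt; [lra|]. apply Rdiv_lt_0_compat; [now apply Rmult_lt_0_compat | assumption]. }
  exists (Rmin 0 (ln e1)). intros r Hr.
  assert (Hr0 : r < 0) by (eapply Rlt_le_trans; [exact Hr | apply Rmin_l]).
  assert (Hr1 : exp r < e1).
  { rewrite <- (exp_ln e1) by assumption. apply exp_increasing.
    eapply Rlt_le_trans; [exact Hr | apply Rmin_r]. }
  assert (Hr2 : exp r < Cmod z / 2) by (eapply Rlt_le_trans; [exact Hr1 | apply Rmin_l]).
  assert (Hr3 : exp r < eps * Cmod z / (8 * PI * A)) by (eapply Rlt_le_trans; [exact Hr1 | apply Rmin_r]).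
  assert (Hex := exp_pos r).
  assert (H : Rabs (J r - 2 * PI * 0) <= 2 * PI * (A * (exp r * (2 / Cmod z)))).
  { apply J_near. intros t Ht. rewrite Rminus_0_r.
    assert (Hd : Cmod z / 2 <= Cmod (Cexp (r, t) + - z)%C).
    { rewrite <- (Cmod_opp (Cexp (r, t) + - z)%C). replace (- (Cexp (r, t) + - z))%C with (z + - Cexp (r, t))%C by ring.
      eapply Rle_trans; [|apply Cmod_minus_ge]. rewrite (Cmod_Cexp (r, t)). simpl (Re (r, t)). lra. }
    assert (Hne : Cexp (r, t) <> z).
    { intros E. rewrite E in Hd. replace (z + - z)%C with (RtoC 0) in Hd by ring.
      rewrite Cmod_0 in Hd. lra. }
    rewrite Psi_Q by assumption. eapply Rle_trans; [apply re_le_Cmod|].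
    unfold Q, W. rewrite !Cmod_mult, Cmod_inv, (Cmod_Cexp (r, t)) by (now apply exp_sub_neq_0).
    apply Rmult_le_compat.
    - apply Cmod_ge_0.
    - apply Rmult_le_pos; [apply exp_nonneg | left; apply Rinv_0_lt_compat; lra].
    - eapply Rle_trans; [apply Cmod_triangle|]. rewrite Cmod_opp.
      apply Rplus_le_compat_r. apply Hleft; simpl; [lra | apply Rabs_le; lra].
    - simpl. apply Rmult_le_compat_l; [lra|].
      replace (2 / Cmod z) with (/ (Cmod z / 2)) by (field; lra).
      apply Rinv_le_contravar; lra. }
  replace (J r - 2 * PI * 0) with (J r) in H by ring.
  eapply Rle_lt_trans; [exact H|].
  apply Rlt_le_trans with (2 * PI * (A * (eps * Cmod z / (8 * PI * A) * (2 / Cmod z)))).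
  - apply Rmult_lt_compat_l; [lra|]. apply Rmult_lt_compat_l; [assumption|].
    apply Rmult_lt_compat_r; [apply Rdiv_lt_0_compat; lra | assumption].
  - replace (2 * PI * (A * (eps * Cmod z / (8 * PI * A) * (2 / Cmod z)))) with (eps / 2)
      by (field; lra). lra.
Qed.

Lemma J_lim_p eps : 0 < eps -> exists N, forall r, N < r -> Rabs (J r - 2 * PI * - Re (F u0)) < eps.
Proof.
  intros Heps. assert (HPI := PI_RGT_0). assert (Hz : 0 < Cmod z) by (apply Cmod_gt_0, Cexp_neq_0).
  set (e := eps / (16 * PI)). assert (He : 0 < e) by (apply Rdiv_lt_0_compat; lra).
  set (B := (Cmod (F u0) + 1) * Cmod z / e).
  assert (HF0 := Cmod_ge_0 (F u0)).
  assert (HB : 0 < B) by (apply Rdiv_lt_0_compat; [apply Rmult_lt_0_compat; lra | assumption]).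
  assert (HKe : 0 < K / e) by (now apply Rdiv_lt_0_compat).
  (* Beyond this point [Hright] applies, [|w| > 2 |z|], [|F| < e] and [|F u0| * |z| / |w| < e]. *)
  exists (Rmax (Rmax 0 (ln (2 * Cmod z))) (Rmax (ln (K / e) / del) (ln B))). intros r Hr.
  assert (Hr' := Rle_lt_trans _ _ _ (Rmax_l _ _) Hr). assert (Hr'' := Rle_lt_trans _ _ _ (Rmax_r _ _) Hr).
  assert (Hr0 := Rle_lt_trans _ _ _ (Rmax_l _ _) Hr'). assert (Hr1 := Rle_lt_trans _ _ _ (Rmax_r _ _) Hr').
  assert (Hr2 := Rle_lt_trans _ _ _ (Rmax_l _ _) Hr''). assert (Hr3 := Rle_lt_trans _ _ _ (Rmax_r _ _) Hr'').
  apply exp_increasing in Hr1. rewrite exp_ln in Hr1 by lra.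
  apply exp_increasing in Hr3. rewrite exp_ln in Hr3 by assumption.
  assert (Hr4 : K * exp (- del * r) < e).
  { assert (H1 : ln (K / e) < del * r).
    { replace (ln (K / e)) with (del * (ln (K / e) / del)) by (field; lra). now apply Rmult_lt_compat_l. }
    apply exp_increasing in H1. rewrite exp_ln in H1 by assumption.
    assert (H2 : exp (del * r) * exp (- del * r) = 1).
    { rewrite <- exp_plus. replace (del * r + - del * r) with 0 by ring. apply exp_0. }
    assert (H3 := exp_pos (- del * r)).
    replace e with (e * (exp (del * r) * exp (- del * r))) by (rewrite H2; ring).
    rewrite <- Rmult_assoc. apply Rmult_lt_compat_r; [assumption|].
    replace K with (e * (K / e)) by (field; lra). now apply Rmult_lt_compat_l. }
  assert (Hr5 : Cmod (F u0) * (Cmod z / exp r) < e).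
  { assert (Hex := exp_pos r). apply Rmult_lt_reg_r with (exp r); [assumption|].
    replace (Cmod (F u0) * (Cmod z / exp r) * exp r) with (Cmod (F u0) * Cmod z) by (field; lra).
    apply Rlt_le_trans with (e * B); [|apply Rmult_le_compat_l; lra].
    unfold B. replace (e * ((Cmod (F u0) + 1) * Cmod z / e)) with ((Cmod (F u0) + 1) * Cmod z) by (field; lra).
    lra. }
  assert (H : Rabs (J r - 2 * PI * - Re (F u0)) <= 2 * PI * (4 * e)).
  { apply J_near. intros t Ht.
    assert (Hd : exp r / 2 <= Cmod (Cexp (r, t) + - z)%C).
    { eapply Rle_trans; [|apply Cmod_minus_ge]. rewrite (Cmod_Cexp (r, t)). simpl (Re (r, t)). lra. }
    assert (Hne : Cexp (r, t) <> z).
    { intros E. rewrite E in Hd. replace (z + - z)%C with (RtoC 0) in Hd by ring.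
      rewrite Cmod_0 in Hd. lra. }
    assert (Hn := exp_sub_neq_0 _ Hne).
    rewrite Psi_Q by assumption.
    replace (Re (Q (r, t)) - - Re (F u0)) with (Re (Q (r, t) + F u0)%C) by (rewrite Re_plus; ring).
    eapply Rle_trans; [apply re_le_Cmod|].
    (* [w/(w - z)] is bounded and [1 - w/(w - z) = - z/(w - z)], so both terms tend to 0. *)
    replace (Q (r, t) + F u0)%C with
      (F (r, t) * (Cexp (r, t) * / (Cexp (r, t) + - z)) + - (F u0 * (z * / (Cexp (r, t) + - z))))%C
      by (unfold Q, W; field; assumption).
    eapply Rle_trans; [apply Cmod_triangle|].
    rewrite Cmod_opp, !Cmod_mult, Cmod_inv, (Cmod_Cexp (r, t)) by assumption. simpl (Re (r, t)).
    assert (Hi : / Cmod (Cexp (r, t) + - z)%C <= 2 / exp r).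
    { replace (2 / exp r) with (/ (exp r / 2)) by (field; pose proof (exp_pos r); lra).
      apply Rinv_le_contravar; [pose proof (exp_pos r); lra | assumption]. }
    assert (Hi0 : 0 < / Cmod (Cexp (r, t) + - z)%C) by (apply Rinv_0_lt_compat; now apply Cmod_gt_0).
    set (I := / Cmod (Cexp (r, t) + - z)%C) in *.
    assert (HF' : Cmod (F (r, t)) < e).
    { eapply Rle_lt_trans; [apply Hright; simpl; [lra | apply Rabs_le; lra] | exact Hr4]. }
    assert (HF0' := Cmod_ge_0 (F (r, t))).
    assert (H1 : exp r * I <= 2).
    { replace 2 with (exp r * (2 / exp r)) by (field; lra). apply Rmult_le_compat_l; lra. }
    assert (H1' : 0 <= exp r * I) by (apply Rmult_le_pos; lra).
    assert (H2 : Cmod (F (r, t)) * (exp r * I) <= e * 2) by (apply Rmult_le_compat; lra).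
    assert (H3 : Cmod (F u0) * (Cmod z * I) <= 2 * (Cmod (F u0) * (Cmod z / exp r))).
    { replace (2 * (Cmod (F u0) * (Cmod z / exp r))) with (Cmod (F u0) * (Cmod z * (2 / exp r))) by (field; lra).
      apply Rmult_le_compat_l; [lra|]. apply Rmult_le_compat_l; lra. }
    lra. }
  eapply Rle_lt_trans; [exact H|]. unfold e.
  replace (2 * PI * (4 * (eps / (16 * PI)))) with (eps / 2) by (field; lra). lra.
Qed.

(** The jump of [F] across the cut at [w = - t], over [t + z = - (w - z)]. *)
Let p t := Im ((F (ln t, PI) - F (ln t, (- PI)%R)) / (RtoC t + z))%C.

Lemma Cexp_pm_PI t : 0 < t -> Cexp (ln t, PI) = RtoC (- t) /\ Cexp (ln t, (- PI)%R) = RtoC (- t).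
Proof.
  intros Ht. unfold Cexp; simpl. rewrite cos_neg, sin_neg, cos_PI, sin_PI, exp_ln by assumption.
  split; apply Ceq_intro; simpl; ring.
Qed.

(** Both edges have the same [w = - t], so the subtracted [F u0] cancels; [1/t] is the derivative of
    [r = ln t]. *)
Lemma p_Psi t : 0 < t -> p t = / t * (Im (Psi (ln t, PI)) - Im (Psi (ln t, (- PI)%R))).
Proof.
  intros Ht. assert (HPI := PI_RGT_0). destruct (Cexp_pm_PI t Ht) as [E1 E2].
  assert (Hne : forall x, Rabs x = PI -> Cexp (ln t, x) <> z).
  { intros x Hx. apply Cexp_neq_z_slab; [|simpl; lra]. intros E. rewrite <- E in Hu0. simpl in Hu0. lra. }
  assert (N1 := Hne PI (Rabs_pos_eq _ (Rlt_le _ _ HPI))).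
  assert (N2 := Hne (- PI) ltac:(rewrite Rabs_Ropp; apply Rabs_pos_eq; lra)).
  assert (M1 := exp_sub_neq_0 _ N1). rewrite E1 in M1.
  assert (M2 : (RtoC t + z)%C <> RtoC 0).
  { intros E. apply M1. rewrite RtoC_opp. replace (- RtoC t + - z)%C with (- (RtoC t + z))%C by ring.
    rewrite E. ring. }
  rewrite !Psi_Q by assumption. unfold Q, W. rewrite E1, E2, RtoC_opp.
  unfold p.
  replace (Im ((F (ln t, PI) + - F u0) * (- RtoC t * / (- RtoC t + - z)))%C -
      Im ((F (ln t, (- PI)%R) + - F u0) * (- RtoC t * / (- RtoC t + - z)))%C)
    with (Im (RtoC t * ((F (ln t, PI) - F (ln t, (- PI)%R)) / (RtoC t + z)))%C).
  - rewrite Im_scal. field. lra.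
  - transitivity (Im ((F (ln t, PI) + - F u0) * (- RtoC t * / (- RtoC t + - z)) -
      (F (ln t, (- PI)%R) + - F u0) * (- RtoC t * / (- RtoC t + - z)))%C); [|reflexivity].
    f_equal. field. split; [rewrite <- RtoC_opp; exact M1 | exact M2].
Qed.

Lemma p_contpos : contpos p.
Proof.
  assert (HPI := PI_RGT_0).
  assert (Hc : forall x, Rabs x <= PI -> contpos (fun t => Im (Psi (ln t, x)))).
  { intros x Hx t Ht. apply (continuous_comp ln (fun r => Im (Psi (r, x)))).
    - apply ex_derive_cont. auto_derive. assumption.
    - destruct (Ccont_2d Psi (ln t) x (Psi_cont (ln t, x) Hx)) as [_ H].
      apply filterlim_locally. intros eps. destruct (H eps) as [d Hd]. exists d.
      intros y Hy. apply (Hd y x); [exact Hy|]. replace (x - x) with 0 by ring. rewrite Rabs_R0. apply cond_pos. }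
  intros t Ht. apply (continuous_ext_loc _ (fun t => / t * (Im (Psi (ln t, PI)) - Im (Psi (ln t, (- PI)%R))))).
  - exists (mkposreal t Ht). intros x Hx. apply Rabs_def2 in Hx.
    unfold minus, plus, opp in Hx; simpl in Hx. symmetry. apply p_Psi. lra.
  - apply (contpos_mult (fun t => / t)); [| |assumption].
    + apply contpos_derive. intros x Hx. auto_derive. lra.
    + intros x Hx. apply (continuous_minus (fun t => Im (Psi (ln t, PI)))); apply Hc; try assumption.
      * rewrite Rabs_pos_eq; lra.
      * rewrite Rabs_Ropp, Rabs_pos_eq; lra.
Qed.

(** [J (ln t)] is a primitive of [p], except for differentiability at [t = exp (Re u0)]. The
    imaginary part of [F u0] follows by applying this to [- Ci * F]. *)
Lemma cauchy_Re : is_int p (- (2 * PI * Re (F u0))).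
Proof.
  replace (- (2 * PI * Re (F u0))) with (2 * PI * - Re (F u0) - 0) by ring.
  apply (is_int_primitive (fun t => J (ln t))).
  - apply p_contpos.
  - intros a b Hab. apply (RInt_FTC_except (fun t => J (ln t)) p (exp (Re u0))); [apply p_contpos | | |assumption].
    + intros t Ht Hn. rewrite p_Psi by assumption.
      assert (Hl : ln t <> Re u0) by (intros E; apply Hn; rewrite <- E; now rewrite exp_ln).
      apply (is_derive_comp J ln t _ (/ t) (J_derive _ Hl)). auto_derive; [assumption | ring].
    + intros Ht. apply (continuous_comp ln J); [|apply J_cont].
      apply ex_derive_cont. auto_derive. assumption.
  - apply at_right_0_intro. intros eps Heps. destruct (J_lim_m eps Heps) as [N HN].
    exists (exp N). split; [apply exp_pos|]. intros t Ht. rewrite Rminus_0_r. apply HN.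
    rewrite <- (ln_exp N). now apply ln_increasing.
  - apply p_infty_intro. intros eps Heps. destruct (J_lim_p eps Heps) as [N HN].
    exists (exp N). intros t Ht. apply HN.
    rewrite <- (ln_exp N). apply ln_increasing; [apply exp_pos | assumption].
Qed.

End Cauchy.

(** * Principal branches and boundary values *)

Lemma Clog_Cexp v : Rabs (Im v) < PI -> Clog (Cexp v) = v.
Proof.
  intros Hv. unfold Clog. rewrite Cmod_Cexp, ln_exp. apply Ceq_intro; [reflexivity|].
  change (Carg (Cexp v) = Im v).
  assert (He := exp_pos (Re v)). apply Rabs_def2 in Hv.
  unfold Carg. rewrite Cmod_Cexp.
  replace (Re (Cexp v) / exp (Re v)) with (cos (Im v)) by (unfold Cexp; simpl; field; lra).
  change (Im (Cexp v)) with (exp (Re v) * sin (Im v)).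
  destruct (Rle_dec 0 (exp (Re v) * sin (Im v))) as [H | H].
  - apply acos_cos. destruct (Rle_lt_dec 0 (Im v)) as [H1 | H1]; [lra|].
    assert (0 < sin (- Im v)) by (apply sin_gt_0; lra). rewrite sin_neg in H0. nra.
  - destruct (Rle_lt_dec 0 (Im v)) as [H1 | H1].
    + exfalso. apply H. apply Rmult_le_pos; [lra|]. apply sin_ge_0; lra.
    + rewrite <- cos_neg, acos_cos by lra. ring.
Qed.

Lemma Cexp_Clog z : z <> RtoC 0 -> Cexp (Clog z) = z.
Proof.
  intros Hz. assert (Hm : 0 < Cmod z) by (now apply Cmod_gt_0).
  assert (HR := re_le_Cmod z). assert (H2 := Cmod2_alt z).
  assert (Hq : -1 <= Re z / Cmod z <= 1).
  { apply Rabs_le_between in HR. split.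
    - apply Rmult_le_reg_r with (Cmod z); [assumption|].
      unfold Rdiv. rewrite Rmult_assoc, Rinv_l by lra. lra.
    - apply Rmult_le_reg_r with (Cmod z); [assumption|].
      unfold Rdiv. rewrite Rmult_assoc, Rinv_l by lra. lra. }
  assert (Hs : Cmod z * sqrt (1 - Rsqr (Re z / Cmod z)) = Rabs (Im z)).
  { rewrite <- sqrt_Rsqr_abs. rewrite <- (sqrt_Rsqr (Cmod z)) at 1 by lra.
    rewrite <- sqrt_mult.
    - f_equal. unfold Rsqr. transitivity (Cmod z ^ 2 - Re z ^ 2); [field; lra|]. rewrite H2. ring.
    - apply Rle_0_sqr.
    - unfold Rsqr. nra. }
  unfold Clog, Cexp. simpl (Re (_, _)). simpl (Im (_, _)). rewrite exp_ln by assumption.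
  unfold Carg. destruct (Rle_dec 0 (Im z)) as [Hi | Hi].
  - rewrite cos_acos, sin_acos, Hs, Rabs_pos_eq by assumption.
    apply Ceq_intro; simpl; [field; lra | reflexivity].
  - rewrite cos_neg, sin_neg, cos_acos, sin_acos by assumption.
    replace (Cmod z * - sqrt (1 - Rsqr (Re z / Cmod z))) with (Im z).
    + apply Ceq_intro; simpl; [field; lra | reflexivity].
    + rewrite Ropp_mult_distr_r_reverse, Hs, Rabs_left by lra. ring.
Qed.

(** With [v = log(w/2)] the series in [(w/2)^2] becomes a series in [exp(2 v)]. *)
Lemma BesselI_Cexp m w v : Rabs (Im v) < PI -> (w / RtoC 2)%C = Cexp v ->
  BesselI m w = (Cexp (RtoC m * v) * eser (bcoef m) (v + v))%C.
Proof.
  intros Hv Hw. unfold BesselI, Cpower. rewrite Hw, Clog_Cexp by assumption. f_equal.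
  apply CSeries_ext. intros k. unfold eser_term, bcoef. f_equal.
  rewrite Cexp_nat, Cexp_plus, Cpow_mult_r. f_equal. simpl. ring.
Qed.

Lemma BesselK_Cexp m w v : Rabs (Im v) < PI -> (w / RtoC 2)%C = Cexp v ->
  BesselK m w = (RtoC (PI / 2) * (Cexp (RtoC (- m) * v) * kk m (v + v)) / RtoC (sin (m * PI)))%C.
Proof.
  intros Hv Hw. unfold BesselK. rewrite !(BesselI_Cexp _ w v Hv Hw). unfold kk.
  replace (Cexp (RtoC m * v)) with (Cexp (RtoC (- m) * v) * Cexp (RtoC m * (v + v)))%C.
  - f_equal. f_equal. ring.
  - rewrite <- Cexp_plus. f_equal. rewrite RtoC_opp. ring.
Qed.

Lemma Csqrt_half a z : 0 < a -> z <> RtoC 0 ->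
  (RtoC a * Csqrt z / RtoC 2)%C = Cexp (RtoC (ln (a / 2)) + RtoC (1 / 2) * Clog z)%C.
Proof.
  intros Ha Hz. rewrite Cexp_plus, Cexp_R, exp_ln by lra. unfold Csqrt, Cpower.
  rewrite (RtoC_div a 2) by lra. unfold Cdiv. ring.
Qed.

(** Halving the argument keeps [|Im v| < PI], so the principal branches compose without correction;
    the scale [a] becomes a real translation of [Clog z]. *)
Lemma BesselK_Csqrt a m z : 0 < a -> z <> RtoC 0 -> Rabs (Carg z) < PI ->
  BesselK m (RtoC a * Csqrt z)%C =
  (RtoC (PI / 2) / RtoC (sin (m * PI)) * RtoC (Rpower (a / 2) (- m)) * Cexp (RtoC (- (m / 2)) * Clog z)
   * kk m (Clog z + RtoC (2 * ln (a / 2))))%C.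
Proof.
  intros Ha Hz Hc. set (v := (RtoC (ln (a / 2)) + RtoC (1 / 2) * Clog z)%C).
  assert (Hv : Rabs (Im v) < PI).
  { replace (Im v) with (1 / 2 * Carg z) by (simpl; unfold Im, Re; simpl; ring).
    rewrite Rabs_mult, (Rabs_pos_eq (1 / 2)) by lra. pose proof (Rabs_pos (Carg z)). lra. }
  rewrite (BesselK_Cexp m _ v Hv (Csqrt_half a z Ha Hz)).
  replace (v + v)%C with (Clog z + RtoC (2 * ln (a / 2)))%C.
  2:{ unfold v. apply Ceq_intro; simpl; field. }
  replace (Cexp (RtoC (- m) * v)) with (RtoC (Rpower (a / 2) (- m)) * Cexp (RtoC (- (m / 2)) * Clog z))%C.
  - unfold Cdiv. ring.
  - unfold Rpower. rewrite <- Cexp_R, <- Cexp_plus. f_equal.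
    apply Ceq_intro; simpl; field.
Qed.

Lemma Series_zero : Series (fun _ => 0) = 0.
Proof.
  rewrite (Series_ext _ (fun k => 0 * 0)) by (intros; ring).
  rewrite (Series_scal_l 0 (fun _ => 0)). ring.
Qed.

Lemma Cexp_PI r : Cexp (r, PI) = RtoC (- exp r).
Proof. unfold Cexp; simpl. rewrite cos_PI, sin_PI. apply Ceq_intro; simpl; ring. Qed.

Lemma eser_at_PI c r : eser c (r, PI) = RtoC (Series (fun k => c k * (- exp r) ^ k)).
Proof.
  assert (H : forall k, eser_term c (r, PI) k = RtoC (c k * (- exp r) ^ k)).
  { intros k. unfold eser_term. now rewrite Cexp_nat, Cexp_PI, <- RtoC_pow, <- RtoC_mult. }
  apply Ceq_intro.
  - change (Series (fun k => Re (eser_term c (r, PI) k)) = Series (fun k => c k * (- exp r) ^ k)).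
    apply Series_ext. intros k. now rewrite H.
  - change (Series (fun k => Im (eser_term c (r, PI) k)) = 0).
    rewrite (Series_ext _ (fun _ => 0)); [apply Series_zero|]. intros k. now rewrite H.
Qed.

Lemma BesselJ_series m x r : 0 < x -> exp r = (x / 2) ^ 2 ->
  BesselJ m x = Rpower (x / 2) m * Series (fun k => bcoef m k * (- exp r) ^ k).
Proof.
  intros Hx Hr. unfold BesselJ. f_equal. apply Series_ext. intros k.
  rewrite Hr. unfold bcoef, Rdiv.
  replace (- (x * / 2) ^ 2) with (-1 * (x * / 2) ^ 2) by ring.
  rewrite (Rpow_mult_distr (-1) ((x * / 2) ^ 2)), (pow_mult (x * / 2) 2 k). ring.
Qed.

Lemma sin_mPI_pos m : 0 < m < 1 -> 0 < sin (m * PI).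
Proof. intros Hm. pose proof PI_RGT_0. apply sin_gt_0; nra. Qed.

(** On the upper edge [2 sqrt w = i x], and this is [K_m(i x) = - (PI/2) exp(- i PI m/2) (Y_m(x) + i
    J_m(x))]. The factor [exp(m (r + i PI))] of the series supplies [cos(m PI)] and [sin(m PI)]. *)
Lemma kk_at_PI m x r : 0 < m < 1 -> 0 < x -> exp r = (x / 2) ^ 2 ->
  kk m (r, PI) = (- RtoC (sin (m * PI) * Rpower (x / 2) m) * (BesselY m x, BesselJ m x))%C.
Proof.
  intros Hm Hx Hr. assert (Hs := sin_mPI_pos m Hm).
  unfold kk. rewrite !eser_at_PI.
  set (S1 := Series (fun k => bcoef (- m) k * (- exp r) ^ k)).
  set (S2 := Series (fun k => bcoef m k * (- exp r) ^ k)).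
  assert (HJ : BesselJ m x = Rpower (x / 2) m * S2) by (now apply BesselJ_series).
  assert (HJ' : BesselJ (- m) x = Rpower (x / 2) (- m) * S1) by (now apply BesselJ_series).
  assert (HX : exp (m * r) = Rpower (x / 2) m * Rpower (x / 2) m).
  { assert (Hl : r = 2 * ln (x / 2)).
    { rewrite <- (ln_exp r), Hr, ln_pow by lra. simpl. ring. }
    unfold Rpower. rewrite <- exp_plus, Hl. f_equal. ring. }
  assert (HP : Rpower (x / 2) m * Rpower (x / 2) (- m) = 1).
  { unfold Rpower. rewrite <- exp_plus. replace (m * ln (x / 2) + - m * ln (x / 2)) with 0 by ring. apply exp_0. }
  set (P := Rpower (x / 2) m) in *. set (P' := Rpower (x / 2) (- m)) in *.
  unfold BesselY. rewrite HJ, HJ'.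
  assert (HE : Cexp (RtoC m * (r, PI))%C = (P * P * cos (m * PI), P * P * sin (m * PI))).
  { unfold Cexp. rewrite Re_scal, Im_scal. simpl (Re (r, PI)). simpl (Im (r, PI)). now rewrite HX. }
  rewrite HE. apply Ceq_intro; simpl.
  - transitivity (P * P' * S1 - P * P * cos (m * PI) * S2); [rewrite HP; ring | field; lra].
  - ring.
Qed.

(** * From the Stieltjes to the Laplace transform *)

(** The half planes of [u] and [u + c] differ by a strip of width [|c|], on which the factor [exp A]
    makes the two bounds comparable. *)
Lemma kk_shift_bound m c : 0 < m < 1 -> exists K, 0 < K /\
  (forall u, Re u <= 0 -> Rabs (Im u) <= PI -> Cmod (kk m (u + RtoC c)%C) <= K) /\
  (forall u, 0 <= Re u -> Rabs (Im u) <= PI ->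
     Cmod (kk m (u + RtoC c)%C) <= K * exp ((m / 2 - 1 / 4) * Re u)).
Proof.
  intros Hm. destruct (kk_bound_left m Hm) as (K1 & HK1 & H1).
  destruct (kk_decay m Hm) as (K2 & HK2 & H2).
  set (q := m / 2 - 1 / 4) in *. set (A := Rabs q * Rabs c).
  assert (HA : 0 <= A) by (apply Rmult_le_pos; apply Rabs_pos).
  assert (HeA : 1 <= exp A) by (pose proof (exp_ineq1_le A); lra).
  assert (Hq : forall x, - Rabs c <= x <= Rabs c -> - A <= q * x <= A).
  { intros x Hx. apply Rabs_le_between. rewrite Rabs_mult. apply Rmult_le_compat_l; [apply Rabs_pos|].
    now apply Rabs_le. }
  assert (Hc := Rle_abs c). assert (Hc' := Rle_abs (- c)). rewrite Rabs_Ropp in Hc'.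
  exists ((K1 + K2) * exp A). split; [apply Rmult_lt_0_compat; [lra | apply exp_pos]|].
  assert (HR : forall u, Re (u + RtoC c)%C = Re u + c) by reflexivity.
  assert (HI : forall u, Im (u + RtoC c)%C = Im u) by (intros; simpl; unfold Im; ring).
  split; intros u Hu Hi; (destruct (Rle_lt_dec (Re u + c) 0) as [Hn | Hp];
    [eapply Rle_trans; [apply H1; now rewrite HR|]
    |eapply Rle_trans; [apply H2; [rewrite HR; lra | now rewrite HI]|]]); rewrite ?HR.
  - nra.
  - assert (exp (q * (Re u + c)) <= exp A) by (apply exp_le, Hq; lra).
    apply Rmult_le_compat; [lra | apply exp_nonneg | lra | assumption].
  - rewrite Rmult_assoc, <- exp_plus.
    assert (0 <= A + q * Re u) by (specialize (Hq (Re u)); lra).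
    pose proof (exp_ineq1_le (A + q * Re u)). nra.
  - rewrite Rmult_assoc, <- exp_plus.
    apply Rmult_le_compat; [lra | apply exp_nonneg | lra |].
    apply exp_le. specialize (Hq c). lra.
Qed.

Lemma is_int_pair (f : R -> C) l1 l2 : is_int (fun t => Re (f t)) l1 -> is_int (fun t => Im (f t)) l2 ->
  is_RInt_gen (V := C_R_NormedModule) f (at_right 0) (Rbar_locally p_infty) (l1, l2).
Proof.
  intros H1 H2.
  apply (filterlimi_locally (U := C_R_NormedModule) (fun ab => is_RInt f (fst ab) (snd ab))).
  intros eps.
  assert (E1 := proj1 (filterlimi_locally _ _) H1 eps).
  assert (E2 := proj1 (filterlimi_locally _ _) H2 eps).
  generalize (filter_and _ _ E1 E2). apply filter_imp.
  intros ab [(y1 & I1 & B1) (y2 & I2 & B2)]. exists (y1, y2). split.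
  - exact (is_RInt_fct_extend_pair (U := R_NormedModule) (V := R_NormedModule) f _ _ y1 y2 I1 I2).
  - split; assumption.
Qed.

Lemma contpos_ext (f g : R -> R) : (forall t, 0 < t -> f t = g t) -> contpos f -> contpos g.
Proof.
  intros H Hf t Ht. apply (continuous_ext_loc _ f); [|now apply Hf].
  exists (mkposreal t Ht). intros x Hx. apply Rabs_def2 in Hx.
  unfold minus, plus, opp in Hx; simpl in Hx. apply H. lra.
Qed.

Lemma lap_bounded f C : 0 <= C -> contpos f -> (forall t, 0 < t -> Rabs (f t) <= C) -> lap f.
Proof.
  intros HC Hf Hb. split; [assumption|]. intros s Hs.
  apply (absint_exp _ C s Hs HC); [now apply contpos_expmul|].
  intros t Ht. rewrite Rabs_mult, Rabs_exp, Rmult_comm.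
  apply Rmult_le_compat_r; [apply exp_nonneg | now apply Hb].
Qed.

Lemma lim_mult (F : (R -> Prop) -> Prop) (f g : R -> R) a b : Filter F ->
  filterlim f F (locally a) -> filterlim g F (locally b) ->
  filterlim (fun t => f t * g t) F (locally (a * b)).
Proof. intros HF Hf Hg. exact (filterlim_comp_2 f g Rmult Hf Hg (filterlim_mult (K := R_AbsRing) a b)). Qed.

Lemma lim_plus (F : (R -> Prop) -> Prop) (f g : R -> R) a b : Filter F ->
  filterlim f F (locally a) -> filterlim g F (locally b) ->
  filterlim (fun t => f t + g t) F (locally (a + b)).
Proof.
  intros HF Hf Hg.
  exact (filterlim_comp_2 f g Rplus Hf Hg (filterlim_plus (K := R_AbsRing) (V := R_NormedModule) a b)).
Qed.

Lemma lim_at_right_continuous (f : R -> R) : ex_derive f 0 -> filterlim f (at_right 0) (locally (f 0)).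
Proof.
  intros H. eapply filterlim_filter_le_1; [apply filter_le_within|].
  exact (ex_derive_continuous (V := R_NormedModule) f 0 H).
Qed.

Lemma lim_infty_bounded_mult (f g : R -> R) B : 0 <= B ->
  (forall t, 0 < t -> Rabs (f t) <= B) -> filterlim g (Rbar_locally p_infty) (locally 0) ->
  filterlim (fun t => f t * g t) (Rbar_locally p_infty) (locally 0).
Proof.
  intros HB Hf Hg. apply p_infty_intro. intros eps Heps.
  assert (He : 0 < eps / (B + 1)) by (apply Rdiv_lt_0_compat; lra).
  destruct (proj1 (filterlim_locally _ _) Hg (mkposreal _ He)) as [N HN].
  exists (Rmax 0 N). intros t Ht.
  assert (Ht0 := Rle_lt_trans _ _ _ (Rmax_l _ _) Ht). assert (Ht1 := Rle_lt_trans _ _ _ (Rmax_r _ _) Ht).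
  specialize (HN t Ht1). change (Rabs (g t - 0) < eps / (B + 1)) in HN. rewrite Rminus_0_r in *.
  rewrite Rabs_mult. specialize (Hf t Ht0).
  pose proof (Rabs_pos (g t)).
  apply Rle_lt_trans with (B * Rabs (g t)); [apply Rmult_le_compat_r; assumption|].
  replace eps with ((B + 1) * (eps / (B + 1))) by (field; lra). nra.
Qed.

(* With [z = x + i y] and [h1 + i h2 = Phi / (z + t)], a primitive of [exp(-z s) * Lint Phi s] is
   [- exp(-z s) * Lint (h1 + i h2) s]; no exchange of integrals is needed. *)
Lemma laplace_of_stieltjes (Phi h1 h2 : R -> R) x y : 0 <= x -> lap Phi ->
  contpos h1 -> absint h1 -> contpos h2 -> absint h2 ->
  (forall t, 0 < t -> (x + t) * h1 t - y * h2 t = Phi t) ->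
  (forall t, 0 < t -> y * h1 t + (x + t) * h2 t = 0) ->
  is_int (fun s => exp (- (x * s)) * cos (y * s) * Lint Phi s) (int0oo h1) /\
  is_int (fun s => - (exp (- (x * s)) * sin (y * s)) * Lint Phi s) (int0oo h2).
Proof.
  intros Hx HPhi C1 A1 C2 A2 E1 E2.
  assert (L1 := absint_lap h1 C1 A1). assert (L2 := absint_lap h2 C2 A2).
  set (H1 := Lint h1). set (H2 := Lint h2). set (G := Lint Phi).
  (* Multiplying by [t] under the integral gives, with [H = H1 + i H2], the equation
     [H' = z H - G]. *)
  assert (ET1 : forall s, 0 < s -> Lint (fun t => t * h1 t) s = G s - x * H1 s + y * H2 s).
  { intros s Hs. apply is_int_unique.
    assert (I := is_int_plus _ _ _ _ (is_int_plus _ _ _ _ (lap_correct Phi s HPhi Hs)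
      (is_int_scal _ (- x) _ (lap_correct h1 s L1 Hs))) (is_int_scal _ y _ (lap_correct h2 s L2 Hs))).
    fold G H1 H2 in I. replace (G s - x * H1 s + y * H2 s) with (G s + - x * H1 s + y * H2 s) by ring.
    revert I. apply is_int_ext. intros t Ht. rewrite <- (E1 t Ht). ring. }
  assert (ET2 : forall s, 0 < s -> Lint (fun t => t * h2 t) s = - y * H1 s - x * H2 s).
  { intros s Hs. apply is_int_unique.
    assert (I := is_int_plus _ _ _ _ (is_int_scal _ (- y) _ (lap_correct h1 s L1 Hs))
      (is_int_scal _ (- x) _ (lap_correct h2 s L2 Hs))).
    fold G H1 H2 in I. replace (- y * H1 s - x * H2 s) with (- y * H1 s + - x * H2 s) by ring.
    revert I. apply is_int_ext. intros t Ht.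
    replace (exp (- (s * t)) * (t * h2 t)) with
      (exp (- (s * t)) * (- y * h1 t - x * h2 t + (y * h1 t + (x + t) * h2 t))) by ring.
    rewrite (E2 t Ht). ring. }
  assert (D1 : forall s, 0 < s -> is_derive H1 s (- (G s - x * H1 s + y * H2 s))).
  { intros s Hs. rewrite <- (ET1 s Hs). now apply Lint_derive. }
  assert (D2 : forall s, 0 < s -> is_derive H2 s (- (- y * H1 s - x * H2 s))).
  { intros s Hs. rewrite <- (ET2 s Hs). now apply Lint_derive. }
  assert (CG : forall s, 0 < s -> ex_derive G s).
  { intros s Hs. eexists. now apply Lint_derive. }
  assert (X1 : forall s, 0 < s -> ex_derive H1 s) by (intros s Hs; eexists; now apply D1).
  assert (X2 : forall s, 0 < s -> ex_derive H2 s) by (intros s Hs; eexists; now apply D2).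
  assert (V1 : forall s, 0 < s -> Derive (fun s => H1 s) s = - (G s - x * H1 s + y * H2 s))
    by (intros s Hs; now apply is_derive_unique, D1).
  assert (V2 : forall s, 0 < s -> Derive (fun s => H2 s) s = - (- y * H1 s - x * H2 s))
    by (intros s Hs; now apply is_derive_unique, D2).
  assert (Z1 : filterlim H1 (at_right 0) (locally (int0oo h1))) by (now apply Lint_lim_0).
  assert (Z2 : filterlim H2 (at_right 0) (locally (int0oo h2))) by (now apply Lint_lim_0).
  assert (I1 : filterlim H1 (Rbar_locally p_infty) (locally 0)) by (now apply Lint_lim_infty).
  assert (I2 : filterlim H2 (Rbar_locally p_infty) (locally 0)) by (now apply Lint_lim_infty).
  (* [0 <= x] keeps the exponential bounded, so the boundary terms at [+oo] vanish with [H1] and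
     [H2]. *)
  assert (B : forall c s, 0 < s -> -1 <= c <= 1 -> Rabs (- (exp (- (x * s)) * c)) <= 1).
  { intros c s Hs Hc. rewrite Rabs_Ropp, Rabs_mult, Rabs_exp.
    assert (exp (- (x * s)) <= 1) by (apply Rle_trans with (exp 0); [apply exp_le; nra | right; apply exp_0]).
    assert (Rabs c <= 1) by (now apply Rabs_le). pose proof (exp_pos (- (x * s))). nra. }
  assert (Bc : forall s, 0 < s -> Rabs (- (exp (- (x * s)) * cos (y * s))) <= 1)
    by (intros s Hs; apply B; [assumption | apply COS_bound]).
  assert (Bs : forall s, 0 < s -> Rabs (- (exp (- (x * s)) * sin (y * s))) <= 1)
    by (intros s Hs; apply B; [assumption | apply SIN_bound]).
  assert (Bs' : forall s, 0 < s -> Rabs (- (exp (- (x * s)) * - sin (y * s))) <= 1).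
  { intros s Hs. apply B; [assumption|]. pose proof (SIN_bound (y * s)). lra. }
  assert (Z0 : filterlim (fun s => - (exp (- (x * s)) * cos (y * s))) (at_right 0) (locally (-1))).
  { replace (-1) with (- (exp (- (x * 0)) * cos (y * 0))) by (rewrite !Rmult_0_r, Ropp_0, exp_0, cos_0; ring).
    apply (lim_at_right_continuous (fun s => - (exp (- (x * s)) * cos (y * s)))). auto_derive. exact I. }
  assert (Z0s : filterlim (fun s => - (exp (- (x * s)) * sin (y * s))) (at_right 0) (locally 0)).
  { replace 0 with (- (exp (- (x * 0)) * sin (y * 0))) at 2 by (rewrite !Rmult_0_r, sin_0; ring).
    apply (lim_at_right_continuous (fun s => - (exp (- (x * s)) * sin (y * s)))). auto_derive. exact I. }
  assert (Z0s' : filterlim (fun s => - (exp (- (x * s)) * - sin (y * s))) (at_right 0) (locally 0)).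
  { replace 0 with (- (exp (- (x * 0)) * - sin (y * 0))) at 2 by (rewrite !Rmult_0_r, sin_0; ring).
    apply (lim_at_right_continuous (fun s => - (exp (- (x * s)) * - sin (y * s)))). auto_derive. exact I. }
  split.
  - replace (int0oo h1) with ((0 + 0) - (-1 * int0oo h1 + 0 * int0oo h2)) by ring.
    apply (is_int_FTC (fun s => - (exp (- (x * s)) * cos (y * s)) * H1 s + - (exp (- (x * s)) * sin (y * s)) * H2 s)).
    + intros s Hs. assert (XX1 := X1 s Hs). assert (XX2 := X2 s Hs).
      assert (VV1 := V1 s Hs). assert (VV2 := V2 s Hs).
      auto_derive; [tauto|]. rewrite VV1, VV2. ring.
    + apply contpos_derive. intros s Hs. assert (XG := CG s Hs). auto_derive. tauto.
    + apply lim_plus; [typeclasses eauto | |]; apply lim_mult; try typeclasses eauto; assumption.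
    + apply lim_plus; [typeclasses eauto | |]; (eapply lim_infty_bounded_mult; [|eassumption|eassumption]; lra).
  - replace (int0oo h2) with ((0 + 0) - (-1 * int0oo h2 + 0 * int0oo h1)) by ring.
    apply (is_int_FTC (fun s => - (exp (- (x * s)) * cos (y * s)) * H2 s + - (exp (- (x * s)) * - sin (y * s)) * H1 s)).
    + intros s Hs. assert (XX1 := X1 s Hs). assert (XX2 := X2 s Hs).
      assert (VV1 := V1 s Hs). assert (VV2 := V2 s Hs).
      auto_derive; [tauto|]. rewrite VV1, VV2. ring.
    + apply contpos_derive. intros s Hs. assert (XG := CG s Hs). auto_derive. tauto.
    + apply lim_plus; [typeclasses eauto | |]; apply lim_mult; try typeclasses eauto; assumption.
    + apply lim_plus; [typeclasses eauto | |]; (eapply lim_infty_bounded_mult; [|eassumption|eassumption]; lra).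
Qed.

(** * The product formula *)

Section Product.
Variables a b mu nu : R.
Hypothesis ha : 0 < a.
Hypothesis hb : 0 < b.
Hypothesis hmu : 0 < mu.
Hypothesis hnu : 0 < nu.
Hypothesis hmunu : nu + mu < 1.

Let la := 2 * ln (a / 2).
Let lb := 2 * ln (b / 2).
(** The sum of the decay exponents [1/4 - mu/2] and [1/4 - nu/2] of the two factors; positive
    exactly when [mu + nu < 1]. *)
Let del := 1 / 2 - (mu + nu) / 2.

Definition kprod (u : C) : C := (kk mu (u + RtoC la) * kk nu (u + RtoC lb))%C.

Definition kprod' (u : C) : C :=
  (kk' mu (u + RtoC la) * kk nu (u + RtoC lb) + kk mu (u + RtoC la) * kk' nu (u + RtoC lb))%C.

(** Half of the jump across the cut: by [kprod_conj] the two boundary values differ by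
    [2 i * jump t]. *)
Definition jump (t : R) : R := Im (kprod (ln t, PI)).

Lemma Cderiv_shift f f' c u : Cderiv f (u + c)%C (f' (u + c)%C) ->
  Cderiv (fun u => f (u + c)%C) u (f' (u + c)%C).
Proof.
  intros H. eapply Cderiv_eq.
  - apply (Cderiv_comp f (fun u => u + c)%C u); [exact H|].
    apply Cderiv_plus; [apply Cderiv_id | apply Cderiv_const].
  - ring.
Qed.

Lemma kprod_deriv u : Cderiv kprod u (kprod' u).
Proof.
  apply (Cderiv_mult (fun u => kk mu (u + RtoC la))%C (fun u => kk nu (u + RtoC lb))%C);
    apply (Cderiv_shift (kk _) (kk' _)), kk_deriv; lra.
Qed.

Lemma kprod'_cont u : Ccont kprod' u.
Proof.
  assert (H : forall m c, 0 < m < 1 -> Ccont (fun u => kk m (u + RtoC c))%C u /\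
    Ccont (fun u => kk' m (u + RtoC c))%C u).
  { intros m c Hm. split; eapply Ccont_Cderiv.
    - apply (Cderiv_shift (kk m) (kk' m)), kk_deriv. lra.
    - apply (Cderiv_shift (kk' m) (fun u => RtoC m * kk' m u + Cexp u * kk m u)%C), kk'_deriv. lra. }
  destruct (H mu la ltac:(lra)) as [H1 H2]. destruct (H nu lb ltac:(lra)) as [H3 H4].
  apply (Ccont_plus (fun u => kk' mu (u + RtoC la) * kk nu (u + RtoC lb))%C);
    [apply (Ccont_mult (fun u => kk' mu (u + RtoC la))%C) | apply (Ccont_mult (fun u => kk mu (u + RtoC la))%C)];
    assumption.
Qed.

Lemma kprod_conj u : kprod (Cconj u) = Cconj (kprod u).
Proof.
  unfold kprod. rewrite Cconj_mult, <- !kk_conj, !Cconj_plus, !Cconj_R. reflexivity.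
Qed.

Lemma kprod_bound : exists K, 0 < K /\
  (forall u, Re u <= 0 -> Rabs (Im u) <= PI -> Cmod (kprod u) <= K) /\
  (forall u, 0 <= Re u -> Rabs (Im u) <= PI -> Cmod (kprod u) <= K * exp (- del * Re u)).
Proof.
  destruct (kk_shift_bound mu la ltac:(lra)) as (K1 & HK1 & L1 & R1).
  destruct (kk_shift_bound nu lb ltac:(lra)) as (K2 & HK2 & L2 & R2).
  exists (K1 * K2). split; [now apply Rmult_lt_0_compat|]. split; intros u Hu Hi;
    unfold kprod; rewrite Cmod_mult.
  - apply Rmult_le_compat; try apply Cmod_ge_0; [now apply L1 | now apply L2].
  - replace (K1 * K2 * exp (- del * Re u)) with
      (K1 * exp ((mu / 2 - 1 / 4) * Re u) * (K2 * exp ((nu / 2 - 1 / 4) * Re u))).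
    + apply Rmult_le_compat; try apply Cmod_ge_0; [now apply R1 | now apply R2].
    + replace (- del * Re u) with ((mu / 2 - 1 / 4) * Re u + (nu / 2 - 1 / 4) * Re u)
        by (unfold del; field).
      rewrite exp_plus. ring.
Qed.

Lemma Cconj_ln_PI t : ((ln t, (- PI)%R) : C) = Cconj (ln t, PI).
Proof. reflexivity. Qed.

Lemma stieltjes_jump u0 : Rabs (Im u0) < PI ->
  is_int (fun t => Re (RtoC (jump t) / (Cexp u0 + RtoC t))%C) (- PI * Re (kprod u0)) /\
  is_int (fun t => Im (RtoC (jump t) / (Cexp u0 + RtoC t))%C) (- PI * Im (kprod u0)).
Proof.
  intros Hu. assert (Hdel : 0 < del) by (unfold del; lra).
  destruct kprod_bound as (K & HK & HL & HR).
  assert (HX : forall t, (kprod (ln t, PI) - kprod (ln t, (- PI)%R))%C = (RtoC (2 * jump t) * Ci)%C).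
  { intros t. rewrite Cconj_ln_PI, kprod_conj. unfold jump. apply Ceq_intro; simpl; unfold Re, Im; simpl; ring. }
  (* [- t] is the exponential of an edge point, while [u0] lies strictly inside the strip. *)
  assert (Hn : forall t, 0 < t -> (Cexp u0 + RtoC t)%C <> RtoC 0).
  { intros t Ht E. assert (Hz : Cexp u0 = Cexp (ln t, PI)).
    { rewrite Cexp_PI, exp_ln by assumption. rewrite RtoC_opp.
      replace (Cexp u0) with (Cexp u0 + RtoC t - RtoC t)%C by ring. rewrite E. ring. }
    symmetry in Hz. apply Cexp_inj in Hz; [|simpl; rewrite Rabs_pos_eq; pose proof PI_RGT_0; lra | assumption].
    rewrite <- Hz in Hu. simpl in Hu. rewrite Rabs_pos_eq in Hu; pose proof PI_RGT_0; lra. }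
  split.
  - assert (I := cauchy_Re kprod kprod' u0 K del kprod_deriv kprod'_cont Hu HK Hdel HL HR).
    apply (is_int_scal _ (1 / 2)) in I.
    replace (1 / 2 * - (2 * PI * Re (kprod u0))) with (- PI * Re (kprod u0)) in I by field.
    revert I. apply is_int_ext. intros t Ht. rewrite HX, RtoC_mult, (Cplus_comm (RtoC t)).
    replace (RtoC 2 * RtoC (jump t) * Ci / (Cexp u0 + RtoC t))%C
      with (RtoC 2 * (Ci * (RtoC (jump t) / (Cexp u0 + RtoC t))))%C by (field; now apply Hn).
    rewrite Im_scal. destruct (RtoC (jump t) / (Cexp u0 + RtoC t))%C. simpl. field.
  - assert (Hm : forall u, Cmod (- Ci * kprod u)%C = Cmod (kprod u)).
    { intros u. rewrite Cmod_mult, Cmod_opp, Cmod_Ci. ring. }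
    (* [Re (- i F) = Im F], and the factor [- i] preserves both bounds. *)
    assert (I := cauchy_Re (fun u => - Ci * kprod u)%C (fun u => - Ci * kprod' u)%C u0 K del
      (fun u => Cderiv_scal (- Ci)%C _ _ _ (kprod_deriv u))
      (fun u => Ccont_mult (fun _ => - Ci)%C _ u (Ccont_const _ u) (kprod'_cont u)) Hu HK Hdel
      (fun u H1 H2 => eq_ind_r (fun x => x <= K) (HL u H1 H2) (Hm u))
      (fun u H1 H2 => eq_ind_r (fun x => x <= K * exp (- del * Re u)) (HR u H1 H2) (Hm u))).
    apply (is_int_scal _ (1 / 2)) in I.
    replace (1 / 2 * - (2 * PI * Re (- Ci * kprod u0)%C)) with (- PI * Im (kprod u0)) in I
      by (simpl; unfold Im; field).
    revert I. apply is_int_ext. intros t Ht.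
    replace (- Ci * kprod (ln t, PI) - - Ci * kprod (ln t, (- PI)%R))%C
      with (- Ci * (kprod (ln t, PI) - kprod (ln t, (- PI)%R)))%C by ring.
    rewrite HX, RtoC_mult, (Cplus_comm (RtoC t)).
    replace (- Ci * (RtoC 2 * RtoC (jump t) * Ci))%C with (RtoC 2 * RtoC (jump t))%C.
    + unfold Cdiv. rewrite <- Cmult_assoc, Im_scal. field.
    + apply Ceq_intro; simpl; ring.
Qed.

Lemma jump_contpos : contpos jump.
Proof.
  intros t Ht. apply (continuous_comp ln (fun r => Im (kprod (r, PI)))).
  - apply ex_derive_cont. auto_derive. assumption.
  - destruct (Ccont_2d kprod (ln t) PI (Ccont_Cderiv _ _ _ (kprod_deriv _))) as [_ H].
    apply filterlim_locally. intros eps. destruct (H eps) as [d Hd]. exists d.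
    intros y Hy. apply (Hd y PI); [exact Hy|]. replace (PI - PI) with 0 by ring. rewrite Rabs_R0. apply cond_pos.
Qed.

Lemma jump_bound : exists K, 0 < K /\ forall t, 0 < t -> Rabs (jump t) <= K * Rpower (1 + t) (- del).
Proof.
  assert (Hdel : 0 < del) by (unfold del; lra). assert (HPI := PI_RGT_0).
  destruct kprod_bound as (K & HK & HL & HR).
  (* [1 + t <= 2] for [t <= 1] and [1 + t <= 2 t] for [t >= 1]: the factor [2^del] covers both. *)
  exists (K * Rpower 2 del). split; [apply Rmult_lt_0_compat; [assumption | apply Rpower_pos]|].
  intros t Ht. eapply Rle_trans; [apply Im_le_Cmod|].
  assert (HI : Rabs (Im (ln t, PI)) <= PI) by (simpl; rewrite Rabs_pos_eq; lra).
  rewrite Rmult_assoc. unfold Rpower. rewrite <- exp_plus.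
  destruct (Rle_lt_dec t 1) as [H1 | H1].
  - eapply Rle_trans; [apply HL; [simpl; rewrite <- ln_1; now apply ln_le | assumption]|].
    rewrite <- (Rmult_1_r K) at 1. apply Rmult_le_compat_l; [lra|].
    apply Rle_trans with (exp 0); [right; now rewrite exp_0|]. apply exp_le.
    assert (ln (1 + t) <= ln 2) by (apply ln_le; lra). nra.
  - eapply Rle_trans; [apply HR; [simpl; rewrite <- ln_1; apply ln_le; lra | assumption]|].
    apply Rmult_le_compat_l; [lra|]. apply exp_le. simpl.
    assert (ln (1 + t) <= ln 2 + ln t) by (rewrite <- ln_mult by lra; apply ln_le; lra). nra.
Qed.

Definition bessel_kernel (t : R) : R :=
  Rpower t ((mu + nu) / 2) *
  (BesselJ mu (a * sqrt t) * BesselY nu (b * sqrt t)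
   + BesselJ nu (b * sqrt t) * BesselY mu (a * sqrt t)).

(** The factors of [kk_at_PI] at [a sqrt t] and [b sqrt t], without the power [t^((mu+nu)/2)] that
    goes into the kernel. *)
Definition jump_const : R :=
  sin (mu * PI) * sin (nu * PI) * Rpower (a / 2) mu * Rpower (b / 2) nu.

Lemma jump_const_pos : 0 < jump_const.
Proof.
  assert (H1 := sin_mPI_pos mu ltac:(lra)). assert (H2 := sin_mPI_pos nu ltac:(lra)).
  repeat (apply Rmult_lt_0_compat; [|apply Rpower_pos]). now apply Rmult_lt_0_compat.
Qed.

Lemma shift_sqrt c t : 0 < c -> 0 < t ->
  exp (ln t + 2 * ln (c / 2)) = (c * sqrt t / 2) ^ 2.
Proof.
  intros Hc Ht. rewrite exp_plus, exp_ln by assumption.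
  replace (2 * ln (c / 2)) with (ln (c / 2) + ln (c / 2)) by ring.
  rewrite exp_plus, exp_ln by lra.
  rewrite <- (sqrt_sqrt t) at 1 by lra. field.
Qed.

Lemma Rpower_half_sqrt c t m : 0 < c -> 0 < t ->
  Rpower (c * sqrt t / 2) m = Rpower (c / 2) m * Rpower t (m / 2).
Proof.
  intros Hc Ht. assert (Hs := sqrt_lt_R0 t Ht).
  replace (c * sqrt t / 2) with (c / 2 * sqrt t) by field.
  rewrite <- Rpower_mult_distr by lra. f_equal.
  rewrite <- Rpower_sqrt by assumption. rewrite Rpower_mult. f_equal. field.
Qed.

(** The two minus signs cancel, and [Im ((Y1 + i J1) (Y2 + i J2)) = J1 Y2 + Y1 J2] is the bracket of
    the kernel. *)
Lemma jump_kernel t : 0 < t -> jump t = jump_const * bessel_kernel t.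
Proof.
  intros Ht. assert (Hs := sqrt_lt_R0 t Ht).
  unfold jump, kprod.
  assert (Hp : forall c, ((ln t, PI) + RtoC c)%C = (ln t + c, PI)) by (intros; apply Ceq_intro; simpl; ring).
  rewrite !Hp.
  rewrite (kk_at_PI mu (a * sqrt t)), (kk_at_PI nu (b * sqrt t));
    try (apply shift_sqrt; assumption); try (now apply Rmult_lt_0_compat); try lra.
  rewrite !Rpower_half_sqrt by assumption.
  unfold jump_const, bessel_kernel.
  replace ((mu + nu) / 2) with (mu / 2 + nu / 2) by field. rewrite Rpower_plus. simpl. ring.
Qed.

Lemma bessel_kernel_jump t : 0 < t -> bessel_kernel t = / jump_const * jump t.
Proof.
  intros Ht. rewrite jump_kernel by assumption. pose proof jump_const_pos. field. lra.
Qed.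

(** The prefactor [z^((mu+nu)/2)] cancels exactly the powers of [z] that [BesselK_Csqrt] leaves
    outside [kk]; each factor contributes [PI/2]. *)
Lemma lhs_kprod z : z <> RtoC 0 -> Rabs (Carg z) < PI ->
  (Cpower z ((mu + nu) / 2) * BesselK mu (RtoC a * Csqrt z) * BesselK nu (RtoC b * Csqrt z))%C
  = (RtoC (PI ^ 2 / 4 * / jump_const) * kprod (Clog z))%C.
Proof.
  intros Hz Hc. rewrite (BesselK_Csqrt a mu z ha Hz Hc), (BesselK_Csqrt b nu z hb Hz Hc).
  assert (H1 := sin_mPI_pos mu ltac:(lra)). assert (H2 := sin_mPI_pos nu ltac:(lra)).
  assert (HA := Rpower_pos (a / 2) mu). assert (HB := Rpower_pos (b / 2) nu).
  unfold kprod. fold la lb. unfold Cpower.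
  set (k1 := kk mu (Clog z + RtoC la)%C). set (k2 := kk nu (Clog z + RtoC lb)%C).
  rewrite <- !RtoC_div by lra. rewrite !Rpower_Ropp.
  assert (HE : (Cexp (RtoC ((mu + nu) / 2) * Clog z) * Cexp (RtoC (- (mu / 2)) * Clog z)
    * Cexp (RtoC (- (nu / 2)) * Clog z))%C = RtoC 1).
  { rewrite <- !Cexp_plus, <- !Cmult_plus_distr_r, <- !RtoC_plus.
    replace ((mu + nu) / 2 + - (mu / 2) + - (nu / 2)) with 0 by field.
    rewrite Cmult_0_l. apply Cexp_0. }
  set (E0 := Cexp (RtoC ((mu + nu) / 2) * Clog z)%C) in *.
  set (E1 := Cexp (RtoC (- (mu / 2)) * Clog z)%C) in *.
  set (E2 := Cexp (RtoC (- (nu / 2)) * Clog z)%C) in *.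
  replace (PI ^ 2 / 4 * / jump_const) with
    (PI / 2 / sin (mu * PI) * / Rpower (a / 2) mu * (PI / 2 / sin (nu * PI) * / Rpower (b / 2) nu))
    by (unfold jump_const; field; repeat split; lra).
  rewrite !RtoC_mult.
  transitivity ((E0 * E1 * E2) * (RtoC (PI / 2 / sin (mu * PI)) * RtoC (/ Rpower (a / 2) mu) *
    (RtoC (PI / 2 / sin (nu * PI)) * RtoC (/ Rpower (b / 2) nu)) * (k1 * k2)))%C; [ring|].
  rewrite HE. ring.
Qed.

End Product.

Theorem theorem15 (a b mu nu : R) (z : C)
  (ha : 0 < a) (hb : 0 < b) (hmu : 0 < mu) (hnu : 0 < nu)
  (hmunu : nu + mu < 1) (hz : z <> RtoC 0) (hargz : Rabs (Carg z) < PI) :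
  let lhs : C :=
    (Cpower z ((mu + nu) / 2) * BesselK mu (RtoC a * Csqrt z)
     * BesselK nu (RtoC b * Csqrt z))%C in
  let g (t : R) : R :=
    Rpower t ((mu + nu) / 2) *
    (BesselJ mu (a * sqrt t) * BesselY nu (b * sqrt t)
     + BesselJ nu (b * sqrt t) * BesselY mu (a * sqrt t)) in
  let stieltjes (t : R) : C := (RtoC (g t) / (z + RtoC t))%C in
  let phi (s : R) : R := - (PI / 4) * int0oo (fun t => exp (- (s * t)) * g t) in
  let laplace (s : R) : C := (Cexp (- (z * RtoC s)) * RtoC (phi s))%C in
  (ex_int0oo (V := C_R_NormedModule) stieltjes
   /\ lhs = (RtoC (- (PI / 4))
             * int0oo (V := C_R_CompleteNormedModule) stieltjes)%C)
  /\
  (0 <= Re z ->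
   (forall s : R, 0 < s -> ex_int0oo (fun t => exp (- (s * t)) * g t))
   /\ ex_int0oo (V := C_R_NormedModule) laplace
   /\ lhs = int0oo (V := C_R_CompleteNormedModule) laplace).
Proof.
  intros lhs g stieltjes phi laplace.
  set (cst := jump_const a b mu nu).
  assert (Hcst : 0 < cst) by (now apply jump_const_pos).
  set (F0 := kprod a b mu nu (Clog z)).
  set (j := jump a b mu nu).
  assert (Hlhs : lhs = (RtoC (PI ^ 2 / 4 * / cst) * F0)%C) by (now apply lhs_kprod).
  assert (Hg : forall t, 0 < t -> g t = / cst * j t) by (intros t Ht; now apply bessel_kernel_jump).
  destruct (stieltjes_jump a b mu nu hmu hnu hmunu (Clog z) hargz) as [I1 I2].
  rewrite Cexp_Clog in I1, I2 by assumption. fold j F0 in I1, I2.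
  assert (HS : forall t, 0 < t -> stieltjes t = (RtoC (/ cst) * (RtoC (j t) / (z + RtoC t)))%C).
  { intros t Ht. unfold stieltjes. rewrite Hg, RtoC_mult by assumption. unfold Cdiv. ring. }
  assert (IS : is_RInt_gen (V := C_R_NormedModule) stieltjes (at_right 0) (Rbar_locally p_infty)
    (/ cst * (- PI * Re F0), / cst * (- PI * Im F0))).
  { apply is_int_pair.
    - apply (is_int_ext (fun t => / cst * Re (RtoC (j t) / (z + RtoC t))%C)).
      + intros t Ht. now rewrite HS, Re_scal.
      + now apply is_int_scal.
    - apply (is_int_ext (fun t => / cst * Im (RtoC (j t) / (z + RtoC t))%C)).
      + intros t Ht. now rewrite HS, Im_scal.
      + now apply is_int_scal. }
  split.
  { split; [eexists; exact IS|].
    assert (US : int0oo (V := C_R_CompleteNormedModule) stieltjes = _)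
      by exact (is_RInt_gen_unique (V := C_R_CompleteNormedModule) _ _ IS).
    rewrite US, Hlhs.
    apply Ceq_intro; rewrite ?Re_scal, ?Im_scal; simpl; unfold Re, Im; field; lra. }
  intros Hre.
  set (del := 1 / 2 - (mu + nu) / 2). assert (Hdel : 0 < del) by (unfold del; lra).
  destruct (jump_bound a b mu nu hmu hnu hmunu) as (K & HK & HKb). fold del j in HKb.
  assert (Cj : contpos j) by (now apply jump_contpos).
  assert (Lj : lap j).
  { apply (lap_bounded j K); [lra | assumption|]. intros t Ht.
    eapply Rle_trans; [now apply HKb|]. rewrite <- (Rmult_1_r K) at 2.
    apply Rmult_le_compat_l; [lra|]. apply Rle_trans with (exp 0); [|right; apply exp_0].
    apply exp_le.
    assert (0 < ln (1 + t)) by (rewrite <- ln_1; apply ln_increasing; lra). nra. }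
  set (h1 := fun t => Re (RtoC (j t) / (z + RtoC t))%C).
  set (h2 := fun t => Im (RtoC (j t) / (z + RtoC t))%C).
  set (x := Re z) in *. set (y := Im z).
  assert (Hzm : 0 < Cmod z) by (now apply Cmod_gt_0).
  (* For [Re z >= 0], [|z + t|] is at least [|z|] and at least [t], hence at least their mean, which
     is at least [kap * (1 + t)]. *)
  set (kap := Rmin (Cmod z) 1 / 2).
  assert (Hkap : 0 < kap).
  { unfold kap. assert (0 < Rmin (Cmod z) 1) by (apply Rmin_glb_lt; lra). lra. }
  assert (Hmod : forall t, 0 < t -> kap * (1 + t) <= Cmod (z + RtoC t)%C).
  { intros t Ht.
    assert (Hm1 : Cmod z <= Cmod (z + RtoC t)%C).
    { apply Rsqr_incr_0_var; [|apply Cmod_ge_0]. unfold Rsqr.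
      assert (E1 := Cmod2_alt z). assert (E2 := Cmod2_alt (z + RtoC t)%C).
      replace (Re (z + RtoC t)%C) with (x + t) in E2 by reflexivity.
      replace (Im (z + RtoC t)%C) with (Im z) in E2 by (simpl; unfold Im; ring).
      fold x in E1. nra. }
    assert (Hm2 : t <= Cmod (z + RtoC t)%C).
    { eapply Rle_trans; [|apply re_le_Cmod]. eapply Rle_trans; [|apply Rle_abs]. simpl. fold (Re z). fold x. lra. }
    assert (Rmin (Cmod z) 1 <= Cmod z) by apply Rmin_l. assert (Rmin (Cmod z) 1 <= 1) by apply Rmin_r.
    unfold kap. nra. }
  assert (Hzt : forall t, 0 < t -> (z + RtoC t)%C <> RtoC 0).
  { intros t Ht. apply Cmod_gt_0. specialize (Hmod t Ht). nra. }
  assert (Ch : contpos h1 /\ contpos h2).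
  { assert (Hcz : forall t, 0 < t -> (x + t) ^ 2 + y ^ 2 <> 0).
    { intros t Ht. specialize (Hzt t Ht). apply Cmod_gt_0 in Hzt. assert (E := Cmod2_alt (z + RtoC t)%C).
      replace (Re (z + RtoC t)%C) with (x + t) in E by reflexivity.
      replace (Im (z + RtoC t)%C) with y in E by (unfold y; simpl; unfold Im; ring). nra. }
    assert (Cq : contpos (fun t => (x + t) / ((x + t) ^ 2 + y ^ 2)) /\ contpos (fun t => - y / ((x + t) ^ 2 + y ^ 2))).
    { split; apply contpos_derive; intros t Ht; specialize (Hcz t Ht); auto_derive; simpl in *; tauto. }
    destruct Cq as [Cq1 Cq2]. split.
    - apply (contpos_ext (fun t => j t * ((x + t) / ((x + t) ^ 2 + y ^ 2)))).
      + intros t Ht. unfold h1, Cdiv. rewrite Re_scal. f_equal.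
        simpl. rewrite Rplus_0_r. reflexivity.
      + now apply contpos_mult.
    - apply (contpos_ext (fun t => j t * (- y / ((x + t) ^ 2 + y ^ 2)))).
      + intros t Ht. unfold h2, Cdiv. rewrite Im_scal. f_equal.
        simpl. rewrite Rplus_0_r. reflexivity.
      + now apply contpos_mult. }
  destruct Ch as [Ch1 Ch2].
  (* The decay of the jump and the denominator together give the integrable power that
     [laplace_of_stieltjes] requires. *)
  assert (Hb : forall t, 0 < t -> Cmod (RtoC (j t) / (z + RtoC t))%C <= K / kap * Rpower (1 + t) (- (del + 1))).
  { intros t Ht. rewrite Cmod_div, Cmod_R by (now apply Hzt).
    specialize (HKb t Ht). specialize (Hmod t Ht).
    replace (- (del + 1)) with (- del + - (1)) by ring. rewrite Rpower_plus, (Rpower_Ropp (1 + t) 1), Rpower_1 by lra.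
    replace (K / kap * (Rpower (1 + t) (- del) * / (1 + t))) with
      (K * Rpower (1 + t) (- del) * / (kap * (1 + t))) by (field; lra).
    apply Rmult_le_compat; [apply Rabs_pos | | assumption |].
    - left. apply Rinv_0_lt_compat. apply Cmod_gt_0. now apply Hzt.
    - apply Rinv_le_contravar; [nra | assumption]. }
  assert (HKk : 0 <= K / kap) by (left; now apply Rdiv_lt_0_compat).
  assert (Ah1 : absint h1).
  { apply (absint_power h1 (K / kap) del); try assumption. intros t Ht.
    eapply Rle_trans; [apply re_le_Cmod | now apply Hb]. }
  assert (Ah2 : absint h2).
  { apply (absint_power h2 (K / kap) del); try assumption. intros t Ht.
    eapply Rle_trans; [apply Im_le_Cmod | now apply Hb]. }
  assert (Hh : forall t, 0 < t -> ((z + RtoC t) * (h1 t, h2 t))%C = RtoC (j t)).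
  { intros t Ht. replace ((h1 t, h2 t) : C) with (RtoC (j t) / (z + RtoC t))%C
      by (unfold h1, h2; now destruct (RtoC (j t) / (z + RtoC t))%C).
    field. now apply Hzt. }
  destruct (laplace_of_stieltjes j h1 h2 x y Hre Lj Ch1 Ah1 Ch2 Ah2) as [J1 J2].
  { intros t Ht. specialize (Hh t Ht). apply (f_equal Re) in Hh. simpl in Hh.
    unfold x, y, Re, Im in *. rewrite <- Hh. ring. }
  { intros t Ht. specialize (Hh t Ht). apply (f_equal Im) in Hh. simpl in Hh.
    unfold x, y, Re, Im in *. rewrite <- Hh. ring. }
  rewrite (is_int_unique h1 _ I1) in J1. rewrite (is_int_unique h2 _ I2) in J2.
  assert (Ig : forall s, 0 < s -> is_int (fun t => exp (- (s * t)) * g t) (/ cst * Lint j s)).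
  { intros s Hs. apply (is_int_ext (fun t => / cst * (exp (- (s * t)) * j t))).
    - intros t Ht. rewrite Hg by assumption. ring.
    - apply is_int_scal. now apply lap_correct. }
  assert (IL : is_RInt_gen (V := C_R_NormedModule) laplace (at_right 0) (Rbar_locally p_infty)
    (- (PI / 4) * / cst * (- PI * Re F0), - (PI / 4) * / cst * (- PI * Im F0))).
  { assert (Hphi : forall s, 0 < s -> phi s = - (PI / 4) * / cst * Lint j s).
    { intros s Hs. unfold phi. rewrite (is_int_unique _ _ (Ig s Hs)). ring. }
    assert (Hexp : forall s, Cexp (- (z * RtoC s))%C =
      (exp (- (x * s)) * cos (y * s), - (exp (- (x * s)) * sin (y * s)))).
    { intros s. unfold Cexp.
      replace (Re (- (z * RtoC s))%C) with (- (x * s)) by (unfold x; simpl; unfold Re; ring).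
      replace (Im (- (z * RtoC s))%C) with (- (y * s)) by (unfold y; simpl; unfold Im; ring).
      rewrite cos_neg, sin_neg. apply Ceq_intro; simpl; ring. }
    apply is_int_pair.
    - apply (is_int_ext (fun s => - (PI / 4) * / cst * (exp (- (x * s)) * cos (y * s) * Lint j s))).
      + intros s Hs. unfold laplace. rewrite Hexp, (Hphi s Hs). simpl. ring.
      + now apply is_int_scal.
    - apply (is_int_ext (fun s => - (PI / 4) * / cst * (- (exp (- (x * s)) * sin (y * s)) * Lint j s))).
      + intros s Hs. unfold laplace. rewrite Hexp, (Hphi s Hs). simpl. ring.
      + now apply is_int_scal. }
  split; [|split].
  - intros s Hs. eexists. now apply Ig.
  - eexists. exact IL.
  - assert (UL : int0oo (V := C_R_CompleteNormedModule) laplace = _)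
      by exact (is_RInt_gen_unique (V := C_R_CompleteNormedModule) _ _ IL).
    rewrite UL, Hlhs.
    apply Ceq_intro; rewrite ?Re_scal, ?Im_scal; simpl; unfold Re, Im; field; lra.
Qed.
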